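(* The sequences $$r_n=r_n(-1)=a_n\frac{\pi^2}{12}-b_n,\qquad \tilde r_n=\tilde r_n(-1)=a_n\frac{3\zeta(3)}2-\tilde b_n,\qquad n=0,1,\dots,$$ and the coefficients $a_n$, $b_n$ and $\tilde b_n$ satisfy the recurrence relation (displayed for $a_n$; the same relation holds with $(a_n)$ replaced by each of $(b_n)$, $(\tilde b_n)$, $(r_n)$, $(\tilde r_n)$) $$\begin{aligned}&(1457n^2-1363n+348)(n+1)^4a_{n+1}\\&\quad-(148614n^6+158202n^5-9295n^4-61894n^3-11111n^2+8932n+2784)a_n\\&\quad+(97619n^6-91321n^5-9443n^4+35343n^3-5440n^2-5678n+1768)a_{n-1}\\&\quad-3(1457n^2+1551n+442)(3n-2)(3n-4)(n-1)^2a_{n-2}=0,\qquad n=2,3,\dots,\end{aligned}$$ of order $3$, and the initial values are as follows: $$a_0=1,\quad a_1=8,\quad a_2=264,$$ $$b_0=0,\quad b_1=\frac{13}2,\quad b_2=\frac{1737}8,\qquad \tilde b_0=0,\quad \tilde b_1=\frac{29}2,\quad \tilde b_2=\frac{7617}{16}.$$ In addition, $$\limsup_{n\to\infty}|r_n|^{1/n}=\limsup_{n\to\infty}|\tilde r_n|^{1/n}=|\lambda_{1,2}|=0.51616460\dots,$$ $$\lim_{n\to\infty}|a_n|^{1/n}=\lim_{n\to\infty}|b_n|^{1/n}=\lim_{n\to\infty}|\tilde b_n|^{1/n}=\lambda_3=101.34149804\dots,$$ where $\lambda_{1,2}=0.32925097\ldots\pm i\,0.39751691\dots$ (a complex conjugate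 pair) and $\lambda_3$ are the zeros of the characteristic polynomial $\lambda^3-102\lambda^2+67\lambda-27$.
   Context: For $n=0,1,2,\dots$ let $$R_n(t)=(-1)^{n+1}\Bigl(t+\frac n2\Bigr)\frac{\bigl((t-1)\cdots(t-n)\cdot(t+n+1)\cdots(t+2n)\bigr)^2}{n!\cdot\bigl(t(t+1)\cdots(t+n)\bigr)^3},$$ with partial-fraction decomposition $$R_n(t)=\sum_{k=0}^n\Bigl(\frac{A_k}{(t+k)^3}+\frac{A_k'}{(t+k)^2}+\frac{A_k''}{t+k}\Bigr)+B(t),$$ $B(t)$ a polynomial. For $0<|z|<1$ put $$r_n(z)=\sum_{\nu=1}^\infty z^\nu R_n(\nu),\qquad \tilde r_n(z)=-\sum_{\nu=1}^\infty z^\nu\frac{dR_n(t)}{dt}\Big|_{t=\nu}.$$ These functions extend by analytic continuation to the points of $|z|\le1$ other than $z=1$; $r_n(-1)$ and $\tilde r_n(-1)$ denote the values at $z=-1$ of the continuations, i.e. the limits of $r_n(z)$, $\tilde r_n(z)$ as $z\to-1$, $z$ real, $|z|<1$. The common leading coefficient is $a_n=-\sum_{k=0}^n(-1)^kA_k'$ (it arises as the coefficient of $-\operatorname{Li}_2(-1)=\pi^2/12$ in $r_n(-1)$ and of $-2\operatorname{Li}_3(-1)=3\zeta(3)/2$ in $\tilde r_n(-1)$, where $\operatorname{Li}_s(z)=\sum_{m\ge1}z^m/m^s$), and $b_n=a_n\frac{\pi^2}{12}-r_n(-1)$, $\tilde b_n=a_n\frac{3\zeta(3)}2-\tilde r_n(-1)$,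 with $\zeta$ the Riemann zeta function. Decimals followed by dots denote truncated numerical values. *)

(* Defs.v *)
From Stdlib Require Import Reals Lra Lia List Arith ClassicalEpsilon.
From Coquelicot Require Import Coquelicot.
Open Scope R_scope.

(* f 0 * ... * f (n - 1), equal to 1 for n = 0 *)
Fixpoint rprod (f : nat -> R) (n : nat) : R :=
  match n with
  | O => 1
  | S m => rprod f m * f m
  end.

Definition Rn (n : nat) (t : R) : R :=
  (-1) ^ (n + 1) * (t + INR n / 2)
  * (rprod (fun j => t - INR (j + 1)) n
     * rprod (fun j => t + INR (n + 1 + j)) n) ^ 2
  / (INR (fact n) * rprod (fun j => t + INR j) (n + 1) ^ 3).

Definition horner (l : list R) (t : R) : R :=
  fold_right (fun c v => c + t * v) 0 l.

Definition is_poly (f : R -> R) : Prop :=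
  exists l : list R, forall t, f t = horner l t.

Definition partial_fractions (n : nat) (A A' A'' : nat -> R) (B : R -> R)
  : Prop :=
  is_poly B /\
  forall t : R, (forall k, (k <= n)%nat -> t + INR k <> 0) ->
    Rn n t = sum_f_R0 (fun k => A k / (t + INR k) ^ 3
                                + A' k / (t + INR k) ^ 2
                                + A'' k / (t + INR k)) n + B t.

Lemma is_poly_ext f g : (forall t, f t = g t) -> is_poly g -> is_poly f.
Proof.
  intros H [l Hl]; exists l; intros t; rewrite H; apply Hl.
Qed.

Lemma is_poly_const c : is_poly (fun _ => c).
Proof. exists (c :: nil); intros t; cbn; ring. Qed.

Lemma is_poly_plus f g :
  is_poly f -> is_poly g -> is_poly (fun t => f t + g t).
Proof.
  intros [l Hl] [m Hm].
  enough (H : exists p, forall t, horner l t + horner m t = horner p t).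
  { destruct H as [p Hp]; exists p; intros t; rewrite Hl, Hm; apply Hp. }
  clear; revert m; induction l as [|c l IH]; intros m.
  - exists m; intros t; cbn; ring.
  - destruct m as [|d m].
    + exists (c :: l); intros t; cbn; ring.
    + destruct (IH m) as [p Hp]; exists ((c + d) :: p); intros t.
      cbn; fold (horner l t) (horner m t) (horner p t); rewrite <- Hp; ring.
Qed.

Lemma is_poly_shift f : is_poly f -> is_poly (fun t => t * f t).
Proof.
  intros [l Hl]; exists (0 :: l); intros t; rewrite Hl; cbn; unfold horner; ring.
Qed.

Lemma is_poly_scal c f : is_poly f -> is_poly (fun t => c * f t).
Proof.
  intros [l Hl]; exists (map (Rmult c) l); intros t; rewrite Hl; clear Hl.
  induction l as [|d l IH]; cbn; [ring|].
  fold (horner l t) (horner (map (Rmult c) l) t); rewrite <- IH; ring.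
Qed.

Lemma is_poly_mult f g :
  is_poly f -> is_poly g -> is_poly (fun t => f t * g t).
Proof.
  intros [l Hl] Hg.
  apply (is_poly_ext _ (fun t => horner l t * g t)).
  { intros t; now rewrite Hl. }
  clear Hl; induction l as [|c l IH].
  - apply (is_poly_ext _ (fun _ => 0)); [intros t; cbn; ring|apply is_poly_const].
  - apply (is_poly_ext _ (fun t => c * g t + t * (horner l t * g t))).
    + intros t; cbn; unfold horner; ring.
    + apply is_poly_plus; [now apply is_poly_scal|now apply is_poly_shift].
Qed.

Lemma is_poly_affine c d : is_poly (fun t => c * t + d).
Proof. exists (d :: c :: nil); intros t; cbn; ring. Qed.

Lemma is_poly_rprod (f : R -> nat -> R) n :
  (forall j, is_poly (fun t => f t j)) -> is_poly (fun t => rprod (f t) n).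
Proof.
  intros H; induction n as [|n IH]; cbn.
  - apply is_poly_const.
  - now apply is_poly_mult.
Qed.

Lemma is_poly_divide f m :
  is_poly f -> exists q c, is_poly q /\ forall t, f t = q t * (t + m) + c.
Proof.
  intros [l Hl].
  enough (H : exists q c, is_poly q /\ forall t, horner l t = q t * (t + m) + c).
  { destruct H as (q & c & Hq & H); exists q, c; split; [easy|].
    intros t; rewrite Hl; apply H. }
  clear Hl; induction l as [|d l (q & c & Hq & H)].
  - exists (fun _ => 0), 0; split; [apply is_poly_const|intros t; cbn; ring].
  - exists (fun t => t * q t + c), (d - m * c); split.
    + apply is_poly_plus; [now apply is_poly_shift|apply is_poly_const].
    + intros t; cbn; fold (horner l t); rewrite H; ring.
Qed.

Fixpoint rsum (f : nat -> R) (n : nat) : R :=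
  match n with
  | O => 0
  | S m => rsum f m + f m
  end.

Lemma rsum_S_sum_f_R0 f n : rsum f (S n) = sum_f_R0 f n.
Proof. induction n as [|n IH]; cbn in *; [ring|now rewrite IH]. Qed.

(* pole parts of order <= 3 at 0, -1, ..., -(m-1) *)
Definition poles (A A' A'' : nat -> R) (m : nat) (t : R) : R :=
  rsum (fun k => A k / (t + INR k) ^ 3 + A' k / (t + INR k) ^ 2
                 + A'' k / (t + INR k)) m.

Definition off_poles (n : nat) (t : R) : Prop :=
  forall k, (k < n)%nat -> t + INR k <> 0.

Lemma poles_divide A A' A'' m :
  exists D D' D'' : nat -> R, forall p, (p <= m)%nat ->
  exists c, forall t, off_poles (S m) t ->
    poles A A' A'' p t / (t + INR m) = poles D D' D'' p t + c / (t + INR m).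
Proof.
  set (d := fun k => INR m - INR k).
  exists (fun k => A k / d k),
         (fun k => A' k / d k - A k / d k ^ 2),
         (fun k => A'' k / d k - A' k / d k ^ 2 + A k / d k ^ 3).
  induction p as [|p IH]; intros Hp.
  - exists 0; intros t Ht; cbn.
    assert (t + INR m <> 0) by (apply Ht; lia). now field.
  - destruct IH as [c Hc]; [lia|].
    exists (c - A'' p / d p + A' p / d p ^ 2 - A p / d p ^ 3).
    intros t Ht; specialize (Hc t Ht).
    assert (Hm : t + INR m <> 0) by (apply Ht; lia).
    assert (Hk : t + INR p <> 0) by (apply Ht; lia).
    assert (Hd : INR m - INR p <> 0).
    { assert (INR p < INR m) by (apply lt_INR; lia). lra. }
    unfold poles in *; cbn [rsum].
    rewrite Rdiv_plus_distr, Hc.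
    unfold d; field; repeat split; assumption.
Qed.

Definition decomposable (m : nat) (f : R -> R) : Prop :=
  exists A A' A'' B, is_poly B /\
    forall t, off_poles m t -> f t = poles A A' A'' m t + B t.

(* decomposable at -m too, with a pole of order <= 3 there *)
Lemma decomposable_divide3 m f :
  decomposable m f -> decomposable (S m) (fun t => f t / (t + INR m) ^ 3).
Proof.
  assert (step : forall g A A' A'' B b c, is_poly B ->
    (forall t, off_poles (S m) t -> g t = poles A A' A'' m t
       + b / (t + INR m) ^ 2 + c / (t + INR m) + B t) ->
    exists D D' D'' E e, is_poly E /\
    forall t, off_poles (S m) t -> g t / (t + INR m) = poles D D' D'' m t
       + b / (t + INR m) ^ 3 + c / (t + INR m) ^ 2 + e / (t + INR m) + E t).
  { intros g A A' A'' B b c HB Hg.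
    destruct (poles_divide A A' A'' m) as (D & D' & D'' & H).
    destruct (H m (le_n m)) as [x Hx].
    destruct (is_poly_divide B (INR m) HB) as (q & y & Hq & Hy).
    exists D, D', D'', q, (x + y); split; [easy|].
    intros t Ht.
    assert (Hm : t + INR m <> 0) by (apply Ht; lia).
    rewrite (Hg t Ht), !Rdiv_plus_distr, (Hx t Ht), Hy.
    field; assumption. }
  intros (A & A' & A'' & B & HB & Hf).
  destruct (step f A A' A'' B 0 0 HB) as (A1 & A1' & A1'' & B1 & e1 & HB1 & H1).
  { intros t Ht. rewrite Hf; [|intros k Hk; apply Ht; lia].
    assert (Hm : t + INR m <> 0) by (apply Ht; lia). field; assumption. }
  destruct (step (fun t => f t / (t + INR m)) A1 A1' A1'' B1 0 e1 HB1)
    as (A2 & A2' & A2'' & B2 & e2 & HB2 & H2).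
  { intros t Ht; rewrite (H1 t Ht).
    assert (Hm : t + INR m <> 0) by (apply Ht; lia). field; assumption. }
  destruct (step (fun t => f t / (t + INR m) / (t + INR m))
              A2 A2' A2'' B2 e1 e2 HB2)
    as (A3 & A3' & A3'' & B3 & e3 & HB3 & H3).
  { intros t Ht; rewrite (H2 t Ht).
    assert (Hm : t + INR m <> 0) by (apply Ht; lia). field; assumption. }
  set (ext := fun (F : nat -> R) (v : R) k => if Nat.eq_dec k m then v else F k).
  assert (Hext : forall t,
    poles (ext A3 e1) (ext A3' e2) (ext A3'' e3) (S m) t
    = poles A3 A3' A3'' m t + (e1 / (t + INR m) ^ 3 + e2 / (t + INR m) ^ 2
                               + e3 / (t + INR m))).
  { intros t; unfold poles; cbn [rsum].
    assert (E : forall F v, ext F v m = v).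
    { intros F v; unfold ext; destruct (Nat.eq_dec m m); congruence. }
    rewrite !E; f_equal.
    assert (E' : forall p, (p <= m)%nat -> forall F F' F'' v v' v'',
      poles (ext F v) (ext F' v') (ext F'' v'') p t = poles F F' F'' p t).
    { induction p as [|p IH]; intros Hp F F' F'' v v' v''; [easy|].
      unfold poles in *; cbn [rsum]; rewrite IH by lia.
      unfold ext; destruct (Nat.eq_dec p m); [lia|easy]. }
    apply (E' m (le_n m)). }
  exists (ext A3 e1), (ext A3' e2), (ext A3'' e3), B3; split; [easy|].
  intros t Ht; rewrite Hext.
  assert (Hm : t + INR m <> 0) by (apply Ht; lia).
  replace (f t / (t + INR m) ^ 3)
    with (f t / (t + INR m) / (t + INR m) / (t + INR m)) by (field; assumption).
  rewrite (H3 t Ht); ring.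
Qed.

Lemma decomposable_rprod f m :
  is_poly f ->
  decomposable m (fun t => f t / rprod (fun j => t + INR j) m ^ 3).
Proof.
  intros Hf; induction m as [|m IH].
  - exists (fun _ => 0), (fun _ => 0), (fun _ => 0), f; split; [easy|].
    intros t _; cbn; field.
  - destruct (decomposable_divide3 m _ IH) as (A & A' & A'' & B & HB & H).
    exists A, A', A'', B; split; [easy|]; intros t Ht; rewrite <- (H t Ht).
    assert (Hm : t + INR m <> 0) by (apply Ht; lia).
    assert (Hr : rprod (fun j => t + INR j) m <> 0).
    { assert (E : forall p, (p <= m)%nat -> rprod (fun j => t + INR j) p <> 0).
      { induction p as [|p IHp]; intros Hp; cbn; [lra|].
        apply Rmult_integral_contrapositive_currified; [apply IHp; lia|].
        apply Ht; lia. }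
      now apply E. }
    cbn [rprod]; field; split; assumption.
Qed.

Lemma partial_fractions_ex n : exists A A' A'' B, partial_fractions n A A' A'' B.
Proof.
  set (N := fun t => (-1) ^ (n + 1) / INR (fact n) * ((t + INR n / 2) *
    ((rprod (fun j => t - INR (j + 1)) n
      * rprod (fun j => t + INR (n + 1 + j)) n) *
     (rprod (fun j => t - INR (j + 1)) n
      * rprod (fun j => t + INR (n + 1 + j)) n)))).
  assert (HN : is_poly N).
  { assert (aff : forall c, is_poly (fun t => t + c)).
    { intros c; apply (is_poly_ext _ (fun t => 1 * t + c));
        [intros t; ring|apply is_poly_affine]. }
    assert (P : is_poly (fun t => rprod (fun j => t - INR (j + 1)) n
                                * rprod (fun j => t + INR (n + 1 + j)) n)).
    { apply is_poly_mult.
      - apply (is_poly_rprod (fun t j => t - INR (j + 1))).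
        intros j; apply (aff (- INR (j + 1))).
      - apply (is_poly_rprod (fun t j => t + INR (n + 1 + j))).
        intros j; apply aff. }
    unfold N; apply is_poly_scal, is_poly_mult; [apply aff|].
    now apply is_poly_mult. }
  destruct (decomposable_rprod N (n + 1) HN) as (A & A' & A'' & B & HB & H).
  exists A, A', A'', B; split; [easy|]; intros t Ht.
  assert (Ho : off_poles (n + 1) t) by (intros k Hk; apply Ht; lia).
  transitivity (N t / rprod (fun j => t + INR j) (n + 1) ^ 3).
  - assert (Hr : rprod (fun j => t + INR j) (n + 1) <> 0).
    { assert (E : forall p, (p <= n + 1)%nat ->
        rprod (fun j => t + INR j) p <> 0).
      { induction p as [|p IHp]; intros Hp; cbn; [lra|].
        apply Rmult_integral_contrapositive_currified; [apply IHp; lia|].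
        apply Ho; lia. }
      now apply E. }
    unfold Rn, N; field; split; [apply INR_fact_neq_0|assumption].
  - rewrite (H t Ho); unfold poles.
    now rewrite Nat.add_1_r, rsum_S_sum_f_R0.
Qed.

Lemma partial_fractions_ex' n :
  exists A', exists A A'' B, partial_fractions n A A' A'' B.
Proof.
  destruct (partial_fractions_ex n) as (A & A' & A'' & B & H).
  now exists A', A, A'', B.
Qed.

(* Only the values at k <= n are determined by the decomposition. *)
Definition Acoef' (n : nat) : nat -> R :=
  proj1_sig (constructive_indefinite_description _ (partial_fractions_ex' n)).

Definition rgen (n : nat) (z : R) : R :=
  Series (fun m => z ^ (m + 1) * Rn n (INR (m + 1))).

Definition rtgen (n : nat) (z : R) : R :=
  - Series (fun m => z ^ (m + 1) * Derive (Rn n) (INR (m + 1))).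

(* r_n(-1) and its tilde version: the series diverge at z = -1 for large n, so
   the values are limits as z -> -1 from inside the unit disc. *)
Definition r (n : nat) : R :=
  iota (fun l : R => filterlim (rgen n) (at_right (-1)) (locally l)).

Definition rt (n : nat) : R :=
  iota (fun l : R => filterlim (rtgen n) (at_right (-1)) (locally l)).

(* Riemann zeta at integers s >= 2 *)
Definition zeta (s : nat) : R := Series (fun m => / INR (m + 1) ^ s).

Definition a (n : nat) : R := - sum_f_R0 (fun k => (-1) ^ k * Acoef' n k) n.

Definition b (n : nat) : R := a n * (PI ^ 2 / 12) - r n.

Definition bt (n : nat) : R := a n * (3 * zeta 3 / 2) - rt n.

Definition recurrence (u : nat -> R) : Prop :=
  forall n : nat, (2 <= n)%nat ->
  let x := INR n in
  (1457 * x ^ 2 - 1363 * x + 348) * (x + 1) ^ 4 * u (n + 1)%nat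
  - (148614 * x ^ 6 + 158202 * x ^ 5 - 9295 * x ^ 4 - 61894 * x ^ 3
     - 11111 * x ^ 2 + 8932 * x + 2784) * u n
  + (97619 * x ^ 6 - 91321 * x ^ 5 - 9443 * x ^ 4 + 35343 * x ^ 3
     - 5440 * x ^ 2 - 5678 * x + 1768) * u (n - 1)%nat
  - 3 * (1457 * x ^ 2 + 1551 * x + 442) * (3 * x - 2) * (3 * x - 4)
    * (x - 1) ^ 2 * u (n - 2)%nat = 0.

Definition charpoly (x : C) : C :=
  (x * x * x - RtoC 102 * (x * x) + RtoC 67 * x - RtoC 27)%C.

(* |x|^(1/n), with value 0 at x = 0 (and irrelevant at n = 0); [Rpower] alone would give 1 there because
   [ln 0 = 0] in the library. *)
Definition abs_root (n : nat) (x : R) : R :=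
  if Req_EM_T x 0 then 0 else Rpower (Rabs x) (/ INR n).

(* q >= 0 is x truncated to eight decimals *)
Definition trunc8 (x q : R) : Prop := q <= x < q + / 10 ^ 8.

(* Main.v *)
Require Import Defs.
From Stdlib Require Import Reals Lra Lia Psatz Arith List ClassicalEpsilon.
From Coquelicot Require Import Coquelicot.
(* Makes Rn denote the rational function again. *)
Import Defs.
Open Scope R_scope.

(** Recurrences.  Two linear functionals of a rational function f are at work:
    the value at z = -1 of the sum of z^nu f(nu), and the alternating sum of the
    double-pole coefficients of f.  Both change sign when f(t) is replaced by
    f(t + 1), the first up to the boundary term f(1).  Hence if the recurrence
    applied to n -> R_n(t) equals S(t + 1) + S(t) for a rational function S with a
    double zero at t = 1, then r_n, its derivative companion and a_n all satisfy
    the recurrence.  Such an S is exhibited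
    ([Sn], [telescoping], [Sn_1]); b_n and its companion follow by linearity.

    Existence of the values at -1.  The generating function of the differences
    determines that of f near -1 ([abel_diff]), since 1 - z does not vanish there.
    Enough differences make any partial-fraction sum absolutely summable.

    Initial values.  For n <= 2 the decompositions are explicit and the values
    reduce to eta(2) and eta(3).  The first needs zeta(2), obtained by summing
    1/sin^2 + 1/cos^2 over dyadic angles ([sum_inv_sin_sq]).

    Growth of a_n, b_n.  Quotients of consecutive terms iterate the map
    x -> 102 - 67/x + 27/x^2 up to a vanishing error; the initial values put them
    where this map is a contraction, so they tend to the real zero ([ratio_lim]).

    Size of r_n.  It is enough to know that r_n = o(a_n): then the solution lies
    in the plane belonging to the complex zeros.  Dividing out the dominant
    solution a_n leaves a recurrence of order two with complex limiting roots,
    for which an asymptotically invariant definite quadratic form gives the exact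
    exponential rate of every nonzero solution ([recessive_limsup]); r_n does not
    vanish identically as r_0 is a zeta value.

    The bound r_n = O(n 15^n), against a_n >= 30^(n-1), cannot be had termwise,
    because the series at -1 diverges for large n.  At nu = n + 1 + m the summand
    is, up to sign, P(m) u(m) with P a polynomial that has nonnegative coordinates
    in the basis m choose i, and u a completely monotone sequence.  On such u the shift T behaves like a number
    in [0, 1], so the alternating sum of (m choose i) u(m), which is
    (-T)^i (1 + T)^(-i-1) u at 0, is at most 2^-i u(0) in size.  Summing up, the
    value is bounded by u(0) times the positive convergent series of P(m) 3^-m
    ([bin_pos_bound]), and this is estimated by elementary bounds for binomial
    coefficients ([Rpoly_le]).  The derivative of R_n is treated in the same way
    through its logarithmic derivative. *)

(** * Limits of power series at -1 *)

Lemma ex_series_dom (a b : nat -> R) :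
  (forall m, Rabs (a m) <= b m) -> ex_series b -> ex_series a.
Proof. exact (ex_series_le (K := R_AbsRing) (V := R_CompleteNormedModule) a b). Qed.

Lemma Series_nonneg (a : nat -> R) : (forall m, 0 <= a m) -> ex_series a -> 0 <= Series a.
Proof.
  intros Ha Hex. replace 0 with (Series (fun _ => 0 * 0)) by (rewrite Series_scal_l; ring).
  apply Series_le; [|easy]. intros m; generalize (Ha m); lra.
Qed.

Lemma ex_derive_cont (f : R -> R) x : ex_derive f x -> continuous f x.
Proof. exact (ex_derive_continuous (K := R_AbsRing) (V := R_NormedModule) f x). Qed.

Definition poly_growth (f : nat -> R) : Prop :=
  exists C k, forall m, Rabs (f m) <= C * (INR m + 1) ^ k.

Lemma INR1_ge m : 1 <= INR m + 1.
Proof. generalize (pos_INR m); lra. Qed.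

Lemma poly_growth_const_nonneg f C k :
  (forall m, Rabs (f m) <= C * (INR m + 1) ^ k) -> 0 <= C.
Proof.
  intros H. generalize (H 0%nat), (Rabs_pos (f 0%nat)).
  replace (INR 0 + 1) with 1 by (cbn; ring). rewrite pow1. lra.
Qed.

Lemma poly_growth_weaken f C k k' : (k <= k')%nat ->
  (forall m, Rabs (f m) <= C * (INR m + 1) ^ k) ->
  forall m, Rabs (f m) <= C * (INR m + 1) ^ k'.
Proof.
  intros Hk H m.
  apply (Rle_trans _ _ _ (H m)).
  assert (HC := poly_growth_const_nonneg _ _ _ H).
  apply Rmult_le_compat_l; [easy|].
  apply Rle_pow; [apply INR1_ge|easy].
Qed.

Lemma poly_growth_ext f g : (forall m, f m = g m) -> poly_growth f -> poly_growth g.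
Proof. intros E (C & k & H); exists C, k; intros m; rewrite <- E; apply H. Qed.

Lemma poly_growth_plus f g : poly_growth f -> poly_growth g -> poly_growth (fun m => f m + g m).
Proof.
  intros (C & k & H) (C' & k' & H').
  exists (C + C'), (k + k')%nat; intros m.
  apply (poly_growth_weaken f C k (k + k')) with (m := m) in H; [|lia].
  apply (poly_growth_weaken g C' k' (k + k')) with (m := m) in H'; [|lia].
  generalize (Rabs_triang (f m) (g m)); lra.
Qed.

Lemma poly_growth_mult f g : poly_growth f -> poly_growth g -> poly_growth (fun m => f m * g m).
Proof.
  intros (C & k & H) (C' & k' & H').
  exists (C * C'), (k + k')%nat; intros m.
  rewrite Rabs_mult, pow_add.
  replace (C * C' * ((INR m + 1) ^ k * (INR m + 1) ^ k'))
    with ((C * (INR m + 1) ^ k) * (C' * (INR m + 1) ^ k')) by ring.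
  apply Rmult_le_compat; auto using Rabs_pos.
Qed.

Lemma poly_growth_bounded f M : (forall m, Rabs (f m) <= M) -> poly_growth f.
Proof. intros H; exists M, 0%nat; intros m; cbn; rewrite Rmult_1_r; apply H. Qed.

Lemma poly_growth_const c : poly_growth (fun _ => c).
Proof. apply (poly_growth_bounded _ (Rabs c)); intros _; apply Rle_refl. Qed.

Lemma poly_growth_INR : poly_growth INR.
Proof.
  exists 1, 1%nat; intros m; rewrite Rabs_pos_eq by apply pos_INR; lra.
Qed.

Lemma poly_growth_S f : poly_growth f -> poly_growth (fun m => f (S m)).
Proof.
  intros (C & k & H).
  assert (HC := poly_growth_const_nonneg _ _ _ H).
  exists (C * 2 ^ k), k; intros m.
  apply (Rle_trans _ _ _ (H (S m))).
  rewrite Rmult_assoc, <- Rpow_mult_distr.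
  apply Rmult_le_compat_l; [easy|].
  apply pow_incr. rewrite S_INR. generalize (pos_INR m); lra.
Qed.

Lemma is_lim_seq_pow u (l : R) k :
  is_lim_seq u l -> is_lim_seq (fun m => u m ^ k) (l ^ k).
Proof.
  intros H; induction k as [|k IH]; cbn; [apply is_lim_seq_const|].
  now apply is_lim_seq_mult'.
Qed.

Lemma is_lim_seq_inv_INR1 : is_lim_seq (fun m => / (INR m + 1)) 0.
Proof.
  apply (is_lim_seq_ext (fun m => / INR (S m))).
  { intros m; now rewrite S_INR. }
  apply (is_lim_seq_incr_1 (fun m => / INR m)).
  replace (Finite 0) with (Rbar_inv p_infty) by easy.
  apply is_lim_seq_inv; [apply is_lim_seq_INR|easy].
Qed.

(** Ratio test against (m+1)^k z^m. *)
Lemma poly_growth_ex_series_abs f z : poly_growth f -> 0 < Rabs z < 1 ->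
  ex_series (fun m => Rabs (z ^ m * f m)).
Proof.
  intros (C & k & H) [Hz0 Hz].
  assert (z <> 0) by (intros ->; rewrite Rabs_R0 in Hz0; lra).
  apply (ex_series_dom _ (fun m => C * Rabs ((INR m + 1) ^ k * z ^ m))).
  { intros m; rewrite Rabs_Rabsolu, !Rabs_mult.
    rewrite (Rabs_pos_eq ((INR m + 1) ^ k)) by (apply pow_le; generalize (INR1_ge m); lra).
    generalize (H m), (Rabs_pos (z ^ m)); nra. }
  apply (ex_series_scal_l C (fun m => Rabs ((INR m + 1) ^ k * z ^ m))).
  apply (ex_series_DAlembert _ (Rabs z)); [easy| |].
  - intros m; apply Rmult_integral_contrapositive_currified; apply pow_nonzero; [|easy].
    generalize (INR1_ge m); lra.
  - apply (is_lim_seq_ext (fun m => (1 + / (INR m + 1)) ^ k * Rabs z)).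
    + intros m.
      assert (Hm := INR1_ge m).
      replace ((INR (S m) + 1) ^ k * z ^ S m / ((INR m + 1) ^ k * z ^ m))
        with ((1 + / (INR m + 1)) ^ k * z).
      * rewrite Rabs_mult. f_equal. symmetry; apply Rabs_pos_eq, pow_le.
        assert (0 < / (INR m + 1)) by (apply Rinv_0_lt_compat; lra). lra.
      * replace (1 + / (INR m + 1)) with ((INR (S m) + 1) / (INR m + 1))
          by (rewrite S_INR; field; lra).
        unfold Rdiv at 1; rewrite Rpow_mult_distr, pow_inv. cbn [pow].
        field; split; apply pow_nonzero; lra.
    + replace (Finite (Rabs z)) with (Finite ((1 + 0) ^ k * Rabs z))
        by (rewrite Rplus_0_r, pow1; f_equal; ring).
      apply is_lim_seq_mult'; [|apply is_lim_seq_const].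
      apply is_lim_seq_pow, is_lim_seq_plus'; [apply is_lim_seq_const|].
      apply is_lim_seq_inv_INR1.
Qed.

Lemma poly_growth_ex_series f z : poly_growth f -> 0 < Rabs z < 1 ->
  ex_series (fun m => z ^ m * f m).
Proof. intros H Hz; now apply ex_series_Rabs, poly_growth_ex_series_abs. Qed.

Definition gser (f : nat -> R) (z : R) : R := Series (fun m => z ^ m * f m).

(** The value at -1 of the continuation of the generating function of f, as a
    radial limit.  The growth condition gives absolute convergence inside the
    disc, so there the series may be manipulated freely. *)
Definition abel (f : nat -> R) (l : R) : Prop :=
  poly_growth f /\ filterlim (gser f) (at_right (-1)) (locally l).

Lemma near_m1 (P : R -> Prop) :
  (forall z, -1 < z < 0 -> P z) -> at_right (-1) P.
Proof.
  intros H; exists (mkposreal 1 Rlt_0_1); intros z Hz Hz'.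
  apply H; split; [easy|]. unfold ball in Hz; cbn in Hz.
  unfold AbsRing_ball, abs, minus, plus, opp in Hz; cbn in Hz.
  apply Rabs_def2 in Hz; lra.
Qed.

Lemma near_m1_abs z : -1 < z < 0 -> 0 < Rabs z < 1.
Proof. intros H; rewrite Rabs_left; lra. Qed.

Lemma filterlim_Rplus {T} (F : (T -> Prop) -> Prop) {FF : Filter F} (f g : T -> R) x y :
  filterlim f F (locally x) -> filterlim g F (locally y) ->
  filterlim (fun t => f t + g t) F (locally (x + y)).
Proof.
  intros Hf Hg. apply (filterlim_comp_2 f g Rplus Hf Hg).
  apply (filterlim_plus (K := R_AbsRing) (V := R_NormedModule)).
Qed.

Lemma filterlim_Rmult {T} (F : (T -> Prop) -> Prop) {FF : Filter F} (f g : T -> R) x y :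
  filterlim f F (locally x) -> filterlim g F (locally y) ->
  filterlim (fun t => f t * g t) F (locally (x * y)).
Proof.
  intros Hf Hg. apply (filterlim_comp_2 f g Rmult Hf Hg).
  apply (filterlim_mult (K := R_AbsRing)).
Qed.

Lemma filterlim_near_m1 (g : R -> R) : continuous g (-1) ->
  filterlim g (at_right (-1)) (locally (g (-1))).
Proof.
  intros H P HP. apply (filter_imp (F := locally (-1)) (fun x => P (g x))).
  - intros x Hx _; exact Hx.
  - exact (H P HP).
Qed.

Lemma abel_ext f g l : (forall m, f m = g m) -> abel f l -> abel g l.
Proof.
  intros E [H1 H2]; split; [exact (poly_growth_ext f g E H1)|].
  apply (filterlim_ext (gser f)); [|easy].
  intros z; apply Series_ext; intros m; now rewrite E.
Qed.

Lemma abel_unique f l l' : abel f l -> abel f l' -> l = l'.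
Proof.
  intros [_ H] [_ H'].
  exact (filterlim_locally_unique (K := R_AbsRing) (V := R_NormedModule) _ _ _ H H').
Qed.

Lemma abel_plus f g l l' : abel f l -> abel g l' -> abel (fun m => f m + g m) (l + l').
Proof.
  intros [H1 H2] [H1' H2']; split; [now apply poly_growth_plus|].
  apply (filterlim_ext_loc (fun z => gser f z + gser g z)).
  - apply near_m1; intros z Hz; apply near_m1_abs in Hz. unfold gser.
    rewrite <- Series_plus by now apply poly_growth_ex_series.
    apply Series_ext; intros m; ring.
  - apply filterlim_Rplus; [apply _|easy|easy].
Qed.

Lemma abel_scal c f l : abel f l -> abel (fun m => c * f m) (c * l).
Proof.
  intros [H1 H2]; split; [apply poly_growth_mult; [apply poly_growth_const|easy]|].
  apply (filterlim_ext (fun z => c * gser f z)).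
  - intros z; unfold gser. rewrite <- Series_scal_l.
    apply Series_ext; intros m; ring.
  - apply filterlim_Rmult; [apply _|apply filterlim_const|easy].
Qed.

Lemma gser_S f z : poly_growth f -> 0 < Rabs z < 1 ->
  gser f z = f 0%nat + z * gser (fun m => f (S m)) z.
Proof.
  intros Hf Hz; unfold gser at 1.
  rewrite Series_incr_1 by now apply poly_growth_ex_series.
  unfold gser; rewrite <- Series_scal_l; f_equal; [cbn; ring|].
  apply Series_ext; intros m; cbn; ring.
Qed.

(** F(z) = f(0) + z F_1(z) for the generating function F_1 of the shifted
    sequence, evaluated at z = -1. *)
Lemma abel_S f l : abel f l -> abel (fun m => f (S m)) (f 0%nat - l).
Proof.
  intros [H1 H2]; split; [now apply poly_growth_S|].
  apply (filterlim_ext_loc (fun z => (gser f z + - f 0%nat) * / z)).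
  - apply near_m1; intros z Hz. rewrite (gser_S f) by (auto using near_m1_abs).
    field; lra.
  - replace (f 0%nat - l) with ((l + - f 0%nat) * / -1) by field.
    apply filterlim_Rmult; [apply _| |].
    + apply filterlim_Rplus; [apply _|easy|apply filterlim_const].
    + apply (filterlim_near_m1 Rinv).
      apply ex_derive_cont.
      auto_derive; lra.
Qed.

(** (1 - z) F(z) = f(0) + z (generating function of the differences), and
    1 - z does not vanish at -1: one summation by parts of Euler's transform. *)
Lemma abel_diff f l : poly_growth f -> abel (fun m => f (S m) - f m) l ->
  abel f ((f 0%nat - l) / 2).
Proof.
  intros Hf [_ H]; split; [easy|].
  apply (filterlim_ext_loc
    (fun z => (f 0%nat + z * gser (fun m => f (S m) - f m) z) * / (1 - z))).
  - apply near_m1; intros z Hz.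
    assert (E : gser (fun m => f (S m) - f m) z = gser (fun m => f (S m)) z - gser f z).
    { unfold gser. rewrite <- Series_minus
        by (apply poly_growth_ex_series; auto using near_m1_abs, poly_growth_S).
      apply Series_ext; intros m; ring. }
    assert (E' := gser_S f z Hf (near_m1_abs z Hz)).
    rewrite E, Rmult_minus_distr_l.
    replace (z * gser (fun m => f (S m)) z) with (gser f z - f 0%nat) by (rewrite E'; ring).
    field; lra.
  - replace ((f 0%nat - l) / 2) with ((f 0%nat + -1 * l) * / (1 - -1)) by field.
    apply filterlim_Rmult; [apply _| |].
    + apply filterlim_Rplus; [apply _|apply filterlim_const|].
      apply filterlim_Rmult; [apply _| |easy].
      apply (filterlim_near_m1 (fun z => z)), continuous_id.
    + apply (filterlim_near_m1 (fun z => / (1 - z))).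
      apply ex_derive_cont.
      auto_derive; lra.
Qed.

Lemma ex_series_inv_sq : ex_series (fun m => / (INR m + 1) ^ 2).
Proof.
  apply (ex_series_dom _ (fun m => 2 * (/ (INR m + 1) - / (INR m + 2)))).
  { intros m. assert (Hm := INR1_ge m).
    rewrite Rabs_pos_eq.
    - replace (2 * (/ (INR m + 1) - / (INR m + 2)))
        with (2 / ((INR m + 1) * (INR m + 2))) by (field; lra).
      apply Rmult_le_reg_l with ((INR m + 1) * (INR m + 1) * (INR m + 2)); [nra|].
      field_simplify; [|lra|lra]. nra.
    - apply Rlt_le, Rinv_0_lt_compat; nra. }
  apply (ex_series_scal_l 2 (fun m => / (INR m + 1) - / (INR m + 2))).
  exists 1.
  change (is_lim_seq (sum_n (fun m => / (INR m + 1) - / (INR m + 2))) 1).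
  apply (is_lim_seq_ext (fun n => 1 - / (INR (S n) + 1))).
  { intros n; rewrite S_INR; induction n as [|n IH].
    - rewrite sum_O; cbn; field.
    - rewrite sum_Sn, <- IH; unfold plus; cbn -[INR]; rewrite S_INR.
      generalize (INR1_ge n); intros; field; lra. }
  replace (Finite 1) with (Finite (1 - 0)) by (f_equal; ring).
  apply is_lim_seq_minus'; [apply is_lim_seq_const|].
  apply (is_lim_seq_incr_1 (fun n => / (INR n + 1))), is_lim_seq_inv_INR1.
Qed.

Lemma continuous_sum_f_R0 (f : nat -> R -> R) n x :
  (forall k, continuous (f k) x) -> continuous (fun t => sum_f_R0 (fun k => f k t) n) x.
Proof.
  intros H; induction n as [|n IH]; cbn; [apply H|].
  apply (continuous_plus (fun t => sum_f_R0 (fun k => f k t) n)); auto.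
Qed.

Lemma ex_series_dom_sq f C : (forall m, Rabs (f m) <= C / (INR m + 1) ^ 2) ->
  ex_series (fun m => Rabs (f m)).
Proof.
  intros H.
  apply (ex_series_dom _ (fun m => C * / (INR m + 1) ^ 2)).
  { intros m; rewrite Rabs_Rabsolu; apply H. }
  apply (ex_series_scal_l C (fun m => / (INR m + 1) ^ 2)), ex_series_inv_sq.
Qed.

(** Abel's theorem for an absolutely convergent series. *)
Lemma abel_dom_sq f C : (forall m, Rabs (f m) <= C / (INR m + 1) ^ 2) ->
  abel f (gser f (-1)).
Proof.
  intros H. split.
  { apply (poly_growth_bounded _ C); intros m; apply (Rle_trans _ _ _ (H m)).
    assert (Hm := INR1_ge m).
    assert (0 <= C).
    { generalize (H 0%nat), (Rabs_pos (f 0%nat)); cbn; lra. }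
    assert (/ (INR m + 1) ^ 2 <= 1).
    { rewrite <- Rinv_1; apply Rinv_le_contravar; nra. }
    unfold Rdiv; nra. }
  assert (Hs := ex_series_dom_sq f C H).
  set (a := fun m => Rabs (f m)) in *.
  apply filterlim_locally; intros eps.
  assert (He : 0 < eps / 4) by (destruct eps; cbn; lra).
  assert (HN : exists N, Series (fun k => a (S N + k)%nat) < eps / 4).
  { assert (L := Series_correct _ Hs).
    change (is_lim_seq (sum_n a) (Series a)) in L.
    apply is_lim_seq_spec in L. destruct (L (mkposreal _ He)) as [N HN].
    exists N. specialize (HN N (le_n N)). cbn [pos] in HN.
    rewrite (Series_incr_n a (S N)) in HN by (auto; lia). cbn [Init.Nat.pred] in HN.
    rewrite sum_n_Reals in HN. apply Rabs_def2 in HN. lra. }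
  destruct HN as [N HN].
  set (p := fun z => sum_f_R0 (fun k => z ^ k * f k) N).
  assert (Hp : forall z, -1 <= z < 0 -> Rabs (gser f z - p z) < eps / 4).
  { intros z Hz.
    assert (Hle : forall m, Rabs (z ^ m * f m) <= a m).
    { intros m; rewrite Rabs_mult, <- RPow_abs; unfold a.
      assert (0 <= Rabs z ^ m <= 1).
      { split; [apply pow_le, Rabs_pos|].
        rewrite <- (pow1 m); apply pow_incr; split; [apply Rabs_pos|].
        rewrite Rabs_left; lra. }
      generalize (Rabs_pos (f m)); nra. }
    assert (Hex : ex_series (fun m => z ^ m * f m)).
    { exact (ex_series_dom _ a Hle Hs). }
    unfold gser; rewrite (Series_incr_n _ (S N)) by (auto; lia).
    cbn [Init.Nat.pred]. fold (p z).
    replace (p z + _ - p z)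
      with (Series (fun k => z ^ (S N + k) * f (S N + k)%nat)) by ring.
    assert (Ht : ex_series (fun k => a (S N + k)%nat))
      by now apply (ex_series_incr_n a).
    apply (Rle_lt_trans _ (Series (fun k => a (S N + k)%nat))); [|easy].
    apply (Rle_trans _ (Series (fun k => Rabs (z ^ (S N + k) * f (S N + k)%nat)))).
    - apply Series_Rabs.
      apply (ex_series_dom _ (fun k => a (S N + k)%nat)); [|exact Ht].
      intros m. rewrite Rabs_Rabsolu. apply Hle.
    - apply Series_le; [|exact Ht]. intros k; split; [apply Rabs_pos|apply Hle]. }
  assert (Hc : filterlim p (at_right (-1)) (locally (p (-1)))).
  { apply filterlim_near_m1, (continuous_sum_f_R0 (fun k z => z ^ k * f k)).
    intros k. apply ex_derive_cont.
    auto_derive; easy. }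
  assert (Hc' := proj1 (filterlim_locally p (p (-1))) Hc (mkposreal _ He)).
  assert (Hn : at_right (-1) (fun z => -1 < z < 0)) by now apply near_m1.
  generalize (filter_and _ _ Hc' Hn); apply filter_imp; intros z [H1 H2].
  assert (B1 := Hp z ltac:(lra)). assert (B2 := Hp (-1) ltac:(lra)).
  change (Rabs (p z - p (-1)) < eps / 4) in H1.
  change (Rabs (gser f z - gser f (-1)) < eps).
  replace (gser f z - gser f (-1))
    with ((gser f z - p z) + (p z - p (-1)) - (gser f (-1) - p (-1))) by ring.
  eapply Rle_lt_trans; [apply Rabs_triang|].
  rewrite Rabs_Ropp.
  eapply Rle_lt_trans; [apply Rplus_le_compat_r, Rabs_triang|]. lra.
Qed.

Lemma poly_growth_inv c : 0 < c -> poly_growth (fun m => / (INR m + c)).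
Proof.
  intros Hc; apply (poly_growth_bounded _ (/ c)); intros m.
  generalize (pos_INR m); intros Hm.
  rewrite Rabs_pos_eq by (apply Rlt_le, Rinv_0_lt_compat; lra).
  apply Rinv_le_contravar; lra.
Qed.

Lemma inv_le_mult c m : 0 < c -> / (INR m + c) <= (1 + / c) / (INR m + 1).
Proof.
  intros Hc. generalize (pos_INR m); intros Hm.
  assert (0 < / c) by now apply Rinv_0_lt_compat.
  apply Rmult_le_reg_l with ((INR m + c) * (INR m + 1)); [nra|].
  replace ((INR m + c) * (INR m + 1) * / (INR m + c)) with (INR m + 1) by (field; lra).
  replace ((INR m + c) * (INR m + 1) * ((1 + / c) / (INR m + 1)))
    with (INR m + c + INR m * / c + c * / c) by (field; lra).
  rewrite Rinv_r by lra. nra.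
Qed.

Lemma dom_sq_inv c k : 0 < c -> exists C, forall m,
  Rabs (/ (INR m + c) ^ (2 + k)) <= C / (INR m + 1) ^ 2.
Proof.
  intros Hc. exists ((1 + / c) ^ 2 * (/ c) ^ k); intros m.
  assert (Hm := pos_INR m).
  assert (H0 : 0 < / (INR m + c)) by (apply Rinv_0_lt_compat; lra).
  rewrite <- pow_inv, pow_add, Rabs_pos_eq by (apply Rmult_le_pos; apply pow_le; lra).
  replace ((1 + / c) ^ 2 * (/ c) ^ k / (INR m + 1) ^ 2)
    with (((1 + / c) / (INR m + 1)) ^ 2 * (/ c) ^ k) by (field; split; [|lra]; lra).
  apply Rmult_le_compat; try (apply pow_le; lra).
  - apply pow_incr; split; [lra|now apply inv_le_mult].
  - apply pow_incr; split; [lra|apply Rinv_le_contravar; lra].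
Qed.

(** For exponent 1 the series at -1 converges only conditionally; one summation
    by parts makes it absolutely convergent. *)
Lemma abel_inv c k : 0 < c ->
  exists l, abel (fun m => / (INR m + c) ^ S k) l.
Proof.
  intros Hc. destruct k as [|k].
  - destruct (dom_sq_inv c 0 Hc) as [C HC].
    assert (HD : forall m, Rabs (/ (INR (S m) + c) ^ 1 - / (INR m + c) ^ 1)
                           <= C / (INR m + 1) ^ 2).
    { intros m. eapply Rle_trans; [|apply HC].
      assert (Hm := pos_INR m).
      rewrite S_INR. replace (/ (INR m + 1 + c) ^ 1 - / (INR m + c) ^ 1)
        with (- / ((INR m + c) * (INR m + 1 + c))) by (field; lra).
      rewrite Rabs_Ropp, !Rabs_pos_eq; [|apply Rlt_le, Rinv_0_lt_compat; cbn; nra..].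
      apply Rinv_le_contravar; cbn; nra. }
    eexists. apply (abel_diff (fun m => / (INR m + c) ^ 1));
      [|exact (abel_dom_sq _ C HD)].
    apply (poly_growth_ext (fun m => / (INR m + c))); [|now apply poly_growth_inv].
    intros m; now rewrite pow_1.
  - destruct (dom_sq_inv c k Hc) as [C HC]. eexists.
    exact (abel_dom_sq _ C HC).
Qed.

(** Polynomial sequences, seen through their differences: the form in which
    summation by parts applies to them. *)
Fixpoint fin_diff (k : nat) (f : nat -> R) : Prop :=
  match k with
  | O => forall m, f m = 0
  | S k => fin_diff k (fun m => f (S m) - f m)
  end.

Lemma fin_diff_ext k f g : (forall m, f m = g m) -> fin_diff k f -> fin_diff k g.
Proof.
  revert f g; induction k as [|k IH]; cbn; intros f g E H.
  - intros m; now rewrite <- E.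
  - apply (IH (fun m => f (S m) - f m)); [|easy]. intros m; now rewrite !E.
Qed.

Lemma fin_diff_plus k f g : fin_diff k f -> fin_diff k g ->
  fin_diff k (fun m => f m + g m).
Proof.
  revert f g; induction k as [|k IH]; cbn; intros f g Hf Hg.
  - intros m; rewrite Hf, Hg; ring.
  - eapply fin_diff_ext; [|exact (IH _ _ Hf Hg)]. intros m; cbn; ring.
Qed.

Lemma fin_diff_S k f : fin_diff k f -> fin_diff k (fun m => f (S m)).
Proof.
  revert f; induction k as [|k IH]; cbn; intros f Hf; [easy|].
  now apply (IH (fun m => f (S m) - f m)).
Qed.

Lemma fin_diff_INR c k f : fin_diff k f -> fin_diff (S k) (fun m => (INR m + c) * f m).
Proof.
  revert f; induction k as [|k IH]; intros f Hf.
  - cbn in *; intros m; rewrite !Hf; ring.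
  - change (fin_diff (S k) (fun m => (INR (S m) + c) * f (S m) - (INR m + c) * f m)).
    apply (fin_diff_ext _ (fun m => (INR m + c) * (f (S m) - f m) + f (S m))).
    + intros m; rewrite S_INR; ring.
    + apply fin_diff_plus; [now apply (IH (fun m => f (S m) - f m))|].
      now apply (fin_diff_S (S k)).
Qed.

Lemma fin_diff_abel k f : poly_growth f -> fin_diff k f -> exists l, abel f l.
Proof.
  revert f; induction k as [|k IH]; cbn; intros f Hp Hf.
  - exists (gser f (-1)). apply (abel_dom_sq _ 0).
    intros m; rewrite Hf, Rabs_R0; unfold Rdiv; lra.
  - destruct (IH (fun m => f (S m) - f m)) as [l Hl]; [|easy|].
    + apply (poly_growth_ext (fun m => f (S m) + -1 * f m)); [intros; ring|].
      apply poly_growth_plus; [now apply poly_growth_S|].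
      apply poly_growth_mult; [apply poly_growth_const|easy].
    + exists ((f 0%nat - l) / 2); now apply abel_diff.
Qed.

Lemma abel_horner l c : exists v, abel (fun m => horner l (INR m + c)) v.
Proof.
  assert (H : poly_growth (fun m => horner l (INR m + c)) /\
              exists k, fin_diff k (fun m => horner l (INR m + c))).
  { induction l as [|d l [IH [k IHk]]].
    - split; [apply (poly_growth_const 0)|]. now exists 0%nat.
    - split.
      + apply (poly_growth_plus (fun _ => d)); [apply poly_growth_const|].
        apply poly_growth_mult; [|exact IH].
        apply poly_growth_plus; [apply poly_growth_INR|apply poly_growth_const].
      + exists (S k). apply (fin_diff_plus (S k) (fun _ => d)).
        * clear. assert (H : forall j, fin_diff j (fun _ => 0)).
          { intros j; induction j as [|j IH]; cbn; [reflexivity|].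
            apply (fin_diff_ext _ (fun _ => 0)); [intros; ring|exact IH]. }
          cbn. apply (fin_diff_ext _ (fun _ => 0)); [intros; ring|apply H].
        * now apply fin_diff_INR. }
  destruct H as [H [k Hk]]. exact (fin_diff_abel k _ H Hk).
Qed.

Lemma abel_poly B c : is_poly B -> exists v, abel (fun m => B (INR m + c)) v.
Proof.
  intros [l Hl]. destruct (abel_horner l c) as [v Hv]; exists v.
  now apply (abel_ext (fun m => horner l (INR m + c))).
Qed.

Lemma is_derive_horner l : exists l', forall t, is_derive (horner l) t (horner l' t).
Proof.
  induction l as [|c l [l' IH]].
  - exists nil; intros t. apply (is_derive_const (K := R_AbsRing) (V := R_NormedModule) 0).
  - destruct (is_poly_plus (horner l) (fun t => t * horner l' t)) as [p Hp].
    + now exists l.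
    + apply is_poly_shift; now exists l'.
    + exists p; intros t. rewrite <- Hp.
      change (is_derive (fun t => c + t * horner l t) t (horner l t + t * horner l' t)).
      specialize (IH t).
      auto_derive; [now exists (horner l' t)|].
      replace (Derive (fun t => horner l t) t) with (horner l' t)
        by (symmetry; exact (is_derive_unique _ t _ IH)).
      ring.
Qed.

Lemma is_derive_poly B : is_poly B ->
  exists B', is_poly B' /\ forall t, is_derive B t (B' t).
Proof.
  intros [l Hl]. destruct (is_derive_horner l) as [l' H'].
  exists (horner l'); split; [now exists l'|]. intros t.
  apply (is_derive_ext (horner l)); [intros; now rewrite Hl|apply H'].
Qed.

Definition dpoles (A A' A'' : nat -> R) (m : nat) (t : R) : R :=
  rsum (fun k => -3 * A k / (t + INR k) ^ 4 + -2 * A' k / (t + INR k) ^ 3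
                 + - A'' k / (t + INR k) ^ 2) m.

Lemma is_derive_poles A A' A'' m t : 0 < t ->
  is_derive (poles A A' A'' m) t (dpoles A A' A'' m t).
Proof.
  intros Ht; induction m as [|m IH].
  - apply (is_derive_const (K := R_AbsRing) (V := R_NormedModule) 0).
  - apply (is_derive_plus (K := R_AbsRing) (V := R_NormedModule)
      (poles A A' A'' m)); [exact IH|].
    assert (0 < t + INR m) by (generalize (pos_INR m); lra).
    assert (Hn : t + INR m <> 0) by lra.
    auto_derive; [|field; exact Hn].
    repeat split; repeat apply Rmult_integral_contrapositive_currified; auto with real.
Qed.

Lemma off_poles_pos m t : 0 < t -> off_poles m t.
Proof. intros Ht k _; generalize (pos_INR k); lra. Qed.

Lemma locally_pos (P : R -> Prop) t : 0 < t -> (forall s, 0 < s -> P s) -> locally t P.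
Proof.
  intros Ht H; exists (mkposreal t Ht); intros s Hs; apply H.
  unfold ball in Hs; cbn in Hs.
  unfold AbsRing_ball, abs, minus, plus, opp in Hs; cbn in Hs.
  apply Rabs_def2 in Hs; lra.
Qed.

Lemma decomposable_derive m f : decomposable m f ->
  forall t, 0 < t -> ex_derive f t.
Proof.
  intros (A & A' & A'' & B & HB & H) t Ht.
  destruct (is_derive_poly B HB) as (B' & HB' & HD).
  exists (dpoles A A' A'' m t + B' t).
  apply (is_derive_ext_loc (fun t => poles A A' A'' m t + B t)).
  - apply locally_pos; [easy|]. intros s Hs; symmetry; apply H, off_poles_pos, Hs.
  - apply (is_derive_plus (K := R_AbsRing) (V := R_NormedModule)); [|easy].
    now apply is_derive_poles.
Qed.

Lemma abel_rsum (f : nat -> nat -> R) m :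
  (forall k, (k < m)%nat -> exists l, abel (f k) l) ->
  exists l, abel (fun i => rsum (fun k => f k i) m) l.
Proof.
  induction m as [|m IH]; intros H; cbn.
  - apply (abel_horner nil 0).
  - destruct IH as [l Hl]; [auto|]. destruct (H m) as [l' Hl']; [lia|].
    exists (l + l'); now apply abel_plus.
Qed.

(** A partial-fraction decomposition splits the sequence into the two kinds
    treated above, reciprocal powers and a polynomial. *)
Lemma decomposable_abel m f : decomposable m f ->
  exists l, abel (fun i => f (INR i + 1)) l.
Proof.
  intros (A & A' & A'' & B & HB & H).
  destruct (abel_poly B 1 HB) as [l Hl].
  assert (Hp : exists l, abel (fun i => poles A A' A'' m (INR i + 1)) l).
  { apply (abel_rsum (fun k i => A k / (INR i + 1 + INR k) ^ 3
        + A' k / (INR i + 1 + INR k) ^ 2 + A'' k / (INR i + 1 + INR k))).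
    intros k _. assert (Hk : 0 < 1 + INR k) by (generalize (pos_INR k); lra).
    destruct (abel_inv _ 2 Hk) as [l3 H3], (abel_inv _ 1 Hk) as [l2 H2],
      (abel_inv _ 0 Hk) as [l1 H1].
    exists (A k * l3 + A' k * l2 + A'' k * l1).
    eapply abel_ext; [|apply abel_plus; [apply abel_plus|];
      apply abel_scal; [exact H3|exact H2|exact H1]].
    intros i; cbn -[pow INR]. rewrite !Rplus_assoc, pow_1. reflexivity. }
  destruct Hp as [l' Hl']. exists (l' + l).
  eapply abel_ext; [|exact (abel_plus _ _ _ _ Hl' Hl)].
  intros i; cbn -[INR]; symmetry; apply H, off_poles_pos.
  generalize (pos_INR i); lra.
Qed.

Lemma decomposable_abel_Derive m f : decomposable m f ->
  exists l, abel (fun i => Derive f (INR i + 1)) l.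
Proof.
  intros (A & A' & A'' & B & HB & H).
  destruct (is_derive_poly B HB) as (B' & HB' & HD).
  destruct (abel_poly B' 1 HB') as [l Hl].
  assert (Hp : exists l, abel (fun i => dpoles A A' A'' m (INR i + 1)) l).
  { apply (abel_rsum (fun k i => -3 * A k / (INR i + 1 + INR k) ^ 4
        + -2 * A' k / (INR i + 1 + INR k) ^ 3 + - A'' k / (INR i + 1 + INR k) ^ 2)).
    intros k _. assert (Hk : 0 < 1 + INR k) by (generalize (pos_INR k); lra).
    destruct (abel_inv _ 3 Hk) as [l3 H3], (abel_inv _ 2 Hk) as [l2 H2],
      (abel_inv _ 1 Hk) as [l1 H1].
    exists (-3 * A k * l3 + -2 * A' k * l2 + - A'' k * l1).
    eapply abel_ext; [|apply abel_plus; [apply abel_plus|];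
      apply abel_scal; [exact H3|exact H2|exact H1]].
    intros i; cbn -[pow INR]. rewrite !Rplus_assoc. reflexivity. }
  destruct Hp as [l' Hl']. exists (l' + l).
  eapply abel_ext; [|exact (abel_plus _ _ _ _ Hl' Hl)].
  intros i; cbn -[INR]; symmetry.
  assert (Hi : 0 < INR i + 1) by (generalize (pos_INR i); lra).
  apply is_derive_unique.
  apply (is_derive_ext_loc (fun t => poles A A' A'' m t + B t)).
  - apply locally_pos; [easy|]. intros s Hs; symmetry; apply H, off_poles_pos, Hs.
  - apply (is_derive_plus (K := R_AbsRing) (V := R_NormedModule)); [|easy].
    now apply is_derive_poles.
Qed.

(** * Creative telescoping *)

Definition cA (x : R) : R := (1457 * x ^ 2 - 1363 * x + 348) * (x + 1) ^ 4.
Definition cB (x : R) : R :=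
  148614 * x ^ 6 + 158202 * x ^ 5 - 9295 * x ^ 4 - 61894 * x ^ 3
  - 11111 * x ^ 2 + 8932 * x + 2784.
Definition cC (x : R) : R :=
  97619 * x ^ 6 - 91321 * x ^ 5 - 9443 * x ^ 4 + 35343 * x ^ 3
  - 5440 * x ^ 2 - 5678 * x + 1768.
Definition cD (x : R) : R :=
  3 * (1457 * x ^ 2 + 1551 * x + 442) * (3 * x - 2) * (3 * x - 4) * (x - 1) ^ 2.

(** Numerator of the rational certificate of the recurrence.  Creative
    telescoping asks for a rational multiple S of R_(n-2) such that S(t + 1) + S(t)
    is the recurrence applied to n -> R_n(t), the plus sign being due to z = -1.
    Its denominator and its forced zeros are known in advance (see [Sn]); the
    remaining factor is a polynomial in t of degree 12, obtained by solving a
    linear system.  Here y stands for n. *)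
Definition cert_poly (y t : R) : R :=
    (1457 * y^6 + 4465 * y^5 + 3638 * y^4 - 958 * y^3 - 1907 * y^2 + 29 * y
     + 348) * t^12
    + (170469 * y^7 + 356307 * y^6 + 149897 * y^5 - 129215 * y^4 - 90114 *
     y^3 + 21140 * y^2 + 16588 * y - 1392) * t^11
    + (2307888 * y^8 + 2823948 * y^7 - 1725307 * y^6 - 3053145 * y^5 - 24289
     * y^4 + 1026935 * y^3 + 107292 * y^2 - 143986 * y - 11832) * t^10
    + (13691429 * y^9 + 4393231 * y^8 - 24388827 * y^7 - 10096153 * y^6 +
     12692058 * y^5 + 6246256 * y^4 - 3180132 * y^3 - 1435630 * y^2 + 387832
     * y + 94656) * t^9
    + (43213163 * y^10 - 30022237 * y^9 - 93302012 * y^8 + 33615282 * y^7 +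
     67110011 * y^6 - 7297779 * y^5 - 24326629 * y^4 + 638457 * y^3 +
     4376471 * y^2 - 115715 * y - 252996) * t^8
    + (70773775 * y^11 - 151178508 * y^10 - 110848715 * y^9 + 238453352 *
     y^8 + 72123750 * y^7 - 111183273 * y^6 - 41215834 * y^5 + 28603419 *
     y^4 + 10929932 * y^3 - 4328630 * y^2 - 1105620 * y + 290928) * t^7
    + (32741704 * y^12 - 266058681 * y^11 + 164183240 * y^10 + 414533625 *
     y^9 - 250978707 * y^8 - 191588756 * y^7 + 61229717 * y^6 + 60462928 *
     y^5 + 263806 * y^4 - 13198044 * y^3 - 1510760 * y^2 + 1691624 * y -
     86304) * t^6
    + (- 75890759 * y^13 - 143174220 * y^12 + 625860862 * y^11 + 2044178 *
     y^10 - 768972327 * y^9 + 195222303 * y^8 + 241779477 * y^7 - 50202979 *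
     y^6 - 20772457 * y^5 - 8269474 * y^4 - 1312516 * y^3 + 4554696 * y^2 -
     601296 * y - 83520) * t^5
    + (- 105316331 * y^14 + 87420846 * y^13 + 704497110 * y^12 - 781876934 *
     y^11 - 749645454 * y^10 + 1001534364 * y^9 + 118916173 * y^8 -
     347812695 * y^7 + 37142994 * y^6 + 30311695 * y^5 - 8767044 * y^4 +
     5880300 * y^3 - 1649664 * y^2 - 229680 * y + 50112) * t^4
    + (45231108 * y^15 - 76574327 * y^14 + 384607660 * y^13 - 736265677 *
     y^12 - 278001442 * y^11 + 1241916857 * y^10 - 313987656 * y^9 -
     497685203 * y^8 + 196772334 * y^7 + 66096190 * y^6 - 33854532 * y^5 +
     2189408 * y^4 - 1065168 * y^3 + 125280 * y^2 + 100224 * y) * t^3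
    + (196327836 * y^16 - 504998503 * y^15 + 251245531 * y^14 + 172355246 *
     y^13 - 292097456 * y^12 + 549312767 * y^11 - 341094353 * y^10 -
     248164916 * y^9 + 235334254 * y^8 + 31020554 * y^7 - 50682628 * y^6 +
     1406964 * y^5 + 2571264 * y^4 + 522000 * y^3 - 150336 * y^2) * t^2
    + (160820746 * y^17 - 514772435 * y^16 + 263310539 * y^15 + 582199043 *
     y^14 - 540918101 * y^13 - 88351699 * y^12 + 95038549 * y^11 + 42966121
     * y^10 + 34952343 * y^9 - 28713318 * y^8 - 14390444 * y^7 + 6755808 *
     y^6 + 1386816 * y^5 - 83520 * y^4 - 200448 * y^3) * t
    + (45614299 * y^18 - 170859758 * y^17 + 115191408 * y^16 + 242927276 *
     y^15 - 285718902 * y^14 - 110852360 * y^13 + 180908588 * y^12 +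
     56529860 * y^11 - 72674877 * y^10 - 21856634 * y^9 + 19750332 * y^8 +
     4362176 * y^7 - 3271296 * y^6 - 250560 * y^5 + 200448 * y^4).

(** The telescoping relation after division by the factors common to
    R_(y-2), ..., R_(y+1) and multiplication by the common denominator. *)
Lemma cert_identity y t :
  2 * (cA y * (t + (y + 1) / 2)
      * ((t - y + 1) * (t - y) * (t - y - 1)
         * ((t + 2 * y - 3) * (t + 2 * y - 2) * (t + 2 * y - 1) * (t + 2 * y)
            * (t + 2 * y + 1) * (t + 2 * y + 2))) ^ 2
    + cB y * (y + 1) * (t + y / 2)
      * ((t - y + 1) * (t - y)
         * ((t + 2 * y - 3) * (t + 2 * y - 2) * (t + 2 * y - 1) * (t + 2 * y))) ^ 2
      * (t + y + 1) ^ 5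
    + cC y * (y + 1) * y * (t + (y - 1) / 2)
      * ((t - y + 1) * ((t + 2 * y - 3) * (t + 2 * y - 2))) ^ 2
      * ((t + y) * (t + y + 1)) ^ 5
    + cD y * ((y + 1) * y * (y - 1)) * (t + (y - 2) / 2)
      * ((t + y - 1) * (t + y) * (t + y + 1)) ^ 5)
  = cert_poly y (t + 1) * t ^ 5 * (t + 2 * y - 3) ^ 2
    + cert_poly y t * (t - y + 1) ^ 2 * (t + y + 1) ^ 5.
Proof. unfold cert_poly, cA, cB, cC, cD. field. Qed.

Lemma rprod_S_l f n : rprod f (S n) = f 0%nat * rprod (fun j => f (S j)) n.
Proof. induction n as [|n IH]; cbn in *; [ring|]. rewrite IH; ring. Qed.

Lemma rprod_ext f g n : (forall j, (j < n)%nat -> f j = g j) -> rprod f n = rprod g n.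
Proof.
  induction n as [|n IH]; intros H; cbn; [easy|].
  rewrite IH, H; [easy|lia|intros; apply H; lia].
Qed.

Lemma rprod_neq_0 f n : (forall j, (j < n)%nat -> f j <> 0) -> rprod f n <> 0.
Proof.
  induction n as [|n IH]; intros H; cbn; [lra|].
  apply Rmult_integral_contrapositive_currified; [apply IH; auto|apply H; lia].
Qed.

Definition Pn (n : nat) (t : R) : R := rprod (fun j => t - INR (j + 1)) n.
Definition Qn (n : nat) (t : R) : R := rprod (fun j => t + INR (n + 1 + j)) n.
Definition Dn (n : nat) (t : R) : R := rprod (fun j => t + INR j) (n + 1).

(** R_n(t) without its sign and its antisymmetric factor t + n/2: this part is
    hypergeometric in n and in t with completely factored ratios. *)
Definition Bn (n : nat) (t : R) : R := (Pn n t * Qn n t) ^ 2 / (INR (fact n) * Dn n t ^ 3).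

Lemma Rn_Bn n (t : R) : Rn n t = (-1) ^ (n + 1) * (t + INR n / 2) * Bn n t.
Proof. unfold Rn, Bn, Pn, Qn, Dn, Rdiv; ring. Qed.

Lemma Pn_S n t : Pn (S n) t = Pn n t * (t - INR n - 1).
Proof. unfold Pn; cbn [rprod]; rewrite plus_INR; cbn [INR]; ring. Qed.

Lemma Dn_S n t : Dn (S n) t = Dn n t * (t + INR n + 1).
Proof.
  unfold Dn; cbn [rprod Nat.add]. rewrite plus_INR; cbn [INR]; ring.
Qed.

Lemma Qn_S n t :
  Qn (S n) t * (t + INR n + 1) = Qn n t * ((t + 2 * INR n + 1) * (t + 2 * INR n + 2)).
Proof.
  transitivity (rprod (fun j => t + INR (n + 1 + j)) (S (S n))).
  - rewrite rprod_S_l; unfold Qn. rewrite Rmult_comm; f_equal.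
    + rewrite !plus_INR; cbn [INR]; ring.
    + apply rprod_ext; intros j _; do 2 f_equal; lia.
  - unfold Qn; cbn [rprod]; rewrite !plus_INR, !S_INR; cbn [INR]; ring.
Qed.

Lemma Dn_neq_0 n t : off_poles (n + 1) t -> Dn n t <> 0.
Proof. intros H; apply rprod_neq_0; exact H. Qed.

Lemma Bn_S n t : off_poles (n + 2) t ->
  Bn (S n) t = Bn n t * ((t - INR n - 1) * ((t + 2 * INR n + 1) * (t + 2 * INR n + 2))) ^ 2
               / ((INR n + 1) * (t + INR n + 1) ^ 5).
Proof.
  intros H.
  assert (Hn : t + INR n + 1 <> 0).
  { generalize (H (S n) ltac:(lia)); rewrite S_INR; lra. }
  assert (HD : Dn n t <> 0) by (apply Dn_neq_0; intros k Hk; apply H; lia).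
  assert (Hf := INR_fact_neq_0 n). assert (Hp := pos_INR n).
  assert (E : Qn (S n) t = Qn n t * ((t + 2 * INR n + 1) * (t + 2 * INR n + 2))
                           / (t + INR n + 1)).
  { rewrite <- Qn_S; field; exact Hn. }
  unfold Bn; rewrite Pn_S, Dn_S, E, fact_simpl, mult_INR, S_INR.
  field; repeat split; auto; lra.
Qed.

Lemma Pn_shift n t : Pn n (t + 1) * (t - INR n) = t * Pn n t.
Proof.
  assert (E : rprod (fun j => t - INR j) (S n) = t * Pn n t).
  { rewrite rprod_S_l; cbn [INR]; f_equal; [ring|].
    apply rprod_ext; intros j _; now rewrite Nat.add_1_r. }
  rewrite <- E; cbn [rprod]; f_equal.
  apply rprod_ext; intros j _; rewrite plus_INR; cbn [INR]; ring.
Qed.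

Lemma Qn_shift n t :
  Qn n (t + 1) * (t + INR n + 1) = Qn n t * (t + 2 * INR n + 1).
Proof.
  transitivity (rprod (fun j => t + INR (n + 1 + j)) (S n)).
  - rewrite rprod_S_l, Rmult_comm; f_equal.
    + rewrite !plus_INR; cbn [INR]; ring.
    + apply rprod_ext; intros j _; rewrite !plus_INR, !S_INR; cbn [INR]; ring.
  - unfold Qn; cbn [rprod]; rewrite !plus_INR; cbn [INR]; ring.
Qed.

Lemma Dn_shift n t : Dn n (t + 1) * t = Dn n t * (t + INR n + 1).
Proof.
  transitivity (rprod (fun j => t + INR j) (S (n + 1))).
  - rewrite rprod_S_l, Rmult_comm; f_equal; [cbn; ring|].
    apply rprod_ext; intros j _; rewrite S_INR; ring.
  - unfold Dn; cbn [rprod]; rewrite !plus_INR; cbn [INR]; ring.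
Qed.

Lemma Bn_shift n t : off_poles (n + 2) t ->
  (t - INR n) ^ 2 * Bn n (t + 1)
  = t ^ 5 * (t + 2 * INR n + 1) ^ 2 / (t + INR n + 1) ^ 5 * Bn n t.
Proof.
  intros H.
  assert (Hn : t + INR n + 1 <> 0).
  { generalize (H (S n) ltac:(lia)); rewrite S_INR; lra. }
  assert (H0 : t <> 0) by (generalize (H 0%nat ltac:(lia)); cbn; lra).
  assert (HD : Dn n t <> 0) by (apply Dn_neq_0; intros k Hk; apply H; lia).
  assert (Hf := INR_fact_neq_0 n).
  assert (EQ : Qn n (t + 1) = Qn n t * (t + 2 * INR n + 1) / (t + INR n + 1)).
  { rewrite <- Qn_shift; field; exact Hn. }
  assert (ED : Dn n (t + 1) = Dn n t * (t + INR n + 1) / t).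
  { rewrite <- Dn_shift; field; exact H0. }
  unfold Bn; rewrite EQ, ED.
  replace ((t - INR n) ^ 2 * ((Pn n (t + 1) * (Qn n t * (t + 2 * INR n + 1) / (t + INR n + 1))) ^ 2 /
     (INR (fact n) * (Dn n t * (t + INR n + 1) / t) ^ 3)))
    with ((Pn n (t + 1) * (t - INR n)) ^ 2 * ((Qn n t * (t + 2 * INR n + 1) / (t + INR n + 1)) ^ 2 /
     (INR (fact n) * (Dn n t * (t + INR n + 1) / t) ^ 3)))
    by (field; repeat split; auto).
  rewrite Pn_shift. field; repeat split; auto.
Qed.

Definition rec_op (u : nat -> R) (n : nat) : R :=
  cA (INR n) * u (n + 1)%nat - cB (INR n) * u n + cC (INR n) * u (n - 1)%nat
  - cD (INR n) * u (n - 2)%nat.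

(** S for n = k + 2.  The factor (t - k - 1)^2 completes the double zeros at
    1, ..., n - 1, and the fifth powers turn the triple poles of R_k at
    0, ..., -k into triple poles at 0, ..., -n once the zeros of Q_k and of the
    certificate polynomial are taken into account. *)
Definition Sn (k : nat) (t : R) : R :=
  (-1) ^ k * cert_poly (INR k + 2) t * (t - INR k - 1) ^ 2 * Bn k t
  / (2 * ((t + INR k + 1) * (t + INR k + 2)) ^ 5
     * ((INR k + 1) * (INR k + 2) * (INR k + 3))).

Lemma telescoping k t : off_poles (k + 4) t ->
  rec_op (fun i => Rn i t) (k + 2) = Sn k (t + 1) + Sn k t.
Proof.
  intros H.
  assert (Hk := pos_INR k).
  assert (H0 : t <> 0) by (generalize (H 0%nat ltac:(lia)); cbn; lra).
  assert (H1 : t + INR k + 1 <> 0).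
  { generalize (H (k + 1)%nat ltac:(lia)); rewrite plus_INR; cbn; lra. }
  assert (H2 : t + INR k + 2 <> 0).
  { generalize (H (k + 2)%nat ltac:(lia)); rewrite plus_INR; cbn; lra. }
  assert (H3 : t + INR k + 3 <> 0).
  { generalize (H (k + 3)%nat ltac:(lia)); rewrite plus_INR; cbn; lra. }
  set (y := INR k + 2).
  assert (B1 := Bn_S k t ltac:(intros j Hj; apply H; lia)).
  assert (B2 := Bn_S (S k) t ltac:(intros j Hj; apply H; lia)).
  assert (B3 := Bn_S (S (S k)) t ltac:(intros j Hj; apply H; lia)).
  assert (E2 : INR (k + 2) = y) by (unfold y; rewrite plus_INR; cbn; ring).
  assert (Ek : INR k = y - 2) by (unfold y; ring).
  assert (ES : INR (S k) = y - 1) by (unfold y; rewrite S_INR; ring).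
  assert (ESS : INR (S (S k)) = y) by (unfold y; rewrite !S_INR; ring).
  assert (ESSS : INR (S (S (S k))) = y + 1) by (unfold y; rewrite !S_INR; ring).
  unfold rec_op; rewrite E2.
  replace (k + 2 + 1)%nat with (S (S (S k))) by lia.
  replace (k + 2 - 1)%nat with (S k) by lia.
  replace (k + 2 - 2)%nat with k by lia.
  replace (k + 2)%nat with (S (S k)) by lia.
  rewrite !Rn_Bn, B3, B2, B1. unfold Sn.
  replace (t + 1 - INR k - 1) with (t - INR k) by ring.
  replace ((-1) ^ k * cert_poly (INR k + 2) (t + 1) * (t - INR k) ^ 2 * Bn k (t + 1))
    with ((-1) ^ k * cert_poly (INR k + 2) (t + 1) * ((t - INR k) ^ 2 * Bn k (t + 1)))
    by ring.
  rewrite Bn_shift by (intros j Hj; apply H; lia).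
  fold y. rewrite ES, ESS, ESSS, Ek in *.
  set (b := Bn k t).
  replace ((-1) ^ (S (S (S k)) + 1)) with ((-1) ^ k) by (rewrite !pow_add; cbn; ring).
  replace ((-1) ^ (S (S k) + 1)) with (- (-1) ^ k) by (rewrite !pow_add; cbn; ring).
  replace ((-1) ^ (S k + 1)) with ((-1) ^ k) by (rewrite !pow_add; cbn; ring).
  replace ((-1) ^ (k + 1)) with (- (-1) ^ k) by (rewrite !pow_add; cbn; ring).
  set (s := (-1) ^ k).
  assert (I := cert_identity y t).
  set (c1 := cert_poly y (t + 1)) in *. set (c0 := cert_poly y t) in *.
  generalize (cA y) (cB y) (cC y) (cD y) I. intros A B C D I'. clear I.
  clearbody s b c1 c0. clear B1 B2 B3 E2 ES ESS ESSS. clearbody y.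
  assert (Hy : y >= 2) by lra. clear H Hk Ek k.
  (* both sides over the common denominator of the certificate identity *)
  transitivity (s * b * (c1 * t ^ 5 * (t + 2 * y - 3) ^ 2
    + c0 * (t - y + 1) ^ 2 * (t + y + 1) ^ 5)
    / (2 * ((y + 1) * y * (y - 1)) * ((t + y - 1) * (t + y) * (t + y + 1)) ^ 5)).
  - rewrite <- I'. field. repeat split; lra.
  - field. repeat split; lra.
Qed.

(** * The recurrence for the values at -1 *)

Lemma is_poly_id : is_poly (fun t => t).
Proof. apply (is_poly_ext _ (fun t => 1 * t + 0)); [intros; ring|apply is_poly_affine]. Qed.

Lemma is_poly_pow f k : is_poly f -> is_poly (fun t => f t ^ k).
Proof.
  intros H; induction k as [|k IH]; cbn; [apply is_poly_const|].
  now apply is_poly_mult.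
Qed.

Ltac poly_tac :=
  repeat first
    [ apply is_poly_const | apply is_poly_id
    | apply is_poly_plus | apply is_poly_mult | apply is_poly_pow ].

Lemma is_poly_cert y : is_poly (cert_poly y).
Proof. unfold cert_poly; poly_tac. Qed.

Lemma is_poly_add c : is_poly (fun t => t + c).
Proof. poly_tac. Qed.

Lemma is_poly_sub c : is_poly (fun t => t - c).
Proof. apply (is_poly_add (- c)). Qed.

(** For k = 0 and k = 1 the product Q_k is too short to reduce the two poles of
    order five; there the certificate polynomial itself has the missing zeros. *)
Lemma cert_numerator k : exists W, is_poly W /\
  forall t, cert_poly (INR k + 2) t * Qn k t ^ 2
            = W t * ((t + INR k + 1) * (t + INR k + 2)) ^ 2.
Proof.
  destruct k as [|[|k]].
  - exists (fun t => 279450 * t ^ 8 + 45071676 * t ^ 7 + 478057698 * t ^ 6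
      + 1384896456 * t ^ 5 + -2075357304 * t ^ 4 + -15718010976 * t ^ 3
      + -10681086528 * t ^ 2 + 46710207360 * t + 64813499136).
    split; [poly_tac|]. intros t. unfold cert_poly; cbn; ring.
  - exists (fun t => 2399232 * t ^ 10 + 641932224 * t ^ 9 + 15471459648 * t ^ 8
      + 142500368256 * t ^ 7 + 473118552960 * t ^ 6 + -1058898656832 * t ^ 5
      + -11788457341632 * t ^ 4 + -19200489368832 * t ^ 3 + 68343672043008 * t ^ 2
      + 282525516656640 * t + 289962516234240).
    split; [poly_tac|]. intros t. unfold cert_poly; cbn; ring.
  - exists (fun t => cert_poly (INR (S (S k)) + 2) t
                     * rprod (fun j => t + INR (k + 5 + j)) k ^ 2).
    split.
    + apply is_poly_mult; [apply is_poly_cert|].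
      apply is_poly_pow, (is_poly_rprod (fun t j => t + INR (k + 5 + j))).
      intros j; apply is_poly_add.
    + intros t. unfold Qn. rewrite !rprod_S_l.
      rewrite (rprod_ext _ (fun j => t + INR (k + 5 + j)))
        by (intros j _; do 2 f_equal; lia).
      replace (t + INR (S (S k) + 1 + 0)) with (t + INR (S (S k)) + 1)
        by (rewrite !plus_INR; cbn [INR]; ring).
      replace (t + INR (S (S k) + 1 + 1)) with (t + INR (S (S k)) + 2)
        by (rewrite !plus_INR; cbn [INR]; ring).
      ring.
Qed.

Lemma Pn_S_l n t : Pn (S n) t = (t - 1) * rprod (fun j => t - INR (j + 2)) n.
Proof.
  unfold Pn; rewrite rprod_S_l; f_equal.
  apply rprod_ext; intros j _; do 2 f_equal; lia.
Qed.

(** Regularity of the certificate at the poles: it has the same shape as R_n,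
    with poles of order at most three, hence it has values at -1 and
    double-pole coefficients of its own. *)
Lemma Sn_decomposable k : exists g,
  decomposable (k + 3) g /\ decomposable (k + 3) (Sn k) /\
  forall t, off_poles (k + 3) t -> Sn k t = (t - 1) ^ 2 * g t.
Proof.
  destruct (cert_numerator k) as (W & HW & E).
  set (c := (-1) ^ k / (2 * INR (fact k) * ((INR k + 1) * (INR k + 2) * (INR k + 3)))).
  set (M := fun t => c * (W t * rprod (fun j => t - INR (j + 2)) k ^ 2)).
  assert (HM : is_poly M).
  { apply is_poly_scal, is_poly_mult; [easy|].
    apply is_poly_pow, (is_poly_rprod (fun t j => t - INR (j + 2))).
    intros j; apply is_poly_sub. }
  set (g := fun t => M t / rprod (fun j => t + INR j) (k + 3) ^ 3).
  assert (HS : forall t, off_poles (k + 3) t -> Sn k t = (t - 1) ^ 2 * g t).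
  { intros t Ht. unfold g, M, c, Sn, Bn.
    assert (Hk := pos_INR k). assert (Hf := INR_fact_neq_0 k).
    assert (H1 : t + INR k + 1 <> 0).
    { generalize (Ht (k + 1)%nat ltac:(lia)); rewrite plus_INR; cbn; lra. }
    assert (H2 : t + INR k + 2 <> 0).
    { generalize (Ht (k + 2)%nat ltac:(lia)); rewrite plus_INR; cbn; lra. }
    assert (HD : Dn k t <> 0) by (apply Dn_neq_0; intros j Hj; apply Ht; lia).
    replace (k + 3)%nat with (S (S k) + 1)%nat by lia.
    fold (Dn (S (S k)) t). rewrite !Dn_S, S_INR.
    replace (t + (INR k + 1) + 1) with (t + INR k + 2) by ring.
    set (p := rprod (fun j => t - INR (j + 2)) k).
    transitivity ((-1) ^ k * (cert_poly (INR k + 2) t * Qn k t ^ 2)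
       * (Pn k t * (t - INR k - 1)) ^ 2
       / (INR (fact k) * Dn k t ^ 3) / (2 * ((t + INR k + 1) * (t + INR k + 2)) ^ 5
     * ((INR k + 1) * (INR k + 2) * (INR k + 3)))).
    { unfold Rdiv; ring. }
    rewrite E, <- Pn_S, Pn_S_l. fold p. field.
    repeat split; auto; lra. }
  exists g; split; [now apply decomposable_rprod|]; split; [|exact HS].
  destruct (decomposable_rprod (fun t => (t - 1) ^ 2 * M t) (k + 3))
    as (A & A' & A'' & B & HB & HAB).
  { apply is_poly_mult; [apply is_poly_pow, is_poly_sub|easy]. }
  exists A, A', A'', B; split; [easy|]. intros t Ht.
  rewrite HS, <- HAB by easy. unfold g, Rdiv; ring.
Qed.

(** The boundary terms vanish, also after differentiation, because Sn contains
    the square of (t - 1)...(t - k - 1). *)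
Lemma Sn_1 k : Sn k 1 = 0 /\ Derive (Sn k) 1 = 0.
Proof.
  destruct (Sn_decomposable k) as (g & Hg & _ & E); split.
  - rewrite E by (apply off_poles_pos; lra). ring.
  - apply is_derive_unique.
    apply (is_derive_ext_loc (fun t => (t - 1) ^ 2 * g t)).
    { apply locally_pos; [lra|]. intros s Hs; symmetry; apply E, off_poles_pos, Hs. }
    assert (Hd := decomposable_derive _ _ Hg 1 Rlt_0_1).
    auto_derive; [exact Hd|]. ring.
Qed.

(** A shift turns the value l into s(0) - l, so the two halves cancel. *)
Lemma abel_telescoping f s : s 0%nat = 0 -> (exists l, abel s l) ->
  (forall i, f i = s (S i) + s i) -> abel f 0.
Proof.
  intros H0 [l Hl] E.
  apply (abel_ext (fun i => s (S i) + s i)); [intros; now rewrite E|].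
  replace 0 with ((s 0%nat - l) + l) by (rewrite H0; ring).
  apply abel_plus; [now apply abel_S|easy].
Qed.

Lemma abel_rec_op (F : nat -> nat -> R) (v : nat -> R) n :
  (forall i, abel (F i) (v i)) -> abel (fun m => rec_op (fun i => F i m) n) (rec_op v n).
Proof.
  intros H. unfold rec_op.
  assert (sub : forall f g l l', abel f l -> abel g l' -> abel (fun m => f m - g m) (l - l')).
  { intros f g l l' Hf Hg. replace (l - l') with (l + -1 * l') by ring.
    apply (abel_ext (fun m => f m + -1 * g m)); [intros; ring|].
    apply abel_plus, abel_scal; easy. }
  apply sub; [|now apply abel_scal].
  apply abel_plus; [|now apply abel_scal].
  apply sub; now apply abel_scal.
Qed.

Lemma Rn_decomposable n : decomposable (n + 1) (Rn n).
Proof.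
  destruct (partial_fractions_ex n) as (A & A' & A'' & B & HB & H).
  exists A, A', A'', B; split; [easy|]. intros t Ht.
  rewrite H by (intros k Hk; apply Ht; lia).
  unfold poles. now rewrite Nat.add_1_r, rsum_S_sum_f_R0.
Qed.

Lemma INR_add_1 m : INR (m + 1) = INR m + 1.
Proof. now rewrite plus_INR. Qed.

Lemma gser_shift (f : nat -> R) z :
  Series (fun m => z ^ (m + 1) * f m) = z * gser f z.
Proof.
  unfold gser; rewrite <- Series_scal_l. apply Series_ext; intros m.
  rewrite pow_add; ring.
Qed.

Lemma abel_Rn n : filterlim (rgen n) (at_right (-1)) (locally (r n)) /\
  abel (fun m => Rn n (INR m + 1)) (- r n).
Proof.
  destruct (decomposable_abel _ _ (Rn_decomposable n)) as [l Hl].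
  assert (L : filterlim (rgen n) (at_right (-1)) (locally (- l))).
  { apply (filterlim_ext (fun z => z * gser (fun m => Rn n (INR m + 1)) z)).
    - intros z; unfold rgen. rewrite <- gser_shift.
      apply Series_ext; intros m; now rewrite INR_add_1.
    - replace (- l) with (-1 * l) by ring.
      apply filterlim_Rmult; [apply _| |exact (proj2 Hl)].
      apply (filterlim_near_m1 (fun z => z)), continuous_id. }
  assert (E : r n = - l).
  { apply (iota_filterlim_locally (K := R_AbsRing) (V := R_CompleteNormedModule)).
    exact L. }
  rewrite E, Ropp_involutive; easy.
Qed.

Lemma abel_Derive_Rn n : filterlim (rtgen n) (at_right (-1)) (locally (rt n)) /\
  abel (fun m => Derive (Rn n) (INR m + 1)) (rt n).
Proof.
  destruct (decomposable_abel_Derive _ _ (Rn_decomposable n)) as [l Hl].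
  assert (L : filterlim (rtgen n) (at_right (-1)) (locally l)).
  { apply (filterlim_ext (fun z => - z * gser (fun m => Derive (Rn n) (INR m + 1)) z)).
    - intros z; unfold rtgen. rewrite Ropp_mult_distr_l_reverse, <- gser_shift.
      f_equal. apply Series_ext; intros m; now rewrite INR_add_1.
    - replace l with (- -1 * l) by ring.
      apply filterlim_Rmult; [apply _| |exact (proj2 Hl)].
      apply (filterlim_near_m1 (fun z => - z)).
      apply ex_derive_cont.
      auto_derive; easy. }
  assert (E : rt n = l).
  { apply (iota_filterlim_locally (K := R_AbsRing) (V := R_CompleteNormedModule)).
    exact L. }
  rewrite E; easy.
Qed.

Lemma rec_op_scal c u n : rec_op (fun i => c * u i) n = c * rec_op u n.
Proof. unfold rec_op; ring. Qed.

Lemma rec_op_minus u v n : rec_op (fun i => u i - v i) n = rec_op u n - rec_op v n.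
Proof. unfold rec_op; ring. Qed.

Lemma recurrence_intro u : (forall k, rec_op u (k + 2) = 0) -> recurrence u.
Proof.
  intros H n Hn. replace n with (n - 2 + 2)%nat by lia. exact (H (n - 2)%nat).
Qed.

Lemma recurrence_elim u k : recurrence u -> rec_op u (k + 2) = 0.
Proof. intros H; exact (H (k + 2)%nat ltac:(lia)). Qed.

Lemma recurrence_r : recurrence r.
Proof.
  apply recurrence_intro; intros k.
  assert (H := abel_rec_op (fun i m => Rn i (INR m + 1)) (fun i => - r i) (k + 2)
                 (fun i => proj2 (abel_Rn i))).
  destruct (Sn_decomposable k) as (g & _ & HS & _).
  assert (H' : abel (fun m => rec_op (fun i => Rn i (INR m + 1)) (k + 2)) 0).
  { apply (abel_telescoping _ (fun m => Sn k (INR m + 1))).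
    - cbn; rewrite Rplus_0_l; apply Sn_1.
    - apply (decomposable_abel _ _ HS).
    - intros m; rewrite telescoping, S_INR; [easy|].
      apply off_poles_pos; generalize (pos_INR m); lra. }
  assert (E := abel_unique _ _ _ H H').
  unfold rec_op in *; lra.
Qed.

Lemma Derive_rec_op n t : 0 < t ->
  Derive (fun t => rec_op (fun i => Rn i t) n) t = rec_op (fun i => Derive (Rn i) t) n.
Proof.
  intros Ht.
  assert (H : forall i, ex_derive (fun t => Rn i t) t).
  { intros i. now apply (decomposable_derive _ _ (Rn_decomposable i)). }
  apply is_derive_unique. unfold rec_op.
  auto_derive; [repeat split; auto|].
  change (fun x => Rn (n + 1) x) with (Rn (n + 1)).
  change (fun x => Rn (n - 1) x) with (Rn (n - 1)).
  change (fun x => Rn (n - 2) x) with (Rn (n - 2)).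
  change (fun x => Rn n x) with (Rn n).
  ring.
Qed.

Lemma recurrence_rt : recurrence rt.
Proof.
  apply recurrence_intro; intros k.
  assert (H := abel_rec_op (fun i m => Derive (Rn i) (INR m + 1)) rt (k + 2)
                 (fun i => proj2 (abel_Derive_Rn i))).
  destruct (Sn_decomposable k) as (g & _ & HS & _).
  assert (H' : abel (fun m => rec_op (fun i => Derive (Rn i) (INR m + 1)) (k + 2)) 0).
  { apply (abel_telescoping _ (fun m => Derive (Sn k) (INR m + 1))).
    - cbn; rewrite Rplus_0_l; apply Sn_1.
    - apply (decomposable_abel_Derive _ _ HS).
    - intros m. assert (Hm := pos_INR m).
      rewrite <- Derive_rec_op, S_INR by lra.
      apply is_derive_unique.
      apply (is_derive_ext_loc (fun t => Sn k (t + 1) + Sn k t)).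
      + apply locally_pos; [lra|]. intros s Hs; symmetry.
        apply telescoping, off_poles_pos, Hs.
      + assert (D1 := decomposable_derive _ _ HS (INR m + 1) ltac:(lra)).
        assert (D2 := decomposable_derive _ _ HS (INR m + 1 + 1) ltac:(lra)).
        auto_derive; [split; [exact D2|split; [exact D1|easy]]|].
        change (fun x => Sn k x) with (Sn k). ring. }
  exact (abel_unique _ _ _ H H').
Qed.

(** * The recurrence for the double-pole coefficients *)

Lemma continuous_zero_right (h : R -> R) : continuous h 0 ->
  (forall e, 0 < e < 1 -> h e = 0) -> h 0 = 0.
Proof.
  intros Hc Hz.
  apply (filterlim_locally_unique (K := R_AbsRing) (V := R_NormedModule)
           (F := at_right 0) h).
  - intros P HP. apply (filter_imp (F := locally 0) (fun x => P (h x))).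
    + intros x Hx _; exact Hx.
    + exact (Hc P HP).
  - apply (filterlim_ext_loc (fun _ => 0)); [|apply filterlim_const].
    exists (mkposreal 1 Rlt_0_1); intros e He He'. symmetry; apply Hz.
    unfold ball in He; cbn in He.
    unfold AbsRing_ball, abs, minus, plus, opp in He; cbn in He.
    apply Rabs_def2 in He; lra.
Qed.

Definition pole_term (A A' A'' : nat -> R) (t : R) (k : nat) : R :=
  A k / (t + INR k) ^ 3 + A' k / (t + INR k) ^ 2 + A'' k / (t + INR k).

Lemma rsum_split f k m : (k < m)%nat ->
  rsum f m = f k + rsum (fun j => if Nat.eq_dec j k then 0 else f j) m.
Proof.
  assert (E : forall p, (p <= k)%nat ->
    rsum (fun j => if Nat.eq_dec j k then 0 else f j) p = rsum f p).
  { induction p as [|p IH]; intros Hp; cbn; [easy|].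
    rewrite IH by lia. destruct (Nat.eq_dec p k); [lia|easy]. }
  induction m as [|m IH]; intros Hk; [lia|]. cbn.
  destruct (Nat.eq_dec m k) as [->|Hn].
  - rewrite E by lia; ring.
  - rewrite IH by lia; ring.
Qed.

Lemma INR_diff j k : j <> k -> 1 <= INR j - INR k \/ INR j - INR k <= -1.
Proof.
  intros H. destruct (Nat.lt_total j k) as [L|[L|L]]; [|lia|].
  - right. assert (INR (S j) <= INR k) by (apply le_INR; lia). rewrite S_INR in *; lra.
  - left. assert (INR (S k) <= INR j) by (apply le_INR; lia). rewrite S_INR in *; lra.
Qed.

(** Multiply by the cube of the local parameter at -k and let it tend to 0;
    then divide by it once and repeat. *)
Lemma poles_unique A A' A'' B m : is_poly B ->
  (forall t, off_poles m t -> poles A A' A'' m t + B t = 0) ->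
  forall k, (k < m)%nat -> A' k = 0.
Proof.
  intros HB H k Hk.
  set (G := fun e => rsum (fun j => if Nat.eq_dec j k then 0
                 else pole_term A A' A'' (- INR k + e) j) m + B (- INR k + e)).
  assert (HG : continuous G 0).
  { apply (continuous_plus (V := R_NormedModule)
      (fun e => rsum (fun j => if Nat.eq_dec j k then 0
                 else pole_term A A' A'' (- INR k + e) j) m)
      (fun e => B (- INR k + e))).
    - clear - k. induction m as [|m IH]; cbn; [apply continuous_const|].
      apply (continuous_plus (V := R_NormedModule)
       (fun e => rsum (fun j => if Nat.eq_dec j k then 0
                 else pole_term A A' A'' (- INR k + e) j) m)); [exact IH|].
      destruct (Nat.eq_dec m k) as [E|E]; [apply continuous_const|].
      apply ex_derive_cont.
      assert (Hn : - INR k + 0 + INR m <> 0) by (destruct (INR_diff m k E); lra).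
      unfold pole_term. auto_derive.
      repeat split; repeat apply Rmult_integral_contrapositive_currified; auto with real.
    - destruct (is_derive_poly B HB) as (B' & _ & HD).
      apply ex_derive_cont.
      auto_derive. exists (B' (- INR k + 0)); apply HD. }
  assert (E : forall e, 0 < e < 1 ->
    A k + A' k * e + A'' k * e ^ 2 + e ^ 3 * G e = 0).
  { intros e He.
    assert (Ho : off_poles m (- INR k + e)).
    { intros j _. destruct (Nat.eq_dec j k) as [->|Hj]; [lra|].
      destruct (INR_diff j k Hj); lra. }
    specialize (H _ Ho). unfold poles in H.
    change (rsum (pole_term A A' A'' (- INR k + e)) m + B (- INR k + e) = 0) in H.
    rewrite (rsum_split _ k m Hk), Rplus_assoc in H. fold (G e) in H.
    replace (A k + A' k * e + A'' k * e ^ 2 + e ^ 3 * G e)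
      with (e ^ 3 * (pole_term A A' A'' (- INR k + e) k + G e)).
    - rewrite H; ring.
    - unfold pole_term. replace (- INR k + e + INR k) with e by ring. field. lra. }
  assert (Hg : forall c1 c2 c3 i, continuous (fun e => c1 + c2 * e + c3 * e ^ 2 + e ^ i * G e) 0).
  { intros c1 c2 c3 i.
    apply (continuous_plus (V := R_NormedModule) (fun e => c1 + c2 * e + c3 * e ^ 2)
             (fun e => e ^ i * G e)).
    - apply ex_derive_cont.
      auto_derive; easy.
    - apply (continuous_mult (K := R_AbsRing) (fun e => e ^ i) G); [|exact HG].
      apply ex_derive_cont.
      auto_derive; easy. }
  assert (H0 : A k = 0).
  { generalize (continuous_zero_right _ (Hg (A k) (A' k) (A'' k) 3%nat) E).
    intros HH; cbn in HH; lra. }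
  assert (E' : forall e, 0 < e < 1 -> A' k + A'' k * e + 0 * e ^ 2 + e ^ 2 * G e = 0).
  { intros e He. specialize (E e He).
    apply Rmult_eq_reg_l with e; [|lra].
    transitivity (A k + A' k * e + A'' k * e ^ 2 + e ^ 3 * G e); [rewrite H0; ring|].
    rewrite E; ring. }
  generalize (continuous_zero_right _ (Hg (A' k) (A'' k) 0 2%nat) E').
  intros HH; cbn in HH; lra.
Qed.

(** The linear functional whose value at R_n is - a_n.  It is a relation because
    the coefficients come from an unspecified decomposition; they do not depend
    on the choice by [poles_unique]. *)
Definition alt_double (m : nat) (f : R -> R) (v : R) : Prop :=
  exists A A' A'' B, is_poly B /\
    (forall t, off_poles m t -> f t = poles A A' A'' m t + B t) /\
    v = rsum (fun k => (-1) ^ k * A' k) m.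

Lemma rsum_lin f g c d m :
  rsum (fun k => c * f k + d * g k) m = c * rsum f m + d * rsum g m.
Proof. induction m as [|m IH]; cbn; [ring|rewrite IH; ring]. Qed.

Lemma rsum_ext f g m : (forall k, (k < m)%nat -> f k = g k) -> rsum f m = rsum g m.
Proof.
  induction m as [|m IH]; intros H; cbn; [easy|].
  rewrite IH, H; [easy|lia|intros; apply H; lia].
Qed.

Lemma rsum_S_l f m : rsum f (S m) = f 0%nat + rsum (fun k => f (S k)) m.
Proof. induction m as [|m IH]; cbn in *; [ring|]. rewrite IH; ring. Qed.

Lemma poles_lin A A' A'' D D' D'' c d m t :
  poles (fun k => c * A k + d * D k) (fun k => c * A' k + d * D' k)
        (fun k => c * A'' k + d * D'' k) m t
  = c * poles A A' A'' m t + d * poles D D' D'' m t.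
Proof.
  unfold poles; rewrite <- rsum_lin. apply rsum_ext; intros k _. unfold Rdiv; ring.
Qed.

Lemma alt_double_lin m f g v w c d : alt_double m f v -> alt_double m g w ->
  alt_double m (fun t => c * f t + d * g t) (c * v + d * w).
Proof.
  intros (A & A' & A'' & B & HB & Hf & Hv) (D & D' & D'' & E & HE & Hg & Hw).
  exists (fun k => c * A k + d * D k), (fun k => c * A' k + d * D' k),
    (fun k => c * A'' k + d * D'' k), (fun t => c * B t + d * E t).
  split; [apply is_poly_plus; now apply is_poly_scal|]; split.
  - intros t Ht; rewrite poles_lin, Hf, Hg by easy; ring.
  - rewrite Hv, Hw, <- rsum_lin. apply rsum_ext; intros; ring.
Qed.

Lemma alt_double_ext m f g v : (forall t, off_poles m t -> f t = g t) ->
  alt_double m f v -> alt_double m g v.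
Proof.
  intros H (A & A' & A'' & B & HB & Hf & Hv).
  exists A, A', A'', B; repeat split; auto. intros t Ht; rewrite <- H; auto.
Qed.

Lemma alt_double_unique m f v w : alt_double m f v -> alt_double m f w -> v = w.
Proof.
  intros H1 H2.
  destruct (alt_double_lin m f f v w 1 (-1) H1 H2) as (A & A' & A'' & B & HB & H & E).
  assert (Z := poles_unique A A' A'' B m HB).
  assert (Hz : forall t, off_poles m t -> poles A A' A'' m t + B t = 0).
  { intros t Ht; rewrite <- H by easy; ring. }
  rewrite (rsum_ext _ (fun k => 0 * 0 + 0 * 0)) in E.
  - rewrite (rsum_lin (fun _ => 0) (fun _ => 0)) in E. lra.
  - intros k Hk; rewrite (Z Hz k Hk); ring.
Qed.

Lemma decomposable_alt m f : decomposable m f -> exists v, alt_double m f v.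
Proof.
  intros (A & A' & A'' & B & HB & H).
  exists (rsum (fun k => (-1) ^ k * A' k) m), A, A', A'', B; easy.
Qed.

Lemma alt_double_widen1 m f v : alt_double m f v -> alt_double (S m) f v.
Proof.
  intros (A & A' & A'' & B & HB & Hf & Hv).
  set (ext := fun (F : nat -> R) k => if Nat.eq_dec k m then 0 else F k).
  assert (E1 : forall F k, (k < m)%nat -> ext F k = F k).
  { intros F k Hk; unfold ext; destruct (Nat.eq_dec k m); [lia|easy]. }
  assert (E2 : forall F, ext F m = 0).
  { intros F; unfold ext; destruct (Nat.eq_dec m m); [easy|lia]. }
  exists (ext A), (ext A'), (ext A''), B; split; [easy|]; split.
  - intros t Ht. rewrite Hf by (intros k Hk; apply Ht; lia).
    unfold poles; cbn [rsum]. rewrite !E2.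
    rewrite (rsum_ext (fun k => ext A k / _ ^ 3 + _ + _)
      (fun k => A k / (t + INR k) ^ 3 + A' k / (t + INR k) ^ 2 + A'' k / (t + INR k)))
      by (intros k Hk; now rewrite !E1).
    unfold Rdiv; ring.
  - cbn [rsum]; rewrite E2, Hv.
    rewrite (rsum_ext (fun k => (-1) ^ k * ext A' k) (fun k => (-1) ^ k * A' k)); [ring|].
    intros k Hk; now rewrite E1.
Qed.

Lemma alt_double_widen m m' f v : (m <= m')%nat ->
  alt_double m f v -> alt_double m' f v.
Proof.
  intros H; induction H as [|m' _ IH]; [easy|].
  intros Hf; now apply alt_double_widen1, IH.
Qed.

(** Shifting the argument moves the pole at -k to -(k + 1), which changes the
    sign in the alternating sum. *)
Lemma alt_double_shift m f v : alt_double m f v ->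
  alt_double (S m) (fun t => f (t + 1)) (- v).
Proof.
  intros (A & A' & A'' & B & HB & Hf & Hv).
  set (sh := fun (F : nat -> R) k => match k with O => 0 | S k => F k end).
  exists (sh A), (sh A'), (sh A''), (fun t => B (t + 1)); split; [|split].
  - destruct HB as [l Hl].
    apply (is_poly_ext _ (fun t => horner l (t + 1))); [intros; now rewrite Hl|].
    clear. induction l as [|c l IH]; cbn; [apply is_poly_const|].
    apply is_poly_plus; [apply is_poly_const|].
    apply is_poly_mult; [apply is_poly_add|exact IH].
  - intros t Ht. rewrite Hf.
    + unfold poles; rewrite rsum_S_l. cbn [sh INR].
      rewrite (rsum_ext (fun k => A k / (t + INR (S k)) ^ 3
                         + A' k / (t + INR (S k)) ^ 2 + A'' k / (t + INR (S k)))
        (fun k => A k / (t + 1 + INR k) ^ 3 + A' k / (t + 1 + INR k) ^ 2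
                  + A'' k / (t + 1 + INR k))).
      * unfold Rdiv; ring.
      * intros k _. rewrite S_INR. replace (t + (INR k + 1)) with (t + 1 + INR k) by ring.
        reflexivity.
    + intros k Hk. generalize (Ht (S k) ltac:(lia)). rewrite S_INR.
      intros H; lra.
  - rewrite rsum_S_l, Hv. cbn [sh].
    rewrite (rsum_ext (fun k => (-1) ^ S k * A' k)
      (fun k => -1 * ((-1) ^ k * A' k) + 0 * 0)) by (intros; cbn; ring).
    rewrite (rsum_lin _ (fun _ => 0)). ring.
Qed.

Lemma alt_Rn n : alt_double (n + 1) (Rn n) (- a n).
Proof.
  destruct (proj2_sig (constructive_indefinite_description _ (partial_fractions_ex' n)))
    as (A & A'' & B & HB & H).
  change (proj1_sig _) with (Acoef' n) in H.
  exists A, (Acoef' n), A'', B; split; [easy|]; split.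
  - intros t Ht. rewrite H by (intros k Hk; apply Ht; lia).
    unfold poles. now rewrite Nat.add_1_r, rsum_S_sum_f_R0.
  - unfold a. rewrite Nat.add_1_r, rsum_S_sum_f_R0. ring.
Qed.

Lemma alt_rec_op m (F : nat -> R -> R) (v : nat -> R) n :
  (forall i, (i <= n + 1)%nat -> alt_double m (F i) (v i)) ->
  alt_double m (fun t => rec_op (fun i => F i t) n) (rec_op v n).
Proof.
  intros H. replace (rec_op v n)
    with (1 * (cA (INR n) * v (n + 1)%nat + - cB (INR n) * v n)
          + 1 * (cC (INR n) * v (n - 1)%nat + - cD (INR n) * v (n - 2)%nat))
    by (unfold rec_op; ring).
  eapply alt_double_ext; [|apply alt_double_lin; apply alt_double_lin; apply H; lia].
  intros t _; unfold rec_op; cbv beta; ring.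
Qed.

(** The functional changes sign under the shift, so it kills S(t + 1) + S(t). *)
Lemma recurrence_a : recurrence a.
Proof.
  apply recurrence_intro; intros k.
  destruct (Sn_decomposable k) as (g & _ & HS & _).
  destruct (decomposable_alt _ _ HS) as [v Hv].
  assert (H1 : alt_double (k + 4) (fun t => rec_op (fun i => Rn i t) (k + 2)) 0).
  { replace 0 with (1 * - v + 1 * v) by ring.
    apply (alt_double_ext _ (fun t => 1 * Sn k (t + 1) + 1 * Sn k t)).
    - intros t Ht; rewrite telescoping by easy; ring.
    - apply alt_double_lin.
      + replace (k + 4)%nat with (S (k + 3)) by lia. now apply alt_double_shift.
      + apply (alt_double_widen (k + 3)); [lia|easy]. }
  assert (H2 : alt_double (k + 4) (fun t => rec_op (fun i => Rn i t) (k + 2))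
                 (rec_op (fun i => - a i) (k + 2))).
  { apply alt_rec_op; intros i Hi. apply (alt_double_widen (i + 1)); [lia|].
    apply alt_Rn. }
  assert (E := alt_double_unique _ _ _ _ H1 H2).
  unfold rec_op in *; lra.
Qed.

Lemma recurrence_b : recurrence b.
Proof.
  apply recurrence_intro; intros k.
  assert (Ha := recurrence_elim _ k recurrence_a).
  assert (Hr := recurrence_elim _ k recurrence_r).
  transitivity (PI ^ 2 / 12 * rec_op a (k + 2) - rec_op r (k + 2)); [|rewrite Ha, Hr; ring].
  rewrite <- rec_op_scal, <- rec_op_minus. unfold b, rec_op; ring.
Qed.

Lemma recurrence_bt : recurrence bt.
Proof.
  apply recurrence_intro; intros k.
  assert (Ha := recurrence_elim _ k recurrence_a).
  assert (Hr := recurrence_elim _ k recurrence_rt).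
  transitivity (3 * zeta 3 / 2 * rec_op a (k + 2) - rec_op rt (k + 2)); [|rewrite Ha, Hr; ring].
  rewrite <- rec_op_scal, <- rec_op_minus. unfold bt, rec_op; ring.
Qed.

(** * Zeta values and initial values *)

Lemma rsum_app f M N : rsum f (M + N) = rsum f M + rsum (fun k => f (M + k)%nat) N.
Proof.
  induction N as [|N IH]; cbn; [rewrite Nat.add_0_r; ring|].
  rewrite Nat.add_succ_r; cbn. rewrite IH; ring.
Qed.

Lemma rsum_rev f N : rsum f N = rsum (fun k => f (N - 1 - k)%nat) N.
Proof.
  induction N as [|N IH]; [easy|].
  rewrite (rsum_S_l (fun k => f (S N - 1 - k)%nat)). cbn [rsum].
  rewrite IH, Rplus_comm. f_equal.
  - f_equal; lia.
  - apply rsum_ext; intros k Hk; f_equal; lia.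
Qed.

Lemma rsum_plus f g m : rsum (fun k => f k + g k) m = rsum f m + rsum g m.
Proof. induction m as [|m IH]; cbn; [ring|rewrite IH; ring]. Qed.

Lemma rsum_fold f M : rsum f (M + M) = rsum (fun k => f k + f (M + M - 1 - k)%nat) M.
Proof.
  rewrite rsum_app, rsum_plus. f_equal. rewrite rsum_rev.
  apply rsum_ext; intros k Hk; f_equal; lia.
Qed.

Lemma rsum_le f g m : (forall k, (k < m)%nat -> f k <= g k) -> rsum f m <= rsum g m.
Proof.
  induction m as [|m IH]; intros H; cbn; [lra|].
  apply Rplus_le_compat; [apply IH; auto|apply H; lia].
Qed.

Lemma rsum_scal c f m : rsum (fun k => c * f k) m = c * rsum f m.
Proof. induction m as [|m IH]; cbn; [ring|rewrite IH; ring]. Qed.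

Lemma rsum_const c m : rsum (fun _ => c) m = INR m * c.
Proof. induction m as [|m IH]; [cbn; ring|]. cbn [rsum]; rewrite IH, S_INR; ring. Qed.

Lemma x_cos_le_sin x : 0 < x < PI / 2 -> x * cos x <= sin x.
Proof.
  intros Hx.
  destruct (MVT_gen (fun x => sin x - x * cos x) 0 x (fun x => x * sin x)) as (c & Hc & E).
  - intros t _. auto_derive; [easy|ring].
  - intros t _. apply continuity_pt_filterlim.
    change (continuous (fun x => sin x - x * cos x) t).
    apply ex_derive_cont.
    auto_derive; easy.
  - rewrite Rmin_left, Rmax_right in Hc by lra.
    rewrite sin_0 in E.
    assert (0 <= sin c) by (apply sin_ge_0; lra).
    assert (0 <= c * sin c * (x - 0)) by (repeat apply Rmult_le_pos; lra). lra.
Qed.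

Lemma inv_sin_sq_bounds x : 0 < x < PI / 2 -> / x ^ 2 <= / sin x ^ 2 <= 1 + / x ^ 2.
Proof.
  intros Hx.
  assert (H1 : 0 < sin x) by (apply sin_gt_0; lra).
  assert (H2 := sin_lt_x x ltac:(lra)).
  assert (H3 := x_cos_le_sin x Hx).
  assert (H4 : 0 < cos x) by (apply cos_gt_0; lra).
  split.
  - apply Rinv_le_contravar; [apply pow_lt; easy|]. apply pow_incr; lra.
  - assert (E := sin2_cos2 x). unfold Rsqr in E.
    assert (0 < sin x ^ 2) by (apply pow_lt; easy).
    assert (0 < x ^ 2) by (apply pow_lt; lra).
    apply Rmult_le_reg_l with (sin x ^ 2 * x ^ 2); [nra|].
    replace (sin x ^ 2 * x ^ 2 * / sin x ^ 2) with (x ^ 2) by (field; lra).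
    replace (sin x ^ 2 * x ^ 2 * (1 + / x ^ 2)) with (sin x ^ 2 * x ^ 2 + sin x ^ 2)
      by (field; lra).
    assert ((x * cos x) ^ 2 <= sin x ^ 2) by (apply pow_incr; split; [nra|easy]).
    nra.
Qed.

Lemma pow2_INR n : INR (2 ^ n) = 2 ^ n.
Proof. rewrite pow_INR; cbn; f_equal; ring. Qed.

Lemma odd_angle_bounds n k : (k < 2 ^ n)%nat ->
  0 < INR (2 * k + 1) * PI / (4 * 2 ^ n) < PI / 2.
Proof.
  intros Hk. assert (Hp : 0 < 2 ^ n) by (apply pow_lt; lra). assert (HPI := PI_RGT_0).
  assert (Hk' : INR k + 1 <= 2 ^ n) by (rewrite <- pow2_INR, <- S_INR; apply le_INR; lia).
  assert (Hk0 := pos_INR k). rewrite plus_INR, mult_INR; cbn [INR]. split.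
  - apply Rdiv_lt_0_compat; nra.
  - apply Rmult_lt_reg_r with (4 * 2 ^ n); [lra|].
    replace (((1 + 1) * INR k + 1) * PI / (4 * 2 ^ n) * (4 * 2 ^ n))
      with (((1 + 1) * INR k + 1) * PI) by (field; lra). nra.
Qed.

(** 1/sin^2(x) + 1/cos^2(x) = 4/sin^2(2x), summed over the odd multiples of a
    dyadic fraction of pi. *)
Lemma sum_inv_sin_sq n :
  rsum (fun k => / sin (INR (2 * k + 1) * PI / (4 * 2 ^ n)) ^ 2) (2 ^ n) = 2 * 4 ^ n.
Proof.
  induction n as [|n IH].
  - cbn [Nat.pow rsum pow]. rewrite Nat.mul_0_r. cbn [Nat.add INR].
    replace (1 * PI / (4 * 1)) with (PI / 4) by field.
    rewrite sin_PI4. assert (H := sqrt_sqrt 2 ltac:(lra)).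
    assert (Hs : sqrt 2 <> 0) by (apply Rgt_not_eq, sqrt_lt_R0; lra).
    replace (1 / sqrt 2 * (1 / sqrt 2 * 1)) with (/ (sqrt 2 * sqrt 2)) by (field; easy).
    rewrite H; field.
  - assert (Hp : 0 < 2 ^ n) by (apply pow_lt; lra). assert (HPI := PI_RGT_0).
    replace (2 ^ S n)%nat with (2 ^ n + 2 ^ n)%nat by (cbn; lia).
    rewrite rsum_fold. cbn [pow].
    replace (2 * (4 * 4 ^ n)) with (4 * (2 * 4 ^ n)) by ring. rewrite <- IH, <- rsum_scal.
    apply rsum_ext; intros k Hk.
    set (th := INR (2 * k + 1) * PI / (4 * (2 * 2 ^ n))).
    assert (Hth : 0 < th < PI / 2) by (apply (odd_angle_bounds (S n) k); cbn; lia).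
    replace (INR (2 * (2 ^ n + 2 ^ n - 1 - k) + 1) * PI / (4 * (2 * 2 ^ n)))
      with (PI / 2 - th).
    2:{ unfold th. rewrite !plus_INR, !mult_INR, !minus_INR, !plus_INR, pow2_INR by lia.
        cbn [INR]. field. lra. }
    replace (INR (2 * k + 1) * PI / (4 * 2 ^ n)) with (2 * th)
      by (unfold th; field; lra).
    rewrite sin_shift, sin_2a.
    assert (H1 : 0 < sin th) by (apply sin_gt_0; lra).
    assert (H4 : 0 < cos th) by (apply cos_gt_0; lra).
    assert (E := sin2_cos2 th). unfold Rsqr in E.
    replace (4 * / (2 * sin th * cos th) ^ 2)
      with ((sin th * sin th + cos th * cos th) / (sin th ^ 2 * cos th ^ 2))
      by (rewrite E; field; lra).
    field; lra.
Qed.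

(** 1/x^2 and 1/sin^2(x) differ by at most 1, and there are only 2^n terms
    while both sums are of size 4^n. *)
Lemma odd_squares_bounds n :
  PI ^ 2 / 8 - PI ^ 2 / (16 * 2 ^ n)
  <= rsum (fun k => / INR (2 * k + 1) ^ 2) (2 ^ n) <= PI ^ 2 / 8.
Proof.
  assert (Hp : 0 < 2 ^ n) by (apply pow_lt; lra). assert (HPI := PI_RGT_0).
  set (x := fun k => INR (2 * k + 1) * PI / (4 * 2 ^ n)).
  assert (E : rsum (fun k => / sin (x k) ^ 2) (2 ^ n) = 2 * 4 ^ n)
    by exact (sum_inv_sin_sq n).
  set (O := rsum (fun k => / INR (2 * k + 1) ^ 2) (2 ^ n)).
  assert (Hx : forall k, (k < 2 ^ n)%nat -> 0 < x k < PI / 2) by apply odd_angle_bounds.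
  assert (EO : rsum (fun k => / x k ^ 2) (2 ^ n) = 16 * 4 ^ n / PI ^ 2 * O).
  { unfold O; rewrite <- rsum_scal. apply rsum_ext; intros k Hk. unfold x.
    assert (0 < INR (2 * k + 1)) by (apply lt_0_INR; lia).
    replace (4 ^ n) with (2 ^ n * 2 ^ n) by (rewrite <- Rpow_mult_distr; f_equal; ring).
    field. repeat split; lra. }
  assert (L1 := rsum_le (fun k => / x k ^ 2) (fun k => / sin (x k) ^ 2) (2 ^ n)
    (fun k Hk => proj1 (inv_sin_sq_bounds _ (Hx k Hk)))).
  assert (L2 := rsum_le (fun k => / sin (x k) ^ 2) (fun k => 1 + / x k ^ 2) (2 ^ n)
    (fun k Hk => proj2 (inv_sin_sq_bounds _ (Hx k Hk)))).
  rewrite rsum_plus, rsum_const, pow2_INR, EO, E in L2. rewrite EO, E in L1.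
  assert (E4 : 4 ^ n = 2 ^ n * 2 ^ n) by (rewrite <- Rpow_mult_distr; f_equal; ring).
  rewrite E4 in L1, L2. set (q := 2 ^ n) in *.
  assert (HP2 : 0 < PI ^ 2) by (apply pow_lt; lra).
  assert (EE : O = 16 * (q * q) / PI ^ 2 * O * (PI ^ 2 / (16 * (q * q)))) by (field; lra).
  assert (Hq : 0 < PI ^ 2 / (16 * (q * q))) by (apply Rdiv_lt_0_compat; nra).
  split; rewrite EE.
  - apply Rle_trans with ((2 * (q * q) - q) * (PI ^ 2 / (16 * (q * q)))).
    + right; field; lra.
    + apply Rmult_le_compat_r; lra.
  - apply Rle_trans with ((2 * (q * q)) * (PI ^ 2 / (16 * (q * q)))).
    + apply Rmult_le_compat_r; lra.
    + right; field; lra.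
Qed.

Lemma sum_n_rsum f n : sum_n f n = rsum f (S n).
Proof. rewrite sum_n_Reals. now rewrite rsum_S_sum_f_R0. Qed.

Lemma is_lim_seq_pow2_inv c : is_lim_seq (fun n => c / 2 ^ n) 0.
Proof.
  apply (is_lim_seq_ext (fun n => c * (/ 2) ^ n)).
  - intros n. now rewrite pow_inv.
  - replace (Finite 0) with (Finite (c * 0)) by (f_equal; ring).
    apply is_lim_seq_mult'; [apply is_lim_seq_const|].
    apply is_lim_seq_geom. rewrite Rabs_pos_eq; lra.
Qed.

Lemma Series_odd_squares :
  ex_series (fun k => / INR (2 * k + 1) ^ 2) ->
  Series (fun k => / INR (2 * k + 1) ^ 2) = PI ^ 2 / 8.
Proof.
  intros Hex. apply Series_correct in Hex.
  set (l := Series _) in *.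
  change (is_lim_seq (sum_n (fun k => / INR (2 * k + 1) ^ 2)) l) in Hex.
  assert (L1 : is_lim_seq (fun n => rsum (fun k => / INR (2 * k + 1) ^ 2) (2 ^ n)) l).
  { apply (is_lim_seq_ext (fun n => sum_n (fun k => / INR (2 * k + 1) ^ 2) (2 ^ n - 1))).
    - intros n. rewrite sum_n_rsum. f_equal.
      assert (2 ^ n <> 0)%nat by (apply Nat.pow_nonzero; lia). lia.
    - apply (is_lim_seq_subseq _ _ (fun n => 2 ^ n - 1)%nat); [|easy].
      apply eventually_subseq. intros n. cbn [Nat.pow].
      assert (2 ^ n <> 0)%nat by (apply Nat.pow_nonzero; lia). lia. }
  assert (L2 : is_lim_seq (fun n => rsum (fun k => / INR (2 * k + 1) ^ 2) (2 ^ n)) (PI ^ 2 / 8)).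
  { apply (is_lim_seq_le_le (fun n => PI ^ 2 / 8 - PI ^ 2 / 16 / 2 ^ n) _
             (fun n => PI ^ 2 / 8)).
    - intros n. generalize (odd_squares_bounds n).
      replace (PI ^ 2 / (16 * 2 ^ n)) with (PI ^ 2 / 16 / 2 ^ n); [easy|].
      field. apply pow_nonzero; lra.
    - replace (Finite (PI ^ 2 / 8)) with (Finite (PI ^ 2 / 8 - 0)) by (f_equal; ring).
      apply is_lim_seq_minus'; [apply is_lim_seq_const|apply is_lim_seq_pow2_inv].
    - apply is_lim_seq_const. }
  apply is_lim_seq_unique in L1, L2. rewrite L1 in L2. now injection L2.
Qed.

Lemma Series_even_odd f (l0 l1 : R) : is_series (fun m => f (2 * m)%nat) l0 ->
  is_series (fun m => f (2 * m + 1)%nat) l1 -> ex_series f -> Series f = l0 + l1.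
Proof.
  intros H0 H1 Hf. apply Series_correct in Hf. set (l := Series f) in *.
  change (is_lim_seq (sum_n (fun m => f (2 * m)%nat)) l0) in H0.
  change (is_lim_seq (sum_n (fun m => f (2 * m + 1)%nat)) l1) in H1.
  change (is_lim_seq (sum_n f) l) in Hf.
  assert (H := is_lim_seq_plus' _ _ _ _ H0 H1).
  assert (H' : is_lim_seq (fun n => sum_n f (2 * n + 1)) l).
  { apply (is_lim_seq_subseq _ _ (fun n => 2 * n + 1)%nat); [|easy].
    apply eventually_subseq. intros n; lia. }
  apply (is_lim_seq_ext _ (fun n => sum_n (fun m => f (2 * m)%nat) n
                                    + sum_n (fun m => f (2 * m + 1)%nat) n)) in H'.
  - apply is_lim_seq_unique in H, H'. rewrite H in H'. now injection H'.
  - intros n; induction n as [|n IH].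
    + change (2 * 0 + 1)%nat with 1%nat. rewrite sum_Sn, !sum_O. reflexivity.
    + replace (2 * S n + 1)%nat with (S (S (2 * n + 1))) by lia.
      rewrite (sum_Sn f (S _)), (sum_Sn f), IH, !sum_Sn. unfold plus; cbn -[INR Nat.mul].
      replace (S (2 * n + 1)) with (2 * S n)%nat by lia.
      replace (S (2 * S n)) with (2 * S n + 1)%nat by lia. ring.
Qed.

Lemma ex_series_inv_pow s : ex_series (fun m => / (INR m + 1) ^ (2 + s)).
Proof.
  apply (ex_series_dom _ (fun m => / (INR m + 1) ^ 2)); [|apply ex_series_inv_sq].
  intros m. assert (H := INR1_ge m).
  assert (0 < (INR m + 1) ^ 2) by (apply pow_lt; lra).
  rewrite Rabs_pos_eq by (apply Rlt_le, Rinv_0_lt_compat, pow_lt; lra).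
  apply Rinv_le_contravar; [easy|]. apply Rle_pow; [lra|lia].
Qed.

Lemma is_series_ext_R (f g : nat -> R) (l : R) :
  (forall m, f m = g m) -> is_series f l -> is_series g l.
Proof. apply is_series_ext. Qed.

(** Even terms are 2^-s times the whole zeta series; they enter with opposite
    signs in the zeta and in the alternating series. *)
Lemma zeta_split s (l : R) :
  is_series (fun k => / INR (2 * k + 1) ^ (2 + s)) l ->
  zeta (2 + s) = l + (/ 2) ^ (2 + s) * zeta (2 + s) /\
  gser (fun m => / (INR m + 1) ^ (2 + s)) (-1) = l - (/ 2) ^ (2 + s) * zeta (2 + s).
Proof.
  intros Ho.
  assert (EZ : zeta (2 + s) = Series (fun m => / (INR m + 1) ^ (2 + s))).
  { apply Series_ext; intros m. now rewrite INR_add_1. }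
  assert (HZ := ex_series_inv_pow s).
  assert (Hev : is_series (fun m => / (INR (2 * m + 1) + 1) ^ (2 + s))
                  ((/ 2) ^ (2 + s) * zeta (2 + s))).
  { apply (is_series_ext_R (fun m => scal ((/ 2) ^ (2 + s)) (/ (INR m + 1) ^ (2 + s)))).
    - intros m. change (scal ?a ?b) with (a * b).
      rewrite <- !pow_inv, <- Rpow_mult_distr. f_equal.
      rewrite <- Rinv_mult. f_equal. rewrite plus_INR, mult_INR; cbn [INR]; ring.
    - rewrite EZ. apply (is_series_scal (K := R_AbsRing) (V := R_NormedModule) ((/ 2) ^ (2 + s))).
      apply Series_correct, HZ. }
  assert (Ho' : is_series (fun m => / (INR (2 * m) + 1) ^ (2 + s)) l).
  { apply (is_series_ext_R (fun k => / INR (2 * k + 1) ^ (2 + s))); [|exact Ho].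
    intros m. now rewrite INR_add_1. }
  split.
  - rewrite EZ at 1. exact (Series_even_odd _ _ _ Ho' Hev HZ).
  - unfold gser, Rminus. apply Series_even_odd.
    + apply (is_series_ext_R (fun m => / (INR (2 * m) + 1) ^ (2 + s))); [|exact Ho'].
      intros m. rewrite pow_1_even; ring.
    + apply (is_series_ext_R (fun m => - (/ (INR (2 * m + 1) + 1) ^ (2 + s)))).
      * intros m. rewrite Nat.add_1_r, pow_1_odd. ring.
      * apply (is_series_opp (K := R_AbsRing) (V := R_NormedModule)
          (fun m => / (INR (2 * m + 1) + 1) ^ (2 + s))), Hev.
    + apply (ex_series_dom _ (fun m => / (INR m + 1) ^ (2 + s))); [|exact HZ].
      intros m. assert (H := INR1_ge m).
      rewrite Rabs_mult, pow_1_abs, Rmult_1_l, Rabs_pos_eq; [lra|].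
      apply Rlt_le, Rinv_0_lt_compat, pow_lt; lra.
Qed.

Lemma ex_series_odd s : ex_series (fun k => / INR (2 * k + 1) ^ (2 + s)).
Proof.
  apply (ex_series_dom _ (fun m => / (INR m + 1) ^ (2 + s))); [|apply ex_series_inv_pow].
  intros m. assert (H := INR1_ge m). rewrite INR_add_1, mult_INR; cbn [INR].
  assert (Hm := pos_INR m).
  rewrite Rabs_pos_eq by (apply Rlt_le, Rinv_0_lt_compat, pow_lt; lra).
  apply Rinv_le_contravar; [apply pow_lt; lra|]. apply pow_incr; lra.
Qed.

Lemma eta_2 : gser (fun m => / (INR m + 1) ^ 2) (-1) = PI ^ 2 / 12.
Proof.
  assert (H := Series_correct _ (ex_series_odd 0)). cbn [Nat.add] in H.
  rewrite Series_odd_squares in H by exact (ex_series_odd 0).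
  destruct (zeta_split 0 _ H) as [E1 E2]. cbn [Nat.add] in *.
  rewrite E2. cbn [pow] in *. lra.
Qed.

Lemma eta_3 : gser (fun m => / (INR m + 1) ^ 3) (-1) = 3 / 4 * zeta 3.
Proof.
  assert (H := Series_correct _ (ex_series_odd 1)). cbn [Nat.add] in H.
  destruct (zeta_split 1 _ H) as [E1 E2]. cbn [Nat.add] in *.
  rewrite E2. cbn [pow] in *. lra.
Qed.

Lemma zeta_3_pos : 0 < zeta 3.
Proof.
  unfold zeta.
  assert (Hex : ex_series (fun m => / INR (m + 1) ^ 3)).
  { apply (ex_series_ext (fun m => / (INR m + 1) ^ 3)); [|exact (ex_series_inv_pow 1)].
    intros m; now rewrite INR_add_1. }
  rewrite Series_incr_1 by easy.
  assert (0 <= Series (fun k => / INR (S k + 1) ^ 3)).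
  { apply Series_nonneg.
    - intros m. apply Rlt_le, Rinv_0_lt_compat, pow_lt, lt_0_INR; lia.
    - now apply (ex_series_incr_1 (fun m => / INR (m + 1) ^ 3)). }
  replace (/ INR (0 + 1) ^ 3) with 1 by (cbn; field). lra.
Qed.

(** The value at -1 attached to 1/(m + 1 + k)^s, when E is the one for k = 0. *)
Fixpoint tail_value (s : nat) (E : R) (k : nat) : R :=
  match k with
  | O => E
  | S k => / (1 + INR k) ^ s - tail_value s E k
  end.

Lemma abel_tail s E k : abel (fun m => / (INR m + 1) ^ s) E ->
  abel (fun m => / (INR m + 1 + INR k) ^ s) (tail_value s E k).
Proof.
  intros H; induction k as [|k IH].
  - eapply abel_ext; [|exact H]. intros m; cbn [INR]. now rewrite Rplus_0_r.
  - generalize (abel_S _ _ IH). cbn [tail_value]. cbv beta.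
    replace (INR 0 + 1 + INR k) with (1 + INR k) by (cbn; ring).
    apply abel_ext. intros m; do 2 f_equal. rewrite !S_INR; ring.
Qed.

Lemma abel_const c : abel (fun _ => c) (c / 2).
Proof.
  replace (c / 2) with ((c - 0) / 2) by field.
  apply (abel_diff (fun _ => c)); [apply poly_growth_const|].
  replace 0 with (gser (fun _ => c - c) (-1)).
  - apply (abel_dom_sq _ 0). intros m.
    replace (c - c) with 0 by ring. rewrite Rabs_R0. unfold Rdiv; lra.
  - unfold gser. rewrite (Series_ext _ (fun _ => 0 * 0)), Series_scal_l; [ring|].
    intros; ring.
Qed.

Lemma abel_rsum_value (f : nat -> nat -> R) v m :
  (forall k, abel (f k) (v k)) -> abel (fun i => rsum (fun k => f k i) m) (rsum v m).
Proof.
  intros H; induction m as [|m IH]; cbn.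
  - generalize (abel_const 0). now replace (0 / 2) with 0 by field.
  - now apply abel_plus.
Qed.

(** Reads off a_n, r_n and its tilde companion from an explicit decomposition
    with constant polynomial part, which covers n <= 2.  The values E1 and E4
    cancel in the cases of interest and can stay unknown. *)
Lemma values_of_poles n A A' A'' c E1 E2 E3 E4 :
  abel (fun m => / (INR m + 1) ^ 1) E1 -> abel (fun m => / (INR m + 1) ^ 2) E2 ->
  abel (fun m => / (INR m + 1) ^ 3) E3 -> abel (fun m => / (INR m + 1) ^ 4) E4 ->
  (forall t, off_poles (n + 1) t -> Rn n t = poles A A' A'' (n + 1) t + c) ->
  a n = - rsum (fun k => (-1) ^ k * A' k) (n + 1) /\
  r n = - (rsum (fun k => A k * tail_value 3 E3 k + A' k * tail_value 2 E2 k
                          + A'' k * tail_value 1 E1 k) (n + 1) + c / 2) /\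
  rt n = rsum (fun k => -3 * A k * tail_value 4 E4 k + -2 * A' k * tail_value 3 E3 k
                        + - A'' k * tail_value 2 E2 k) (n + 1).
Proof.
  intros H1 H2 H3 H4 H. split; [|split].
  - assert (L : alt_double (n + 1) (Rn n) (rsum (fun k => (-1) ^ k * A' k) (n + 1))).
    { exists A, A', A'', (fun _ => c); split; [apply is_poly_const|]; split; [exact H|easy]. }
    generalize (alt_double_unique _ _ _ _ L (alt_Rn n)). lra.
  - assert (L : abel (fun m => Rn n (INR m + 1))
      (rsum (fun k => A k * tail_value 3 E3 k + A' k * tail_value 2 E2 k
                          + A'' k * tail_value 1 E1 k) (n + 1) + c / 2)).
    { eapply abel_ext; [|apply abel_plus; [|apply (abel_const c)];
        apply (abel_rsum_value (fun k i => A k * / (INR i + 1 + INR k) ^ 3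
          + A' k * / (INR i + 1 + INR k) ^ 2 + A'' k * / (INR i + 1 + INR k) ^ 1))].
      - intros m; cbv beta. rewrite H.
        + f_equal. apply rsum_ext; intros k _. unfold Rdiv. now rewrite pow_1.
        + apply off_poles_pos. generalize (pos_INR m); lra.
      - intros k; apply abel_plus; [apply abel_plus|]; apply abel_scal; now apply abel_tail. }
    generalize (abel_unique _ _ _ L (proj2 (abel_Rn n))). lra.
  - assert (L : abel (fun m => Derive (Rn n) (INR m + 1))
      (rsum (fun k => -3 * A k * tail_value 4 E4 k + -2 * A' k * tail_value 3 E3 k
                        + - A'' k * tail_value 2 E2 k) (n + 1))).
    { eapply abel_ext; [|
        apply (abel_rsum_value (fun k i => -3 * A k * / (INR i + 1 + INR k) ^ 4
          + -2 * A' k * / (INR i + 1 + INR k) ^ 3 + - A'' k * / (INR i + 1 + INR k) ^ 2))].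
      - intros m; cbv beta. symmetry.
        assert (Hm : 0 < INR m + 1) by (generalize (pos_INR m); lra).
        apply is_derive_unique.
        apply (is_derive_ext_loc (fun t => poles A A' A'' (n + 1) t + c)).
        + apply locally_pos; [easy|]. intros s Hs; symmetry; now apply H, off_poles_pos.
        + match goal with |- is_derive _ _ ?d =>
            replace d with (dpoles A A' A'' (n + 1) (INR m + 1) + 0) by apply Rplus_0_r end.
          apply (is_derive_plus (K := R_AbsRing) (V := R_NormedModule));
            [now apply is_derive_poles|].
          apply (is_derive_const (K := R_AbsRing) (V := R_NormedModule)).
      - intros k; apply abel_plus; [apply abel_plus|]; apply abel_scal; now apply abel_tail. }
    exact (abel_unique _ _ _ (proj2 (abel_Derive_Rn n)) L).
Qed.

Lemma abel_values : exists E1 E4,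
  abel (fun m => / (INR m + 1) ^ 1) E1 /\ abel (fun m => / (INR m + 1) ^ 2) (PI ^ 2 / 12) /\
  abel (fun m => / (INR m + 1) ^ 3) (3 / 4 * zeta 3) /\ abel (fun m => / (INR m + 1) ^ 4) E4.
Proof.
  destruct (abel_inv 1 0 Rlt_0_1) as [E1 H1], (abel_inv 1 3 Rlt_0_1) as [E4 H4].
  exists E1, E4; split; [easy|]; split; [|split; [|easy]].
  - destruct (dom_sq_inv 1 0 Rlt_0_1) as [C HC]. rewrite <- eta_2.
    exact (abel_dom_sq _ C HC).
  - destruct (dom_sq_inv 1 1 Rlt_0_1) as [C HC]. rewrite <- eta_3.
    exact (abel_dom_sq _ C HC).
Qed.

Lemma values_0 : a 0 = 1 /\ r 0 = PI ^ 2 / 12 /\ rt 0 = 3 * zeta 3 / 2.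
Proof.
  destruct abel_values as (E1 & E4 & H1 & H2 & H3 & H4).
  destruct (values_of_poles 0 (fun _ => 0) (fun _ => -1) (fun _ => 0) 0 _ _ _ _ H1 H2 H3 H4)
    as (Ha & Hr & Ht).
  - intros t Ht. assert (H0 := Ht 0%nat ltac:(lia)). cbn [INR] in H0.
    unfold Rn, poles; cbn. field. lra.
  - rewrite Ha, Hr, Ht; cbn. lra.
Qed.

Lemma values_1 : a 1 = 8 /\ r 1 = 8 * (PI ^ 2 / 12) - 13 / 2 /\
  rt 1 = 8 * (3 * zeta 3 / 2) - 29 / 2.
Proof.
  destruct abel_values as (E1 & E4 & H1 & H2 & H3 & H4).
  destruct (values_of_poles 1 (fun _ => 2) (fun k => if Nat.eqb k 0 then -4 else 4)
     (fun _ => 1 / 2) 0 _ _ _ _ H1 H2 H3 H4) as (Ha & Hr & Ht).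
  - intros t Ht. assert (T0 := Ht 0%nat ltac:(lia)). assert (T1 := Ht 1%nat ltac:(lia)).
    cbn [INR] in T0, T1.
    unfold Rn, poles; cbn. field. lra.
  - rewrite Ha, Hr, Ht; cbn. lra.
Qed.

Lemma values_2 : a 2 = 264 /\ r 2 = 264 * (PI ^ 2 / 12) - 1737 / 8 /\
  rt 2 = 264 * (3 * zeta 3 / 2) - 7617 / 16.
Proof.
  destruct abel_values as (E1 & E4 & H1 & H2 & H3 & H4).
  destruct (values_of_poles 2
     (fun k => match k with O => -36 | 1%nat => 0 | _ => 36 end)
     (fun k => match k with O => 192 | 1%nat => 648 | _ => 192 end)
     (fun k => match k with O => -2041 / 4 | 1%nat => 0 | _ => 2041 / 4 end) (- 1 / 2)
     _ _ _ _ H1 H2 H3 H4) as (Ha & Hr & Ht).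
  - intros t Ht. assert (T0 := Ht 0%nat ltac:(lia)). assert (T1 := Ht 1%nat ltac:(lia)).
    assert (T2 := Ht 2%nat ltac:(lia)).
    cbn [INR] in T0, T1, T2.
    unfold Rn, poles; cbn. field. lra.
  - rewrite Ha, Hr, Ht; cbn. lra.
Qed.

(** * Alternating sums with completely monotone weights *)

Definition bdiff (u : nat -> R) (m : nat) : R := u m - u (S m).

Fixpoint bdiff_iter (j : nat) (u : nat -> R) : nat -> R :=
  match j with
  | O => u
  | S j => bdiff_iter j (bdiff u)
  end.

(** Completely monotone sequences.  They are the moment sequences of measures on
    [0, 1], but only the signs of their differences are used: operators that are
    functions of the shift act on them as on x in [0, 1]. *)
Definition cm (u : nat -> R) : Prop := forall j m, 0 <= bdiff_iter j u m.

Lemma bdiff_iter_ext j u v : (forall m, u m = v m) ->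
  forall m, bdiff_iter j u m = bdiff_iter j v m.
Proof.
  revert u v; induction j as [|j IH]; intros u v H; cbn; [exact H|].
  apply IH. intros m; unfold bdiff; now rewrite !H.
Qed.

Lemma cm_ext u v : (forall m, u m = v m) -> cm u -> cm v.
Proof. intros E H j m; rewrite <- (bdiff_iter_ext j u v E); apply H. Qed.

Lemma bdiff_iter_lin j c d u v m :
  bdiff_iter j (fun m => c * u m + d * v m) m
  = c * bdiff_iter j u m + d * bdiff_iter j v m.
Proof.
  revert u v m; induction j as [|j IH]; intros u v m; cbn; [easy|].
  rewrite <- IH. apply bdiff_iter_ext. intros k; unfold bdiff; ring.
Qed.

Lemma bdiff_iter_S j u m : bdiff_iter j (fun m => u (S m)) m = bdiff_iter j u (S m).
Proof.
  revert u m; induction j as [|j IH]; intros u m; cbn; [easy|].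
  exact (IH (bdiff u) m).
Qed.

Lemma cm_lin c d u v : 0 <= c -> 0 <= d -> cm u -> cm v ->
  cm (fun m => c * u m + d * v m).
Proof.
  intros Hc Hd Hu Hv j m; rewrite bdiff_iter_lin.
  apply Rplus_le_le_0_compat; now apply Rmult_le_pos.
Qed.

Lemma cm_bdiff u : cm u -> cm (bdiff u).
Proof. intros H j m; exact (H (S j) m). Qed.

Lemma cm_S u : cm u -> cm (fun m => u (S m)).
Proof. intros H j m; rewrite bdiff_iter_S; apply H. Qed.

Lemma cm_nonneg u : cm u -> forall m, 0 <= u m.
Proof. intros H m; exact (H 0%nat m). Qed.

Lemma cm_decr u : cm u -> forall m, u (S m) <= u m.
Proof. intros H m; generalize (H 1%nat m); cbn; unfold bdiff; lra. Qed.

Lemma cm_le_0 u : cm u -> forall m, u m <= u 0%nat.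
Proof.
  intros H m; induction m as [|m IH]; [lra|].
  generalize (cm_decr u H m); lra.
Qed.

(** Leibniz rule for backward differences. *)
Lemma cm_mult u v : cm u -> cm v -> cm (fun m => u m * v m).
Proof.
  intros Hu Hv j; revert u v Hu Hv; induction j as [|j IH]; intros u v Hu Hv m; cbn.
  - apply Rmult_le_pos; now apply cm_nonneg.
  - rewrite (bdiff_iter_ext j _ (fun m => 1 * (bdiff u m * v m) + 1 * (u (S m) * bdiff v m)))
      by (intros k; unfold bdiff; cbv beta; ring).
    rewrite (bdiff_iter_lin j 1 1 (fun m => bdiff u m * v m) (fun m => u (S m) * bdiff v m)).
    assert (H1 := IH _ _ (cm_bdiff u Hu) Hv m).
    assert (H2 := IH _ _ (cm_S u Hu) (cm_bdiff v Hv) m). cbn in H1, H2. lra.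
Qed.

Lemma cm_const c : 0 <= c -> cm (fun _ => c).
Proof.
  intros Hc j; revert c Hc; induction j as [|j IH]; intros c Hc m; cbn; [easy|].
  rewrite (bdiff_iter_ext j _ (fun _ => 0)) by (intros; unfold bdiff; cbv beta; ring).
  apply IH; lra.
Qed.

Lemma rising_pos x k : 0 < x -> 0 < rprod (fun i => x + INR i) k.
Proof.
  intros Hx; induction k as [|k IH]; cbn; [lra|].
  apply Rmult_lt_0_compat; [easy|]. generalize (pos_INR k); lra.
Qed.

(** The differences of a reciprocal rising factorial are again multiples of
    reciprocal rising factorials. *)
Lemma cm_inv_rising c k : 0 < c -> cm (fun m => / rprod (fun i => INR m + c + INR i) (S k)).
Proof.
  intros Hc j; revert k; induction j as [|j IH]; intros k m.
  - cbn -[rprod]. apply Rlt_le, Rinv_0_lt_compat, (rising_pos (INR m + c)).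
    generalize (pos_INR m); lra.
  - cbn -[rprod].
    rewrite (bdiff_iter_ext j _ (fun m => INR (S k) * / rprod (fun i => INR m + c + INR i) (S (S k))
                                  + 0 * 0)).
    + rewrite (bdiff_iter_lin j (INR (S k)) 0
        (fun m => / rprod (fun i => INR m + c + INR i) (S (S k))) (fun _ => 0)).
      rewrite Rmult_0_l, Rplus_0_r.
      apply Rmult_le_pos; [apply pos_INR|apply IH].
    + clear - Hc. intros m; unfold bdiff.
      assert (Hx : 0 < INR m + c) by (generalize (pos_INR m); lra).
      set (x := INR m + c) in *.
      set (p := rprod (fun i => x + INR i) (S k)).
      set (p' := rprod (fun i => INR (S m) + c + INR i) (S k)).
      assert (Hp : 0 < p) by (apply rising_pos; lra).
      assert (Hp' : 0 < p') by (apply rising_pos; rewrite S_INR; unfold x in *; lra).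
      assert (E1 : rprod (fun i => x + INR i) (S (S k)) = p * (x + INR (S k))) by reflexivity.
      assert (E2 : rprod (fun i => x + INR i) (S (S k)) = x * p').
      { rewrite rprod_S_l; f_equal; [cbn [INR]; ring|].
        apply rprod_ext; intros i _. cbv beta; unfold x; rewrite !S_INR; ring. }
      assert (Hk := pos_INR (S k)).
      assert (E3 : p' = p * (x + INR (S k)) / x).
      { rewrite <- E1, E2; field; lra. }
      rewrite E1, E3. field. repeat split; lra.
Qed.

Lemma cm_inv c : 0 < c -> cm (fun m => / (INR m + c)).
Proof.
  intros Hc. apply (cm_ext (fun m => / rprod (fun i => INR m + c + INR i) 1)).
  - intros m; cbn; f_equal; ring.
  - now apply cm_inv_rising.
Qed.

Definition bounded (w : nat -> R) : Prop := exists M, forall p, Rabs (w p) <= M.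

Lemma resolvent_nonneg w g y : 0 < y < 1 -> bounded w ->
  (forall p, w p + y * w (S p) = g p) -> (forall p, 0 <= g (S p) <= g p) ->
  forall p, 0 <= w p.
Proof.
  intros Hy [M HM] E Hg.
  assert (step : forall N p, (y ^ 2) ^ N * w (p + 2 * N)%nat <= w p).
  { induction N as [|N IH]; intros p.
    - replace (p + 2 * 0)%nat with p by lia. cbn; lra.
    - apply (Rle_trans _ ((y ^ 2) ^ N * w (p + 2 * N)%nat)); [|apply IH].
      replace (p + 2 * S N)%nat with (S (S (p + 2 * N))) by lia.
      set (q := (p + 2 * N)%nat).
      assert (y ^ 2 * w (S (S q)) <= w q).
      { generalize (E q) (E (S q)) (Hg q); intros E1 E2 [H1 H2].
        assert (y * g (S q) <= g q) by nra.
        rewrite <- E1, <- E2 in H. cbn. lra. }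
      assert (0 <= (y ^ 2) ^ N) by (apply pow_le; nra).
      cbn [pow] in *; nra. }
  intros p. destruct (Rle_lt_dec 0 (w p)) as [H|H]; [easy|exfalso].
  assert (HM0 : 0 <= M) by (generalize (HM 0%nat), (Rabs_pos (w 0%nat)); lra).
  assert (Hy2 : Rabs (y ^ 2) < 1) by (rewrite Rabs_pos_eq; nra).
  destruct (pow_lt_1_zero (y ^ 2) Hy2 (- w p / (M + 1))) as [N HN].
  { apply Rdiv_lt_0_compat; lra. }
  specialize (HN N (le_n N)). specialize (step N p).
  assert (H0 : 0 <= (y ^ 2) ^ N) by (apply pow_le; nra).
  rewrite Rabs_pos_eq in HN by easy.
  assert (HMp := HM (p + 2 * N)%nat). apply Rabs_le_between in HMp.
  apply (Rmult_lt_compat_r (M + 1)) in HN; [|lra].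
  replace (- w p / (M + 1) * (M + 1)) with (- w p) in HN by (field; lra).
  nra.
Qed.

(** The resolvent (1 + yT)^-1 of the shift T preserves complete monotonicity:
    it commutes with differences, and alternating sums of a decreasing
    nonnegative sequence are nonnegative. *)
Lemma resolvent_cm w g y : 0 < y < 1 -> bounded w ->
  (forall p, w p + y * w (S p) = g p) -> cm g -> cm w.
Proof.
  intros Hy Hb E Hg j; revert w g Hb E Hg.
  induction j as [|j IH]; intros w g Hb E Hg m.
  - cbn. apply (resolvent_nonneg w g y Hy Hb E).
    intros p; split; [now apply cm_nonneg|now apply cm_decr].
  - cbn. apply (IH (bdiff w) (bdiff g)).
    + destruct Hb as [M HM]; exists (M + M); intros p; unfold bdiff.
      unfold Rminus. eapply Rle_trans; [apply Rabs_triang|].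
      rewrite Rabs_Ropp. apply Rplus_le_compat; apply HM.
    + intros p; unfold bdiff; rewrite <- !E; ring.
    + now apply cm_bdiff.
Qed.

(** The binomial coefficient m choose i by its product formula, which unlike
    the quotient of factorials vanishes for m < i. *)
Fixpoint bin (i m : nat) : R :=
  match i with
  | O => 1
  | S i => bin i m * (INR m - INR i) / INR (S i)
  end.

Lemma bin_mult i m : INR m * bin i m = INR i * bin i m + INR (S i) * bin (S i) m.
Proof. cbn [bin]. field. apply not_0_INR; lia. Qed.

Lemma bin_absorb i m : bin (S i) (S m) = INR (S m) / INR (S i) * bin i m.
Proof.
  induction i as [|i IH].
  - cbn. field.
  - assert (H1 : INR (S i) <> 0) by (apply not_0_INR; lia).
    assert (H2 : INR (S (S i)) <> 0) by (apply not_0_INR; lia).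
    change (bin (S (S i)) (S m))
      with (bin (S i) (S m) * (INR (S m) - INR (S i)) / INR (S (S i))).
    rewrite IH. cbn [bin]. rewrite !S_INR in *. field. split; lra.
Qed.

Lemma bin_pascal i m : bin (S i) (S m) = bin (S i) m + bin i m.
Proof.
  rewrite bin_absorb. cbn [bin]. rewrite !S_INR. field.
  generalize (pos_INR i); lra.
Qed.

Lemma bin_0_r i : bin (S i) 0 = 0.
Proof.
  induction i as [|i IH]; [cbn; field|].
  change (bin (S i) 0 * (INR 0 - INR (S i)) / INR (S (S i)) = 0). rewrite IH.
  unfold Rdiv; ring.
Qed.

Lemma bin_nonneg i m : 0 <= bin i m.
Proof.
  revert i; induction m as [|m IH]; intros [|i]; try (cbn; lra).
  - rewrite bin_0_r; lra.
  - rewrite bin_pascal. generalize (IH i) (IH (S i)); lra.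
Qed.

Lemma poly_growth_bin i : poly_growth (bin i).
Proof.
  induction i as [|i IH]; [apply (poly_growth_const 1)|].
  apply (poly_growth_ext (fun m => bin i m * ((INR m + - INR i) * / INR (S i)))).
  - intros m; cbn [bin]; unfold Rdiv; ring.
  - apply poly_growth_mult; [easy|]. apply poly_growth_mult; [|apply poly_growth_const].
    apply poly_growth_plus; [apply poly_growth_INR|apply poly_growth_const].
Qed.

(** (1 + x)^M dominates each term of its binomial expansion. *)
Lemma bin_pow_le x i m : 0 <= x -> bin i m * x ^ i <= (1 + x) ^ m.
Proof.
  intros Hx; revert i; induction m as [|m IH]; intros [|i].
  - cbn; lra.
  - rewrite bin_0_r; cbn; lra.
  - cbn [bin]. rewrite Rmult_1_l, pow_O. apply pow_R1_Rle; lra.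
  - rewrite bin_pascal. generalize (IH i) (IH (S i)). cbn [pow]. nra.
Qed.

(** The shift p turns Pascal's rule into a functional equation in p, solved by
    the resolvent. *)
Definition alt_bin (u : nat -> R) (y : R) (i p : nat) : R :=
  Series (fun m => (- y) ^ m * (bin i m * u (p + m)%nat)).

Lemma cm_pgrow u : cm u -> forall p, poly_growth (fun m => u (p + m)%nat).
Proof.
  intros H p; apply (poly_growth_bounded _ (u 0%nat)); intros m.
  rewrite Rabs_pos_eq by (now apply cm_nonneg). now apply cm_le_0.
Qed.

Lemma abs_opp_lt1 y : 0 < y < 1 -> 0 < Rabs (- y) < 1.
Proof. intros H; rewrite Rabs_Ropp, Rabs_pos_eq; lra. Qed.

Lemma alt_bin_bounded u y i : 0 < y < 1 -> cm u -> bounded (alt_bin u y i).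
Proof.
  intros Hy Hu. exists (u 0%nat * Series (fun m => Rabs ((- y) ^ m * bin i m))).
  intros p; unfold alt_bin.
  assert (Hex := poly_growth_ex_series_abs _ _ (poly_growth_bin i) (abs_opp_lt1 y Hy)).
  eapply Rle_trans.
  - apply Series_Rabs. apply poly_growth_ex_series_abs; [|now apply abs_opp_lt1].
    apply poly_growth_mult; [apply poly_growth_bin|now apply cm_pgrow].
  - rewrite <- Series_scal_l. apply Series_le.
    + intros m; split; [apply Rabs_pos|].
      rewrite <- Rmult_assoc, (Rabs_mult (_ * _)), Rmult_comm.
      apply Rmult_le_compat_r; [apply Rabs_pos|].
      rewrite Rabs_pos_eq by now apply cm_nonneg. now apply cm_le_0.
    + apply (ex_series_scal_l (u 0%nat) (fun m => Rabs ((- y) ^ m * bin i m))). exact Hex.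
Qed.

Lemma alt_bin_0 u y p : 0 < y < 1 -> cm u ->
  alt_bin u y 0 p + y * alt_bin u y 0 (S p) = u p.
Proof.
  intros Hy Hu. unfold alt_bin.
  rewrite Series_incr_1.
  - rewrite <- Series_scal_l.
    replace (u p) with (u p + 0) by ring. rewrite Rplus_assoc; f_equal.
    + cbn; rewrite Nat.add_0_r; ring.
    + rewrite <- Series_plus.
      * rewrite (Series_ext _ (fun _ => 0 * 0)), Series_scal_l; [ring|].
        intros m. replace (p + S m)%nat with (S p + m)%nat by lia. cbn; ring.
      * apply (ex_series_incr_1 (fun m => (- y) ^ m * (bin 0 m * u (p + m)%nat))).
        apply poly_growth_ex_series; [|now apply abs_opp_lt1].
        apply poly_growth_mult; [apply poly_growth_bin|now apply cm_pgrow].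
      * apply (ex_series_scal_l y (fun m => (- y) ^ m * (bin 0 m * u (S p + m)%nat))).
        apply poly_growth_ex_series; [|now apply abs_opp_lt1].
        apply poly_growth_mult; [apply poly_growth_bin|now apply cm_pgrow].
  - apply poly_growth_ex_series; [|now apply abs_opp_lt1].
    apply poly_growth_mult; [apply poly_growth_bin|now apply cm_pgrow].
Qed.

(** Pascal's rule for the generating functions. *)
Lemma alt_bin_S u y i p : 0 < y < 1 -> cm u ->
  alt_bin u y (S i) p + y * alt_bin u y (S i) (S p) = - y * alt_bin u y i (S p).
Proof.
  intros Hy Hu. unfold alt_bin.
  assert (Hex : forall i p, ex_series (fun m => (- y) ^ m * (bin i m * u (p + m)%nat))).
  { intros; apply poly_growth_ex_series; [|now apply abs_opp_lt1].
    apply poly_growth_mult; [apply poly_growth_bin|now apply cm_pgrow]. }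
  rewrite (Series_incr_1 (fun m => (- y) ^ m * (bin (S i) m * u (p + m)%nat))) by apply Hex.
  rewrite bin_0_r.
  rewrite (Series_ext (fun k => (- y) ^ S k * (bin (S i) (S k) * u (p + S k)%nat))
    (fun k => - y * ((- y) ^ k * (bin (S i) k * u (S p + k)%nat))
              + - y * ((- y) ^ k * (bin i k * u (S p + k)%nat)))).
  - rewrite Series_plus, !Series_scal_l; [ring| |];
      apply (ex_series_scal_l (- y) (fun m => (- y) ^ m * (bin _ m * u (S p + m)%nat))), Hex.
  - intros m; rewrite bin_pascal. replace (p + S m)%nat with (S p + m)%nat by lia.
    cbn [pow]; ring.
Qed.

Lemma alt_bin_cm u y i : 0 < y < 1 -> cm u -> cm (fun p => (-1) ^ i * alt_bin u y i p).
Proof.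
  intros Hy Hu.
  assert (Hb : forall i, bounded (fun p => (-1) ^ i * alt_bin u y i p)).
  { intros k; destruct (alt_bin_bounded u y k Hy Hu) as [M HM]; exists M; intros p.
    now rewrite Rabs_mult, pow_1_abs, Rmult_1_l. }
  induction i as [|i IH].
  - apply (resolvent_cm _ u y Hy (Hb 0%nat)); [|easy].
    intros p. rewrite <- (alt_bin_0 u y p Hy Hu). cbn; ring.
  - apply (resolvent_cm _ (fun p => y * ((-1) ^ i * alt_bin u y i (S p)) + 0 * 0) y Hy (Hb (S i))).
    + intros p. generalize (alt_bin_S u y i p Hy Hu). cbn [pow]. intros E.
      replace (-1 * (-1) ^ i * alt_bin u y (S i) p
               + y * (-1 * (-1) ^ i * alt_bin u y (S i) (S p)))
        with (-1 * (-1) ^ i * (alt_bin u y (S i) p + y * alt_bin u y (S i) (S p))) by ring.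
      rewrite E; ring.
    + apply cm_lin; [lra|lra| |apply (cm_const 0); lra].
      exact (cm_S _ IH).
Qed.

(** The factor yT/(1 + yT) is at most 1/2 on completely monotone sequences,
    because 1 - 2 yT/(1 + yT) = (1 - yT)/(1 + yT) preserves them. *)
Lemma alt_bin_half u y i p : 0 < y < 1 -> cm u ->
  2 * ((-1) ^ S i * alt_bin u y (S i) p) <= (-1) ^ i * alt_bin u y i p.
Proof.
  intros Hy Hu.
  assert (H : cm (fun p => (-1) ^ i * alt_bin u y i p - 2 * ((-1) ^ S i * alt_bin u y (S i) p))).
  { apply (resolvent_cm _ (fun p => 1 * bdiff (fun p => (-1) ^ i * alt_bin u y i p) p
                    + (1 - y) * ((-1) ^ i * alt_bin u y i (S p))) y Hy).
    - destruct (alt_bin_bounded u y i Hy Hu) as [M HM].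
      destruct (alt_bin_bounded u y (S i) Hy Hu) as [M' HM'].
      exists (M + 2 * M'); intros q. unfold Rminus.
      eapply Rle_trans; [apply Rabs_triang|].
      rewrite Rabs_Ropp, !Rabs_mult, !pow_1_abs.
      rewrite (Rabs_pos_eq 2) by lra. generalize (HM q) (HM' q); lra.
    - intros q. generalize (alt_bin_S u y i q Hy Hu). cbn [pow]. intros E.
      unfold bdiff.
      assert (E' : alt_bin u y (S i) q = - y * alt_bin u y i (S q) - y * alt_bin u y (S i) (S q))
        by lra.
      rewrite E'; ring.
    - assert (Hc := alt_bin_cm u y i Hy Hu).
      apply cm_lin; [lra|lra|now apply cm_bdiff|exact (cm_S _ Hc)]. }
  generalize (cm_nonneg _ H p); cbn beta; lra.
Qed.

Lemma alt_bin_le u y i : 0 < y < 1 -> cm u ->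
  Rabs (alt_bin u y i 0) <= u 0%nat * (/ 2) ^ i.
Proof.
  intros Hy Hu.
  assert (E : Rabs (alt_bin u y i 0) = (-1) ^ i * alt_bin u y i 0).
  { rewrite <- (Rabs_pos_eq ((-1) ^ i * _)).
    - now rewrite Rabs_mult, pow_1_abs, Rmult_1_l.
    - exact (cm_nonneg _ (alt_bin_cm u y i Hy Hu) 0%nat). }
  rewrite E; clear E. induction i as [|i IH].
  - generalize (alt_bin_0 u y 0 Hy Hu) (cm_nonneg _ (alt_bin_cm u y 0 Hy Hu) 1%nat).
    cbn [pow]. nra.
  - generalize (alt_bin_half u y i 0 Hy Hu). cbn [pow] in *. lra.
Qed.

(** Pascal's rule again: each step contributes a factor x/(1 - x), and x = 1/3 is
    chosen to make it 1/2, the factor of [alt_bin_half]. *)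
Lemma Series_bin_third i : Series (fun m => (/ 3) ^ m * bin i m) = 3 / 2 * (/ 2) ^ i.
Proof.
  assert (Ht : 0 < Rabs (/ 3) < 1) by (rewrite Rabs_pos_eq; lra).
  assert (Hex : forall i, ex_series (fun m => (/ 3) ^ m * bin i m)).
  { intros j; apply poly_growth_ex_series; [apply poly_growth_bin|easy]. }
  induction i as [|i IH].
  - rewrite (Series_ext _ (fun m => (/ 3) ^ m)) by (intros; cbn; ring).
    rewrite Series_geom by easy. cbn; field.
  - assert (E := Series_incr_1 _ (Hex (S i))).
    cbv beta in E; rewrite bin_0_r in E.
    rewrite (Series_ext (fun k => (/ 3) ^ S k * bin (S i) (S k))
      (fun k => / 3 * ((/ 3) ^ k * bin (S i) k) + / 3 * ((/ 3) ^ k * bin i k))) in E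
      by (intros m; rewrite bin_pascal; cbn [pow]; ring).
    rewrite Series_plus, !Series_scal_l, IH in E
      by (apply (ex_series_scal_l (/ 3) (fun k => (/ 3) ^ k * bin _ k)), Hex).
    cbn [pow] in *. lra.
Qed.

(** An inductive predicate, because the proofs below follow its clauses and
    never need the coefficients. *)
Inductive bin_pos : (nat -> R) -> Prop :=
| bin_pos_bin i : bin_pos (bin i)
| bin_pos_lin c d P Q : 0 <= c -> 0 <= d -> bin_pos P -> bin_pos Q ->
    bin_pos (fun m => c * P m + d * Q m)
| bin_pos_ext P Q : (forall m, P m = Q m) -> bin_pos P -> bin_pos Q.

Lemma bin_pos_mult P al : 0 <= al -> bin_pos P -> bin_pos (fun m => (INR m + al) * P m).
Proof.
  intros Ha HP; induction HP as [i|c d P Q Hc Hd _ IHP _ IHQ|P Q E _ IH].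
  - apply (bin_pos_ext (fun m => (INR i + al) * bin i m + INR (S i) * bin (S i) m)).
    + intros m; transitivity (INR m * bin i m + al * bin i m); [rewrite (bin_mult i m)|]; ring.
    + apply bin_pos_lin; [generalize (pos_INR i); lra|apply pos_INR| |]; apply bin_pos_bin.
  - apply (bin_pos_ext (fun m => c * ((INR m + al) * P m) + d * ((INR m + al) * Q m))).
    + intros m; ring.
    + now apply bin_pos_lin.
  - apply (bin_pos_ext (fun m => (INR m + al) * P m)); [|easy].
    intros m; now rewrite E.
Qed.

Lemma bin_pos_rprod P (al : nat -> R) k :
  (forall j, (j < k)%nat -> 0 <= al j) -> bin_pos P ->
  bin_pos (fun m => rprod (fun j => INR m + al j) k * P m).
Proof.
  intros Ha HP; induction k as [|k IH].
  - apply (bin_pos_ext P); [intros; cbn; ring|easy].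
  - apply (bin_pos_ext (fun m => (INR m + al k) * (rprod (fun j => INR m + al j) k * P m))).
    + intros m; cbn; ring.
    + apply bin_pos_mult; auto.
Qed.

Lemma bin_pos_nonneg P : bin_pos P -> forall m, 0 <= P m.
Proof.
  intros HP; induction HP as [i|c d P Q Hc Hd _ IHP _ IHQ|P Q E _ IH]; intros m.
  - apply bin_nonneg.
  - apply Rplus_le_le_0_compat; now apply Rmult_le_pos.
  - rewrite <- E; apply IH.
Qed.

Lemma bin_pos_pgrow P : bin_pos P -> poly_growth P.
Proof.
  intros HP; induction HP as [i|c d P Q Hc Hd _ IHP _ IHQ|P Q E _ IH].
  - apply poly_growth_bin.
  - apply poly_growth_plus; apply poly_growth_mult; auto using poly_growth_const.
  - exact (poly_growth_ext _ _ E IH).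
Qed.

(** The alternating sum costs at most 2^-i on m choose i by [alt_bin_le], and the
    positive series at 1/3 is (3/2) 2^-i there; both extend to nonnegative
    combinations. *)
Lemma bin_pos_bound P u y : bin_pos P -> cm u -> 0 < y < 1 ->
  Rabs (Series (fun m => (- y) ^ m * (P m * u m)))
  <= u 0%nat * (2 / 3 * Series (fun m => (/ 3) ^ m * P m)).
Proof.
  intros HP Hu Hy; assert (Hy' := abs_opp_lt1 y Hy).
  assert (Ht : 0 < Rabs (/ 3) < 1) by (rewrite Rabs_pos_eq; lra).
  assert (Hp : poly_growth u) by exact (cm_pgrow u Hu 0%nat).
  induction HP as [i|c d P Q Hc Hd HP IHP HQ IHQ|P Q E _ IH].
  - generalize (alt_bin_le u y i Hy Hu); unfold alt_bin; cbn [Nat.add].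
    rewrite Series_bin_third. intros H.
    replace (2 / 3 * (3 / 2 * (/ 2) ^ i)) with ((/ 2) ^ i) by field. exact H.
  - apply bin_pos_pgrow in HP, HQ.
    assert (X : forall P c, poly_growth P -> ex_series (fun m => c * ((- y) ^ m * (P m * u m)))).
    { intros P0 c0 H0. apply (ex_series_scal_l c0 (fun m => (- y) ^ m * (P0 m * u m))).
      apply poly_growth_ex_series; [|easy]. now apply poly_growth_mult. }
    assert (Y : forall P c, poly_growth P -> ex_series (fun m => c * ((/ 3) ^ m * P m))).
    { intros P0 c0 H0. apply (ex_series_scal_l c0 (fun m => (/ 3) ^ m * P0 m)).
      now apply poly_growth_ex_series. }
    rewrite (Series_ext _ (fun m => c * ((- y) ^ m * (P m * u m)) + d * ((- y) ^ m * (Q m * u m))))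
      by (intros; ring).
    rewrite (Series_ext (fun m => (/ 3) ^ m * _)
      (fun m => c * ((/ 3) ^ m * P m) + d * ((/ 3) ^ m * Q m))) by (intros; ring).
    rewrite !Series_plus, !Series_scal_l by auto.
    eapply Rle_trans; [apply Rabs_triang|].
    rewrite !Rabs_mult, (Rabs_pos_eq c), (Rabs_pos_eq d) by easy.
    apply (Rmult_le_compat_l c) in IHP; [|easy].
    apply (Rmult_le_compat_l d) in IHQ; [|easy]. lra.
  - rewrite (Series_ext _ (fun m => (- y) ^ m * (P m * u m))) by (intros; now rewrite E).
    rewrite (Series_ext (fun m => (/ 3) ^ m * Q m) (fun m => (/ 3) ^ m * P m))
      by (intros; now rewrite E).
    exact IH.
Qed.

(** * Exponential bounds for the values at -1 *)

(** Uniformity in y is what passes to the limit y -> 1. *)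
Definition alt_bound (K : R) (f : nat -> R) : Prop :=
  poly_growth f /\ forall y, 0 < y < 1 -> Rabs (Series (fun m => (- y) ^ m * f m)) <= K.

Lemma alt_bound_ext K f g : (forall m, f m = g m) -> alt_bound K f -> alt_bound K g.
Proof.
  intros E [H1 H2]; split; [exact (poly_growth_ext f g E H1)|].
  intros y Hy. rewrite (Series_ext _ (fun m => (- y) ^ m * f m)); [auto|].
  intros m; now rewrite E.
Qed.

Lemma alt_bound_lin K L c d f g : alt_bound K f -> alt_bound L g ->
  alt_bound (Rabs c * K + Rabs d * L) (fun m => c * f m + d * g m).
Proof.
  intros [H1 H2] [H1' H2']; split.
  - apply poly_growth_plus; apply poly_growth_mult; auto using poly_growth_const.
  - intros y Hy; assert (Hy' := abs_opp_lt1 y Hy).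
    rewrite (Series_ext _ (fun m => c * ((- y) ^ m * f m) + d * ((- y) ^ m * g m)))
      by (intros; ring).
    rewrite Series_plus, !Series_scal_l.
    + eapply Rle_trans; [apply Rabs_triang|]. rewrite !Rabs_mult.
      apply Rplus_le_compat; apply Rmult_le_compat_l; auto using Rabs_pos.
    + apply (ex_series_scal_l c (fun m => (- y) ^ m * f m)). now apply poly_growth_ex_series.
    + apply (ex_series_scal_l d (fun m => (- y) ^ m * g m)). now apply poly_growth_ex_series.
Qed.

Lemma alt_bound_rsum K (f : nat -> nat -> R) k :
  (forall j, (j < k)%nat -> alt_bound K (f j)) ->
  alt_bound (INR k * K) (fun m => rsum (fun j => f j m) k).
Proof.
  induction k as [|k IH]; intros H; cbn [rsum].
  - split; [apply poly_growth_const|]. intros y Hy.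
    rewrite (Series_ext _ (fun _ => 0 * 0)), Series_scal_l, Rmult_0_l, Rabs_R0
      by (intros; ring). cbn; lra.
  - replace (INR (S k) * K) with (Rabs 1 * (INR k * K) + Rabs 1 * K)
      by (rewrite S_INR, Rabs_R1; ring).
    apply (alt_bound_ext _ (fun m => 1 * rsum (fun j => f j m) k + 1 * f k m)); [intros; ring|].
    apply alt_bound_lin; [apply IH; auto|apply H; lia].
Qed.

Lemma abel_alt_bound f l K : abel f l -> alt_bound K f -> Rabs l <= K.
Proof.
  intros [_ H] [_ HK].
  destruct (Rle_lt_dec (Rabs l) K) as [Hl|Hl]; [easy|exfalso].
  assert (He : 0 < Rabs l - K) by lra.
  assert (H1 := proj1 (filterlim_locally (gser f) l) H (mkposreal _ He)).
  assert (H2 : at_right (-1) (fun z => -1 < z < 0)) by now apply near_m1.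
  destruct (filter_ex _ (filter_and _ _ H1 H2)) as [z [Hz1 Hz2]].
  change (Rabs (gser f z - l) < Rabs l - K) in Hz1.
  specialize (HK (- z) ltac:(lra)). rewrite Ropp_involutive in HK.
  fold (gser f z) in HK.
  assert (T := Rabs_triang_inv l (gser f z)). rewrite Rabs_minus_sym in T. lra.
Qed.

Lemma abel_drop f l k : abel f l -> (forall i, (i < k)%nat -> f i = 0) ->
  abel (fun m => f (k + m)%nat) ((-1) ^ k * l).
Proof.
  intros H; induction k as [|k IH]; intros H0.
  - cbn. now rewrite Rmult_1_l.
  - assert (E := abel_S _ _ (IH (fun i Hi => H0 i (Nat.lt_lt_succ_r _ _ Hi)))).
    cbv beta in E. rewrite Nat.add_0_r, H0 in E by lia.
    replace ((-1) ^ S k * l) with (0 - (-1) ^ k * l) by (cbn; ring).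
    eapply abel_ext; [|exact E]. intros m; cbv beta; f_equal; lia.
Qed.

Lemma rising_bin_P n m : rprod (fun j => INR m + (INR n - INR j)) n = INR (fact n) * bin n (m + n).
Proof.
  assert (H : forall k, rprod (fun j => INR m + (INR n - INR j)) k
                        = INR (fact k) * bin k (m + n)).
  { induction k as [|k IH]; [cbn; ring|]. cbn [rprod bin].
    rewrite IH, fact_simpl, mult_INR, plus_INR. field. apply not_0_INR; lia. }
  apply H.
Qed.

Lemma rising_bin_Q n c m :
  rprod (fun j => INR m + (INR c + 1 + INR j)) n = INR (fact n) * bin n (m + c + n).
Proof.
  induction n as [|n IH]; [cbn; ring|]. cbn [rprod]. rewrite IH.
  replace (m + c + S n)%nat with (S (m + c + n)) by lia.
  rewrite bin_absorb, fact_simpl, mult_INR.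
  rewrite !S_INR, !plus_INR. field. generalize (pos_INR n); lra.
Qed.

Lemma rising_fact n c : rprod (fun j => INR (S c) + INR j) n * INR (fact c) = INR (fact (c + n)).
Proof.
  induction n as [|n IH]; [rewrite Nat.add_0_r; cbn; ring|]. cbn [rprod].
  replace (c + S n)%nat with (S (c + n)) by lia.
  rewrite fact_simpl, mult_INR, <- IH, !S_INR, plus_INR; ring.
Qed.

(** R_n vanishes at 1, ..., n; at n + 1 + m it is, up to sign, the product of a
    numerator with nonnegative binomial coordinates and a completely monotone
    weight.  The trailing 1 = (m choose 0) starts the product for [bin_pos]. *)
Definition Rpoly n m : R :=
  (INR m + (INR (n + 1) + INR n / 2))
  * (rprod (fun j => INR m + (INR n - INR j)) n
     * (rprod (fun j => INR m + (INR n - INR j)) n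
        * (rprod (fun j => INR m + (INR (2 * n + 1) + 1 + INR j)) n
           * (rprod (fun j => INR m + (INR (2 * n + 1) + 1 + INR j)) n * bin 0 m)))).

Definition Rweight n m : R :=
  / INR (fact n) * (/ rprod (fun i => INR m + INR (n + 1) + INR i) (S n)) ^ 3.

Lemma Rn_factor n m :
  Rn n (INR (n + m) + 1) = (-1) ^ (n + 1) * (Rpoly n m * Rweight n m).
Proof.
  rewrite Rn_Bn. unfold Bn, Rpoly, Rweight.
  assert (EP : Pn n (INR (n + m) + 1) = rprod (fun j => INR m + (INR n - INR j)) n).
  { apply rprod_ext; intros j _. rewrite !plus_INR; cbn [INR]; ring. }
  assert (EQ : Qn n (INR (n + m) + 1)
               = rprod (fun j => INR m + (INR (2 * n + 1) + 1 + INR j)) n).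
  { apply rprod_ext; intros j _. rewrite !plus_INR, mult_INR; cbn [INR]; ring. }
  assert (ED : Dn n (INR (n + m) + 1) = rprod (fun i => INR m + INR (n + 1) + INR i) (S n)).
  { unfold Dn; rewrite Nat.add_1_r. apply rprod_ext; intros j _.
    rewrite !S_INR, !plus_INR; cbn [INR]; ring. }
  assert (HD : 0 < rprod (fun i => INR m + INR (n + 1) + INR i) (S n)).
  { apply (rising_pos (INR m + INR (n + 1))). rewrite plus_INR; cbn.
    generalize (pos_INR m) (pos_INR n); lra. }
  rewrite EP, EQ, ED. rewrite !plus_INR; cbn [INR bin]. rewrite plus_INR in HD; cbn [INR] in HD.
  assert (Hf := INR_fact_neq_0 n). field. split; lra.
Qed.

Lemma Rweight_cm n : cm (Rweight n).
Proof.
  assert (Hc : 0 < INR (n + 1)) by (apply lt_0_INR; lia).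
  assert (H := cm_inv_rising (INR (n + 1)) n Hc).
  apply (cm_ext (fun m => / INR (fact n)
     * (/ rprod (fun i => INR m + INR (n + 1) + INR i) (S n)
        * (/ rprod (fun i => INR m + INR (n + 1) + INR i) (S n)
           * / rprod (fun i => INR m + INR (n + 1) + INR i) (S n))))).
  - intros m; unfold Rweight; cbn [pow]; ring.
  - apply cm_mult; [|apply cm_mult; [|apply cm_mult]]; try exact H.
    apply cm_const, Rlt_le, Rinv_0_lt_compat, INR_fact_lt_0.
Qed.

Lemma Rpoly_pos n : bin_pos (Rpoly n).
Proof.
  assert (H1 : forall j, (j < n)%nat -> 0 <= INR n - INR j).
  { intros j Hj. apply lt_INR in Hj; lra. }
  assert (H2 : forall j, (j < n)%nat -> 0 <= INR (2 * n + 1) + 1 + INR j).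
  { intros j _. generalize (pos_INR (2 * n + 1)) (pos_INR j); lra. }
  unfold Rpoly. apply bin_pos_mult.
  { generalize (pos_INR (n + 1)) (pos_INR n); lra. }
  do 2 apply (bin_pos_rprod _ (fun j => INR n - INR j) n H1).
  do 2 apply (bin_pos_rprod _ (fun j => INR (2 * n + 1) + 1 + INR j) n H2).
  apply bin_pos_bin.
Qed.

(** The central binomial coefficient is at least 4^n / (2n + 1). *)
Lemma fact_growth n : 4 ^ n * INR (fact n) ^ 2 <= INR (fact (2 * n + 1)).
Proof.
  induction n as [|n IH]; [cbn; lra|].
  replace (2 * S n + 1)%nat with (S (S (2 * n + 1))) by lia.
  rewrite !fact_simpl, !mult_INR, !S_INR, plus_INR, mult_INR.
  cbn [pow INR] in *.
  assert (Hn := pos_INR n). assert (Hf := INR_fact_lt_0 n).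
  assert (H0 : 0 < 4 ^ n) by (apply pow_lt; lra).
  set (f := INR (fact n)) in *. set (g := INR (fact (2 * n + 1))) in *.
  set (q := 4 ^ n) in *.
  replace (4 * q * ((INR n + 1) * f * ((INR n + 1) * f * 1)))
    with (4 * (INR n + 1) ^ 2 * (q * (f * (f * 1)))) by ring.
  assert (0 < q * (f * (f * 1))) by (repeat apply Rmult_lt_0_compat; lra).
  apply Rle_trans with (((1 + 1) * INR n + 1 + 1 + 1) * ((1 + 1) * INR n + 1 + 1)
     * (q * (f * (f * 1)))).
  - apply Rmult_le_compat_r; [lra|nra].
  - apply Rle_trans with (((1 + 1) * INR n + 1 + 1 + 1) * ((1 + 1) * INR n + 1 + 1) * g);
      [apply Rmult_le_compat_l; [nra|lra]|right; ring].
Qed.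

Lemma Rweight_0 n : Rweight n 0 <= / (INR (fact n) ^ 4 * 64 ^ n).
Proof.
  unfold Rweight.
  assert (E : rprod (fun i => INR 0 + INR (n + 1) + INR i) (S n) * INR (fact n)
              = INR (fact (2 * n + 1))).
  { replace (2 * n + 1)%nat with (n + S n)%nat by lia. rewrite <- rising_fact.
    f_equal. apply rprod_ext; intros i _. rewrite Nat.add_1_r; cbn [INR]; ring. }
  set (d := rprod (fun i => INR 0 + INR (n + 1) + INR i) (S n)) in *.
  assert (G := fact_growth n). rewrite <- E in G.
  assert (Hf := INR_fact_lt_0 n). set (f := INR (fact n)) in *.
  assert (Hq : 0 < 4 ^ n) by (apply pow_lt; lra).
  assert (Hd : 4 ^ n * f <= d) by (apply Rmult_le_reg_r with f; [easy|]; lra).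
  assert (H0 : 0 < 4 ^ n * f) by now apply Rmult_lt_0_compat.
  rewrite pow_inv, <- Rinv_mult.
  apply Rinv_le_contravar.
  - apply Rmult_lt_0_compat; apply pow_lt; lra.
  - replace 64 with (4 ^ 3) by ring. rewrite <- pow_mult, Nat.mul_comm, pow_mult.
    replace (f ^ 4 * (4 ^ n) ^ 3) with (f * (4 ^ n * f) ^ 3) by ring.
    apply Rmult_le_compat_l; [lra|]. apply pow_incr; lra.
Qed.

(** Maximal size of the numerator: binomials bounded with x = 2/5 and x = 1/5,
    for which the series at 1/3 still converges, (7/5)^2 (6/5)^2 < 3. *)
Lemma Rpoly_le n m : Rpoly n m <=
  3 * (INR n + 1) * (INR m + 1) * INR (fact n) ^ 4 * (9144576 / 10000) ^ n
  * (1764 / 625) ^ m.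
Proof.
  unfold Rpoly. rewrite rising_bin_P, rising_bin_Q. cbn [bin].
  assert (Hf := INR_fact_lt_0 n). set (f := INR (fact n)) in *.
  assert (B1 := bin_pow_le (2 / 5) n (m + n) ltac:(lra)).
  assert (B2 := bin_pow_le (1 / 5) n (m + (2 * n + 1) + n) ltac:(lra)).
  assert (P1 := bin_nonneg n (m + n)). assert (P2 := bin_nonneg n (m + (2 * n + 1) + n)).
  set (x1 := bin n (m + n)) in *. set (x2 := bin n (m + (2 * n + 1) + n)) in *.
  assert (A1 : x1 <= (7 / 2) ^ n * (7 / 5) ^ m).
  { apply Rmult_le_reg_r with ((2 / 5) ^ n); [apply pow_lt; lra|].
    eapply Rle_trans; [exact B1|]. right.
    replace (1 + 2 / 5) with (7 / 5) by field.
    rewrite pow_add. replace (7 / 5) with (7 / 2 * (2 / 5)) at 2 by field.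
    rewrite Rpow_mult_distr; ring. }
  assert (A2 : x2 <= 6 / 5 * ((216 / 25) ^ n * (6 / 5) ^ m)).
  { apply Rmult_le_reg_r with ((1 / 5) ^ n); [apply pow_lt; lra|].
    eapply Rle_trans; [exact B2|]. right.
    replace (1 + 1 / 5) with (6 / 5) by field.
    replace (m + (2 * n + 1) + n)%nat with (m + 1 + 3 * n)%nat by lia.
    rewrite !pow_add, pow_1, (pow_mult _ 3 n).
    replace ((6 / 5) ^ 3) with (216 / 25 * (1 / 5)) by field.
    rewrite Rpow_mult_distr; ring. }
  assert (Hm := pos_INR m). assert (Hn := pos_INR n).
  set (y1 := (7 / 2) ^ n * (7 / 5) ^ m) in *.
  set (y2 := 6 / 5 * ((216 / 25) ^ n * (6 / 5) ^ m)) in *.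
  assert (X : (x1 * x2) ^ 2 <= (y1 * y2) ^ 2).
  { apply pow_incr; split; [now apply Rmult_le_pos|]. now apply Rmult_le_compat. }
  assert (Y : (y1 * y2) ^ 2 = 36 / 25 * ((9144576 / 10000) ^ n * (1764 / 625) ^ m)).
  { unfold y1, y2.
    replace (9144576 / 10000) with (((7 / 2) * (216 / 25)) ^ 2) by field.
    replace (1764 / 625) with (((7 / 5) * (6 / 5)) ^ 2) by field.
    rewrite <- !(pow_mult _ 2), !(Nat.mul_comm 2), !pow_mult, !Rpow_mult_distr. field. }
  rewrite Y in X.
  set (z := (9144576 / 10000) ^ n * (1764 / 625) ^ m) in *.
  assert (Hz : 0 < z) by (apply Rmult_lt_0_compat; apply pow_lt; lra).
  replace ((INR m + (INR (n + 1) + INR n / 2)) * (f * x1 * (f * x1 * (f * x2 * (f * x2 * 1)))))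
    with ((INR m + (INR (n + 1) + INR n / 2)) * f ^ 4 * (x1 * x2) ^ 2) by ring.
  replace (3 * (INR n + 1) * (INR m + 1) * f ^ 4 * (9144576 / 10000) ^ n * (1764 / 625) ^ m)
    with (2 * (INR n + 1) * (INR m + 1) * f ^ 4 * (3 / 2 * z)) by (unfold z; field).
  assert (0 < f ^ 4) by (apply pow_lt; easy).
  rewrite plus_INR; cbn [INR].
  apply Rmult_le_compat.
  - apply Rmult_le_pos; lra.
  - apply pow2_ge_0.
  - apply Rmult_le_compat_r; [lra|nra].
  - lra.
Qed.

Definition bound_const : R := 2 * Series (fun m => (588 / 625) ^ m * (INR m + 1)).

(** The exponential rate is (7/2)^2 (216/25)^2 / 64 = 14.28... < 15. *)
Lemma Rpoly_weight_bound n v : cm v -> v 0%nat <= 1 ->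
  alt_bound (bound_const * (INR n + 1) * 15 ^ n)
    (fun m => (Rpoly n m * Rweight n m) * v m).
Proof.
  intros Hv Hv1.
  apply (alt_bound_ext _ (fun m => Rpoly n m * (Rweight n m * v m))); [intros; ring|].
  assert (Hc : cm (fun m => Rweight n m * v m)) by (apply cm_mult; [apply Rweight_cm|easy]).
  assert (Hg : poly_growth (fun m => INR m + 1)).
  { apply poly_growth_plus; [apply poly_growth_INR|apply poly_growth_const]. }
  assert (Hex : ex_series (fun m => (588 / 625) ^ m * (INR m + 1))).
  { apply poly_growth_ex_series; [exact Hg|]. rewrite Rabs_pos_eq; lra. }
  assert (Hf := INR_fact_lt_0 n). assert (Hn := pos_INR n).
  split.
  - apply poly_growth_mult; [apply bin_pos_pgrow, Rpoly_pos|exact (cm_pgrow _ Hc 0%nat)].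
  - intros y Hy.
    eapply Rle_trans; [exact (bin_pos_bound _ _ y (Rpoly_pos n) Hc Hy)|].
    set (c := 3 * (INR n + 1) * INR (fact n) ^ 4 * (9144576 / 10000) ^ n).
    assert (Hcc : 0 <= c).
    { unfold c. apply Rmult_le_pos; [|apply pow_le; lra].
      apply Rmult_le_pos; [lra|apply pow_le; lra]. }
    assert (S1 : Series (fun m => (/ 3) ^ m * Rpoly n m)
                 <= c * Series (fun m => (588 / 625) ^ m * (INR m + 1))).
    { rewrite <- Series_scal_l. apply Series_le.
      - intros m; split.
        + apply Rmult_le_pos; [apply pow_le; lra|].
          apply bin_pos_nonneg, Rpoly_pos.
        + eapply Rle_trans.
          * apply Rmult_le_compat_l; [apply pow_le; lra|apply Rpoly_le].
          * right. unfold c. replace (588 / 625) with (/ 3 * (1764 / 625)) by field.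
            rewrite Rpow_mult_distr. ring.
      - apply (ex_series_scal_l c (fun m => (588 / 625) ^ m * (INR m + 1))), Hex. }
    set (s := Series (fun m => (588 / 625) ^ m * (INR m + 1))) in *.
    assert (Hs : 0 <= s).
    { apply Series_nonneg; [|exact Hex]. intros m.
      apply Rmult_le_pos; [apply pow_le; lra|generalize (pos_INR m); lra]. }
    assert (W := Rweight_0 n). assert (W0 := cm_nonneg _ (Rweight_cm n) 0%nat).
    assert (V0 := cm_nonneg _ Hv 0%nat).
    apply (Rle_trans _ (/ (INR (fact n) ^ 4 * 64 ^ n) * (2 / 3 * (c * s)))).
    + apply Rmult_le_compat.
      * now apply Rmult_le_pos.
      * apply Rmult_le_pos; [lra|].
        apply Series_nonneg.
        -- intros m; apply Rmult_le_pos; [apply pow_le; lra|].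
           apply bin_pos_nonneg, Rpoly_pos.
        -- apply poly_growth_ex_series; [apply bin_pos_pgrow, Rpoly_pos|].
           rewrite Rabs_pos_eq; lra.
      * apply Rle_trans with (Rweight n 0 * 1); [|lra].
        apply Rmult_le_compat_l; lra.
      * apply Rmult_le_compat_l; lra.
    + unfold bound_const; fold s. unfold c.
      replace (/ (INR (fact n) ^ 4 * 64 ^ n) * (2 / 3 * (3 * (INR n + 1) * INR (fact n) ^ 4
         * (9144576 / 10000) ^ n * s)))
        with (2 * s * (INR n + 1) * ((9144576 / 10000) ^ n * / 64 ^ n))
        by (field; split; [apply pow_nonzero; lra|lra]).
      rewrite <- pow_inv, <- Rpow_mult_distr.
      apply Rmult_le_compat_l; [nra|]. apply pow_incr; lra.
Qed.

Lemma Pn_zero n i : (i < n)%nat -> Pn n (INR i + 1) = 0.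
Proof.
  intros H; unfold Pn. induction n as [|n IH]; [lia|]. cbn [rprod].
  destruct (Nat.eq_dec i n) as [->|Hi].
  - rewrite plus_INR; cbn; ring.
  - rewrite IH by lia; ring.
Qed.

Lemma Rn_zero n i : (i < n)%nat -> Rn n (INR i + 1) = 0.
Proof.
  intros H. rewrite Rn_Bn; unfold Bn. rewrite Pn_zero by easy. unfold Rdiv; ring.
Qed.

Lemma r_bound n : Rabs (r n) <= bound_const * (INR n + 1) * 15 ^ n.
Proof.
  assert (H := abel_drop _ _ n (proj2 (abel_Rn n)) (Rn_zero n)).
  assert (B : alt_bound (bound_const * (INR n + 1) * 15 ^ n)
                (fun m => Rn n (INR (n + m) + 1))).
  { replace (bound_const * (INR n + 1) * 15 ^ n)
      with (Rabs ((-1) ^ (n + 1)) * (bound_const * (INR n + 1) * 15 ^ n)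
            + Rabs 0 * (bound_const * (INR n + 1) * 15 ^ n))
      by (rewrite pow_1_abs, Rabs_R0; ring).
    assert (P := Rpoly_weight_bound n (fun _ => 1) (cm_const 1 ltac:(lra)) ltac:(lra)).
    eapply alt_bound_ext; [|exact (alt_bound_lin _ _ ((-1) ^ (n + 1)) 0 _ _ P P)].
    intros m; cbv beta. rewrite Rn_factor; ring. }
  generalize (abel_alt_bound _ _ _ H B).
  now rewrite Rabs_mult, pow_1_abs, Rmult_1_l, Rabs_Ropp.
Qed.

Lemma is_derive_rprod c k t : (forall j, (j < k)%nat -> t + c j <> 0) ->
  is_derive (fun t => rprod (fun j => t + c j) k) t
    (rprod (fun j => t + c j) k * rsum (fun j => / (t + c j)) k).
Proof.
  induction k as [|k IH]; intros H; cbn [rprod rsum].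
  - replace (1 * 0) with 0 by ring.
    apply (is_derive_const (K := R_AbsRing) (V := R_NormedModule)).
  - assert (D := IH (fun j Hj => H j (Nat.lt_lt_succ_r _ _ Hj))).
    assert (Hk := H k (Nat.lt_succ_diag_r k)).
    set (F := fun t => rprod (fun j => t + c j) k) in *.
    change (is_derive (fun t => F t * (t + c k)) t
      (F t * (t + c k) * (rsum (fun j => / (t + c j)) k + / (t + c k)))).
    assert (Ex : ex_derive (fun t => F t) t) by (eexists; exact D).
    auto_derive; [exact Ex|].
    replace (Derive (fun x => F x) t) with (F t * rsum (fun j => / (t + c j)) k)
      by (symmetry; exact (is_derive_unique F t _ D)).
    field. exact Hk.
Qed.

(** The logarithmic derivative of R_n at n + 1 + m.  Every summand is a multiple
    of some 1/(m + al) with al >= 1, again a completely monotone factor. *)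
Definition dlog n m : R :=
  / (INR m + (INR (n + 1) + INR n / 2))
  + 2 * rsum (fun j => / (INR m + (INR n - INR j))) n
  + 2 * rsum (fun j => / (INR m + (INR (2 * n + 1) + 1 + INR j))) n
  + -3 * rsum (fun j => / (INR m + INR (n + 1 + j))) (S n).

Lemma Derive_Rn_dlog n m :
  Derive (Rn n) (INR (n + m) + 1) = Rn n (INR (n + m) + 1) * dlog n m.
Proof.
  set (t := INR (n + m) + 1).
  assert (Hm := pos_INR m). assert (Hn := pos_INR n).
  assert (Ht : t = INR m + INR n + 1) by (unfold t; rewrite plus_INR; ring).
  assert (DP : is_derive (Pn n) t (Pn n t * rsum (fun j => / (INR m + (INR n - INR j))) n)).
  { replace (rsum (fun j => / (INR m + (INR n - INR j))) n)
      with (rsum (fun j => / (t + - INR (j + 1))) n).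
    - apply (is_derive_rprod (fun j => - INR (j + 1))).
      intros j Hj. rewrite Ht, plus_INR; cbn. apply lt_INR in Hj. lra.
    - apply rsum_ext; intros j _. f_equal. rewrite Ht, plus_INR; cbn [INR]; ring. }
  assert (DQ : is_derive (Qn n) t
    (Qn n t * rsum (fun j => / (INR m + (INR (2 * n + 1) + 1 + INR j))) n)).
  { replace (rsum (fun j => / (INR m + (INR (2 * n + 1) + 1 + INR j))) n)
      with (rsum (fun j => / (t + INR (n + 1 + j))) n).
    - apply (is_derive_rprod (fun j => INR (n + 1 + j))).
      intros j Hj. generalize (pos_INR (n + 1 + j)); lra.
    - apply rsum_ext; intros j _. f_equal.
      rewrite Ht, !plus_INR, mult_INR; cbn [INR]; ring. }
  assert (DD : is_derive (Dn n) t (Dn n t * rsum (fun j => / (INR m + INR (n + 1 + j))) (S n))).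
  { replace (rsum (fun j => / (INR m + INR (n + 1 + j))) (S n))
      with (rsum (fun j => / (t + INR j)) (n + 1)).
    - apply (is_derive_rprod INR). intros j Hj. generalize (pos_INR j); lra.
    - rewrite Nat.add_1_r. apply rsum_ext; intros j _. f_equal.
      rewrite Ht, !plus_INR, S_INR; ring. }
  assert (HD : Dn n t <> 0) by (apply Dn_neq_0, off_poles_pos; lra).
  assert (Hf := INR_fact_neq_0 n).
  apply is_derive_unique.
  apply (is_derive_ext (fun t => (-1) ^ (n + 1) * (t + INR n / 2)
     * ((Pn n t * Qn n t) ^ 2 / (INR (fact n) * Dn n t ^ 3)))).
  { intros s; now rewrite Rn_Bn. }
  rewrite Rn_Bn; unfold Bn, dlog.
  set (s1 := rsum _ n) in *. set (s2 := rsum _ n) in *. set (s3 := rsum _ (S n)) in *.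
  assert (EP : ex_derive (fun x => Pn n x) t) by (eexists; exact DP).
  assert (EQ : ex_derive (fun x => Qn n x) t) by (eexists; exact DQ).
  assert (ED : ex_derive (fun x => Dn n x) t) by (eexists; exact DD).
  auto_derive.
  - repeat split; auto.
    repeat apply Rmult_integral_contrapositive_currified; auto; lra.
  - apply is_derive_unique in DP, DQ, DD.
    change (Derive (fun x => Pn n x) t) with (Derive (Pn n) t).
    change (Derive (fun x => Qn n x) t) with (Derive (Qn n) t).
    change (Derive (fun x => Dn n x) t) with (Derive (Dn n) t).
    rewrite DP, DQ, DD.
    replace (INR m + (INR (n + 1) + INR n / 2)) with (t + INR n / 2)
      by (rewrite Ht, plus_INR; cbn [INR]; ring).
    field. repeat split; auto; lra.
Qed.

(** The zeros of R_n at 1, ..., n are double. *)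
Lemma Derive_Rn_zero n i : (i < n)%nat -> Derive (Rn n) (INR i + 1) = 0.
Proof.
  intros Hi. assert (H := pos_INR i).
  set (h := fun t => ((-1) ^ (n + 1) / INR (fact n) * ((t + INR n / 2) * Qn n t ^ 2))
                     / rprod (fun j => t + INR j) (n + 1) ^ 3).
  assert (Hh : ex_derive h (INR i + 1)).
  { apply (decomposable_derive (n + 1)); [|lra]. apply decomposable_rprod.
    apply is_poly_scal, is_poly_mult; [apply is_poly_add|].
    apply is_poly_pow, (is_poly_rprod (fun t j => t + INR (n + 1 + j))).
    intros j; apply is_poly_add. }
  assert (HP : ex_derive (fun t => Pn n t) (INR i + 1)).
  { destruct (is_derive_poly (Pn n)) as (P' & _ & HP').
    - apply (is_poly_rprod (fun t j => t - INR (j + 1))). intros j; apply is_poly_sub.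
    - exists (P' (INR i + 1)); apply HP'. }
  assert (E : forall s, 0 < s -> Pn n s ^ 2 * h s = Rn n s).
  { intros s Hs. rewrite Rn_Bn; unfold Bn, h; fold (Dn n s).
    assert (HD : Dn n s <> 0) by (apply Dn_neq_0, off_poles_pos, Hs).
    assert (Hf := INR_fact_neq_0 n). field. split; auto. }
  apply is_derive_unique.
  apply (is_derive_ext_loc (fun t => Pn n t ^ 2 * h t)).
  - apply locally_pos; [lra|exact E].
  - auto_derive; [repeat split; auto|]. rewrite Pn_zero by easy. ring.
Qed.

Lemma rt_bound n :
  Rabs (rt n) <= (7 * INR n + 4) * (bound_const * (INR n + 1) * 15 ^ n).
Proof.
  set (K := bound_const * (INR n + 1) * 15 ^ n).
  assert (H := abel_drop _ _ n (proj2 (abel_Derive_Rn n)) (Derive_Rn_zero n)).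
  assert (Hn := pos_INR n).
  assert (T : forall al, 1 <= al ->
    alt_bound K (fun m => (Rpoly n m * Rweight n m) * / (INR m + al))).
  { intros al Hal. apply (Rpoly_weight_bound n (fun m => / (INR m + al))).
    - apply cm_inv; lra.
    - cbn. rewrite Rplus_0_l, <- Rinv_1. apply Rinv_le_contravar; lra. }
  assert (T0 := T (INR (n + 1) + INR n / 2)
                  ltac:(rewrite plus_INR; cbn; lra)).
  assert (T1 := alt_bound_rsum K (fun j m => (Rpoly n m * Rweight n m)
        * / (INR m + (INR n - INR j))) n
    ltac:(intros j Hj; apply T; change 1 with (INR 1); rewrite <- minus_INR by lia;
          apply le_INR; lia)).
  assert (T2 := alt_bound_rsum K (fun j m => (Rpoly n m * Rweight n m)
        * / (INR m + (INR (2 * n + 1) + 1 + INR j))) n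
    ltac:(intros j Hj; apply T; generalize (pos_INR (2 * n + 1)) (pos_INR j); lra)).
  assert (T3 := alt_bound_rsum K (fun j m => (Rpoly n m * Rweight n m)
        * / (INR m + INR (n + 1 + j))) (S n)
    ltac:(intros j Hj; apply T; change 1 with (INR 1); apply le_INR; lia)).
  assert (B : alt_bound ((7 * INR n + 4) * K)
                (fun m => Derive (Rn n) (INR (n + m) + 1))).
  { assert (U1 := alt_bound_lin _ _ 1 2 _ _ T0 T1).
    assert (U2 := alt_bound_lin _ _ 2 (-3) _ _ T2 T3).
    assert (U := alt_bound_lin _ _ ((-1) ^ (n + 1)) ((-1) ^ (n + 1)) _ _ U1 U2).
    rewrite !pow_1_abs, Rabs_R1, (Rabs_pos_eq 2), (Rabs_left (-3)), S_INR in U by lra.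
    replace ((7 * INR n + 4) * K) with
     (1 * (1 * K + 2 * (INR n * K)) + 1 * (2 * (INR n * K) + - -3 * ((INR n + 1) * K)))
      by ring.
    eapply alt_bound_ext; [|exact U]. intros m; cbv beta.
    assert (E : forall f k, rsum (fun j => (Rpoly n m * Rweight n m) * f j) k
                      = Rpoly n m * Rweight n m * rsum f k).
    { intros f k; rewrite (rsum_ext _ (fun j => Rpoly n m * Rweight n m * f j + 0 * 0))
        by (intros; ring). rewrite (rsum_lin f (fun _ => 0)); ring. }
    rewrite Derive_Rn_dlog, Rn_factor, !E. unfold dlog. ring. }
  generalize (abel_alt_bound _ _ _ H B).
  now rewrite Rabs_mult, pow_1_abs, Rmult_1_l.
Qed.

(** * Dominant solutions of the recurrence *)

Lemma recurrence_cc u n : recurrence u ->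
  cA (INR (n + 2)) * u (n + 3)%nat = cB (INR (n + 2)) * u (n + 2)%nat
    - cC (INR (n + 2)) * u (n + 1)%nat + cD (INR (n + 2)) * u n.
Proof.
  intros H. assert (E := recurrence_elim u n H). unfold rec_op in E.
  replace (n + 2 + 1)%nat with (n + 3)%nat in E by lia.
  replace (n + 2 - 1)%nat with (n + 1)%nat in E by lia.
  replace (n + 2 - 2)%nat with n in E by lia.
  lra.
Qed.


(** The sign conditions on the coefficients for n >= 2 hold because their
    expansions in powers of n - 2 have positive coefficients only. *)
Lemma pos_poly6 c0 c1 c2 c3 c4 c5 c6 y : 0 < c0 -> 0 <= c1 -> 0 <= c2 -> 0 <= c3 ->
  0 <= c4 -> 0 <= c5 -> 0 <= c6 -> 0 <= y ->
  0 < c0 + c1 * y + c2 * y ^ 2 + c3 * y ^ 3 + c4 * y ^ 4 + c5 * y ^ 5 + c6 * y ^ 6.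
Proof.
  intros. assert (H7 : forall k, 0 <= y ^ k) by (intros; now apply pow_le).
  assert (0 <= c1 * y) by now apply Rmult_le_pos.
  assert (0 <= c2 * y ^ 2) by now apply Rmult_le_pos.
  assert (0 <= c3 * y ^ 3) by now apply Rmult_le_pos.
  assert (0 <= c4 * y ^ 4) by now apply Rmult_le_pos.
  assert (0 <= c5 * y ^ 5) by now apply Rmult_le_pos.
  assert (0 <= c6 * y ^ 6) by now apply Rmult_le_pos. lra.
Qed.

Lemma cA_pos x : 2 <= x -> 0 < cA x.
Proof.
  intros Hx. replace (cA x) with (279450 + 734265 * (x - 2) + 786537 * (x - 2) ^ 2
    + 439866 * (x - 2) ^ 3 + 135708 * (x - 2) ^ 4 + 21949 * (x - 2) ^ 5 + 1457 * (x - 2) ^ 6)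
    by (unfold cA; ring).
  apply pos_poly6; lra.
Qed.

Lemma cC_pos x : 2 <= x -> 0 < cC x.
Proof.
  intros Hx. replace (cC x) with (3425652 + 11531670 * (x - 2) + 16102866 * (x - 2) ^ 2
    + 11925999 * (x - 2) ^ 3 + 4934487 * (x - 2) ^ 4 + 1080107 * (x - 2) ^ 5
    + 97619 * (x - 2) ^ 6) by (unfold cC; ring).
  apply pos_poly6; lra.
Qed.

Lemma cD_pos x : 2 <= x -> 0 < cD x.
Proof.
  intros Hx. unfold cD. repeat apply Rmult_lt_0_compat; try lra; try nra.
Qed.

Lemma cBCA_pos x : 2 <= x -> 0 < 30 * cB x - cC x - 900 * cA x.
Proof.
  intros Hx. replace (30 * cB x - cC x - 900 * cA x)
    with (162252108 + 531060870 * (x - 2) + 707552784 * (x - 2) ^ 2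
    + 491296581 * (x - 2) ^ 3 + 187615263 * (x - 2) ^ 4 + 37412893 * (x - 2) ^ 5
    + 3049501 * (x - 2) ^ 6) by (unfold cA, cB, cC; ring).
  apply pos_poly6; lra.
Qed.

Lemma INR_ge_2 n : 2 <= INR (n + 2).
Proof. rewrite plus_INR; cbn; generalize (pos_INR n); lra. Qed.

(** Limit at infinity through the substitution h = 1/x. *)
Lemma is_lim_seq_rational (f g : R -> R) (l : R) : continuity_pt g 0 -> g 0 = l ->
  (forall x, 2 <= x -> f x = g (/ x)) -> is_lim_seq (fun n => f (INR (n + 2))) l.
Proof.
  intros Hc <- E.
  apply (is_lim_seq_ext (fun n => g (/ INR (n + 2)))).
  - intros n; symmetry; apply E, INR_ge_2.
  - apply is_lim_seq_continuous; [easy|].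
    apply (is_lim_seq_ext (fun n => / (INR (n + 1) + 1))).
    + intros n; do 2 f_equal. rewrite !plus_INR; cbn; ring.
    + apply (is_lim_seq_incr_n (fun n => / (INR n + 1)) 1), is_lim_seq_inv_INR1.
Qed.

Lemma is_lim_alpha : is_lim_seq (fun n => cB (INR (n + 2)) / cA (INR (n + 2))) 102.
Proof.
  apply (is_lim_seq_rational (fun x => cB x / cA x)
    (fun h => (148614 + 158202 * h - 9295 * h ^ 2 - 61894 * h ^ 3
      - 11111 * h ^ 4 + 8932 * h ^ 5 + 2784 * h ^ 6)
      / ((1457 - 1363 * h + 348 * h ^ 2) * (1 + h) ^ 4))).
  - reg. cbn; lra.
  - field.
  - intros x Hx. assert (H := cA_pos x Hx). unfold cB, cA in *. field.
    split; [|split]; try lra; nra.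
Qed.

Lemma is_lim_beta : is_lim_seq (fun n => cC (INR (n + 2)) / cA (INR (n + 2))) 67.
Proof.
  apply (is_lim_seq_rational (fun x => cC x / cA x)
    (fun h => (97619 - 91321 * h - 9443 * h ^ 2 + 35343 * h ^ 3
      - 5440 * h ^ 4 - 5678 * h ^ 5 + 1768 * h ^ 6)
      / ((1457 - 1363 * h + 348 * h ^ 2) * (1 + h) ^ 4))).
  - reg. cbn; lra.
  - field.
  - intros x Hx. assert (H := cA_pos x Hx). unfold cC, cA in *. field.
    split; [|split]; try lra; nra.
Qed.

Lemma is_lim_gamma : is_lim_seq (fun n => cD (INR (n + 2)) / cA (INR (n + 2))) 27.
Proof.
  apply (is_lim_seq_rational (fun x => cD x / cA x)
    (fun h => 3 * (1457 + 1551 * h + 442 * h ^ 2) * (3 - 2 * h) * (3 - 4 * h) * (1 - h) ^ 2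
      / ((1457 - 1363 * h + 348 * h ^ 2) * (1 + h) ^ 4))).
  - reg. cbn; lra.
  - field.
  - intros x Hx. assert (H := cA_pos x Hx). unfold cD, cA in *. field.
    split; [|split]; try lra; nra.
Qed.

(** If one ratio is at least 30, so is the next one: cB - cC/30 >= 30 cA, and
    the term with cD has the right sign. *)
Lemma growth_30 u : recurrence u -> 0 <= u 0%nat -> 0 < u 1%nat -> 30 * u 1%nat <= u 2%nat ->
  forall n, 0 <= u n /\ 0 < u (n + 1)%nat /\ 30 * u (n + 1)%nat <= u (n + 2)%nat.
Proof.
  intros Hu H0 H1 H2 n; induction n as [|n (I0 & I1 & I2)]; [easy|].
  replace (S n + 1)%nat with (n + 2)%nat by lia.
  replace (S n + 2)%nat with (n + 3)%nat by lia.
  replace (S n) with (n + 1)%nat by lia.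
  split; [lra|]. split; [lra|].
  assert (E := recurrence_cc u n Hu).
  assert (Hx := INR_ge_2 n). set (x := INR (n + 2)) in *.
  assert (PA := cA_pos x Hx). assert (PC := cC_pos x Hx). assert (PD := cD_pos x Hx).
  assert (PB := cBCA_pos x Hx).
  apply Rmult_le_reg_l with (30 * cA x); [lra|].
  replace (30 * cA x * u (n + 3)%nat) with (30 * (cA x * u (n + 3)%nat)) by ring.
  rewrite E.
  assert (T1 : 0 <= cD x * u n) by (apply Rmult_le_pos; lra).
  assert (T2 : cC x * (30 * u (n + 1)%nat) <= cC x * u (n + 2)%nat)
    by (apply Rmult_le_compat_l; lra).
  assert (T3 : 0 <= (30 * cB x - cC x - 900 * cA x) * u (n + 2)%nat)
    by (apply Rmult_le_pos; lra).
  lra.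
Qed.

(** A bound M for late terms improves to 3M/4 for still later ones. *)
Lemma contraction_lim e dl : (forall n, 0 <= e n) -> is_lim_seq dl 0 ->
  (forall n, e (n + 2)%nat <= dl n + (e (n + 1)%nat + e n) / 4) -> is_lim_seq e 0.
Proof.
  intros He Hd Hrec.
  assert (Hd' : forall eps, 0 < eps -> exists N, forall n, (N <= n)%nat -> dl n < eps).
  { intros eps Heps. apply is_lim_seq_spec in Hd.
    destruct (Hd (mkposreal eps Heps)) as [N HN]. exists N; intros n Hn.
    specialize (HN n Hn). cbn in HN. apply Rabs_def2 in HN. lra. }
  destruct (Hd' 1 Rlt_0_1) as [N0 HN0].
  set (M := Rmax 2 (Rmax (e N0) (e (S N0)))).
  assert (HM2 : 2 <= M) by apply Rmax_l.
  assert (HM : forall n, e (N0 + n)%nat <= M /\ e (S (N0 + n)) <= M).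
  { induction n as [|n [I1 I2]].
    - rewrite Nat.add_0_r. unfold M; split.
      + eapply Rle_trans; [|apply Rmax_r]. apply Rmax_l.
      + eapply Rle_trans; [|apply Rmax_r]. apply Rmax_r.
    - rewrite Nat.add_succ_r. split; [easy|].
      generalize (Hrec (N0 + n)%nat) (HN0 (N0 + n)%nat ltac:(lia)).
      replace (N0 + n + 2)%nat with (S (S (N0 + n))) by lia.
      replace (N0 + n + 1)%nat with (S (N0 + n)) by lia. lra. }
  assert (HK : forall k, exists N, forall n, (N <= n)%nat -> e n <= M * (3 / 4) ^ k).
  { induction k as [|k [N HN]].
    - exists N0; intros n Hn. cbn. rewrite Rmult_1_r.
      replace n with (N0 + (n - N0))%nat by lia. apply HM.
    - assert (Hp : 0 < M * (3 / 4) ^ k) by (apply Rmult_lt_0_compat; [lra|apply pow_lt; lra]).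
      destruct (Hd' (M * (3 / 4) ^ k / 4) ltac:(lra)) as [N' HN'].
      exists (N + N' + 2)%nat; intros n Hn.
      generalize (Hrec (n - 2)%nat) (HN' (n - 2)%nat ltac:(lia))
        (HN (n - 2)%nat ltac:(lia)) (HN (n - 1)%nat ltac:(lia)).
      replace (n - 2 + 2)%nat with n by lia. replace (n - 2 + 1)%nat with (n - 1)%nat by lia.
      cbn [pow]. lra. }
  apply is_lim_seq_spec; intros eps.
  destruct (pow_lt_1_zero (3 / 4) ltac:(rewrite Rabs_pos_eq; lra) (eps / M)) as [k Hk].
  { apply Rdiv_lt_0_compat; [apply cond_pos|lra]. }
  destruct (HK k) as [N HN]. exists N; intros n Hn.
  rewrite Rminus_0_r, Rabs_pos_eq by apply He.
  eapply Rle_lt_trans; [now apply HN|].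
  specialize (Hk k (le_n k)). rewrite Rabs_pos_eq in Hk by (apply pow_le; lra).
  apply (Rmult_lt_compat_l M) in Hk; [|lra].
  replace (M * (eps / M)) with (pos eps) in Hk by (field; lra). lra.
Qed.

(** The map r -> 102 - 67/r + 27/r^2 contracts strongly near its fixed point. *)
Lemma ratio_lim u L : recurrence u -> 101 <= L <= 102 ->
  L ^ 3 - 102 * L ^ 2 + 67 * L - 27 = 0 ->
  0 <= u 0%nat -> 0 < u 1%nat -> 30 * u 1%nat <= u 2%nat ->
  is_lim_seq (fun n => u (n + 1)%nat / u n) L.
Proof.
  intros Hu HL EL H0 H1 H2.
  assert (G := growth_30 u Hu H0 H1 H2).
  set (rho := fun n => u (n + 1)%nat / u n).
  set (al := fun n => cB (INR (n + 2)) / cA (INR (n + 2))).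
  set (be := fun n => cC (INR (n + 2)) / cA (INR (n + 2))).
  set (ga := fun n => cD (INR (n + 2)) / cA (INR (n + 2))).
  set (dl := fun n => Rabs (al n - 102) + Rabs (be n - 67) + Rabs (ga n - 27)).
  assert (Hdl : is_lim_seq dl 0).
  { assert (X : forall f (l : R), is_lim_seq f l -> is_lim_seq (fun n => Rabs (f n - l)) 0).
    { intros f l Hf. rewrite <- Rabs_R0. apply (is_lim_seq_abs _ 0).
      replace (Finite 0) with (Finite (l - l)) by (f_equal; ring).
      apply is_lim_seq_minus'; [easy|apply is_lim_seq_const]. }
    replace (Finite 0) with (Finite (0 + 0 + 0)) by (f_equal; ring).
    apply is_lim_seq_plus'; [apply is_lim_seq_plus'|]; apply X;
      [apply is_lim_alpha|apply is_lim_beta|apply is_lim_gamma]. }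
  assert (Hr : forall n, 30 <= rho (n + 1)%nat).
  { intros n; unfold rho. destruct (G n) as (_ & P & Q).
    replace (n + 1 + 1)%nat with (n + 2)%nat by lia.
    apply Rmult_le_reg_r with (u (n + 1)%nat); [easy|].
    unfold Rdiv; rewrite Rmult_assoc, Rinv_l by lra. lra. }
  assert (Erho : forall n, rho (n + 3)%nat = al (n + 1)%nat - be (n + 1)%nat / rho (n + 2)%nat
                   + ga (n + 1)%nat / (rho (n + 2)%nat * rho (n + 1)%nat)).
  { intros n. unfold rho, al, be, ga.
    destruct (G n) as (_ & P1 & _). destruct (G (n + 1)%nat) as (_ & P2 & _).
    destruct (G (n + 2)%nat) as (_ & P3 & _).
    assert (E := recurrence_cc u (n + 1) Hu).
    assert (PA := cA_pos _ (INR_ge_2 (n + 1))).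
    replace (n + 1 + 1)%nat with (n + 2)%nat in * by lia.
    replace (n + 1 + 3)%nat with (n + 3 + 1)%nat in * by lia.
    replace (n + 1 + 2)%nat with (n + 3)%nat in * by lia.
    replace (n + 2 + 1)%nat with (n + 3)%nat in * by lia.
    replace (u (n + 3 + 1)%nat) with ((cB (INR (n + 3)) * u (n + 3)%nat
      - cC (INR (n + 3)) * u (n + 2)%nat + cD (INR (n + 3)) * u (n + 1)%nat) / cA (INR (n + 3)))
      by (rewrite <- E; field; lra).
    field. repeat split; lra. }
  assert (EL' : L = 102 - 67 / L + 27 / (L * L)).
  { apply Rmult_eq_reg_r with (L * L); [|nra].
    replace ((102 - 67 / L + 27 / (L * L)) * (L * L)) with (102 * L ^ 2 - 67 * L + 27)
      by (field; lra). lra. }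
  assert (C : is_lim_seq (fun n => Rabs (rho (n + 1)%nat - L)) 0).
  { apply (contraction_lim _ (fun n => dl (n + 1)%nat)).
    - intros n; apply Rabs_pos.
    - now apply (is_lim_seq_incr_n dl 1).
    - intros n.
      replace (n + 2 + 1)%nat with (n + 3)%nat by lia.
      replace (n + 1 + 1)%nat with (n + 2)%nat by lia.
      assert (Q1 := Hr (n + 1)%nat). replace (n + 1 + 1)%nat with (n + 2)%nat in Q1 by lia.
      assert (Q2 := Hr n).
      rewrite Erho. unfold dl.
      set (r1 := rho (n + 2)%nat) in *. set (r2 := rho (n + 1)%nat) in *.
      set (x := al (n + 1)%nat). set (y := be (n + 1)%nat). set (z := ga (n + 1)%nat).
      clearbody r1 r2 x y z. clear - HL EL' Q1 Q2.
      (* 3000 is a lower bound for r L >= 30 * 101. *)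
      assert (B : forall r, 30 <= r -> Rabs (/ r - / L) <= Rabs (r - L) / 3000).
      { intros r Hr. replace (/ r - / L) with (- (r - L) * / (r * L)) by (field; lra).
        rewrite Rabs_mult, Rabs_Ropp.
        unfold Rdiv. apply Rmult_le_compat_l; [apply Rabs_pos|].
        rewrite Rabs_pos_eq by (apply Rlt_le, Rinv_0_lt_compat; nra).
        apply Rinv_le_contravar; nra. }
      assert (B1 := B r1 Q1). assert (B2 := B r2 Q2).
      assert (I : forall r, 30 <= r -> 0 < / r <= / 30).
      { intros r Hr; split; [apply Rinv_0_lt_compat; lra|apply Rinv_le_contravar; lra]. }
      assert (I1 := I r1 Q1). assert (I2 := I r2 Q2). assert (IL := I L ltac:(lra)).
      replace (x - y / r1 + z / (r1 * r2) - L) with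
        ((x - 102) - (y - 67) * / r1 - 67 * (/ r1 - / L) + (z - 27) * (/ r1 * / r2)
         + 27 * ((/ r1 - / L) * / r2 + / L * (/ r2 - / L)))
        by (rewrite EL' at 5; field; lra).
      set (i1 := / r1) in *. set (i2 := / r2) in *. set (iL := / L) in *.
      set (e1 := Rabs (r1 - L)) in *. set (e2 := Rabs (r2 - L)) in *.
      assert (0 <= e1) by apply Rabs_pos. assert (0 <= e2) by apply Rabs_pos.
      assert (T1 : Rabs ((y - 67) * i1) <= Rabs (y - 67)).
      { rewrite Rabs_mult, (Rabs_pos_eq i1) by lra. generalize (Rabs_pos (y - 67)); nra. }
      assert (T2 : Rabs ((z - 27) * (i1 * i2)) <= Rabs (z - 27)).
      { rewrite Rabs_mult, (Rabs_pos_eq (i1 * i2)) by nra.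
        assert (i1 * i2 <= 1) by nra. generalize (Rabs_pos (z - 27)); nra. }
      assert (T3 : Rabs (67 * (i1 - iL)) <= 67 * (e1 / 3000)).
      { rewrite Rabs_mult, (Rabs_pos_eq 67) by lra. lra. }
      assert (T4 : Rabs (27 * ((i1 - iL) * i2 + iL * (i2 - iL))) <= 27 * (e1 / 3000 + e2 / 3000)).
      { rewrite Rabs_mult, (Rabs_pos_eq 27) by lra. apply Rmult_le_compat_l; [lra|].
        eapply Rle_trans; [apply Rabs_triang|]. rewrite !Rabs_mult.
        rewrite (Rabs_pos_eq i2), (Rabs_pos_eq iL) by lra.
        generalize (Rabs_pos (i1 - iL)) (Rabs_pos (i2 - iL)); nra. }
      eapply Rle_trans; [apply Rabs_triang|].
      eapply Rle_trans; [apply Rplus_le_compat_r, Rabs_triang|].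
      unfold Rminus at 1. eapply Rle_trans;
        [do 2 apply Rplus_le_compat_r; apply Rabs_triang|].
      unfold Rminus at 1. eapply Rle_trans;
        [do 3 apply Rplus_le_compat_r; apply Rabs_triang|].
      rewrite !Rabs_Ropp. lra. }
  apply (is_lim_seq_incr_n rho 1).
  apply is_lim_seq_spec; intros eps. apply is_lim_seq_spec in C.
  destruct (C eps) as [N HN]. exists N; intros n Hn. specialize (HN n Hn).
  cbv beta in HN. now rewrite Rminus_0_r, Rabs_Rabsolu in HN.
Qed.

Lemma abs_root_nonneg n x : 0 <= abs_root n x.
Proof.
  unfold abs_root. destruct (Req_EM_T x 0); [lra|]. apply Rlt_le, exp_pos.
Qed.

Lemma abs_root_pow n x : (1 <= n)%nat -> abs_root n x ^ n = Rabs x.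
Proof.
  intros Hn. unfold abs_root. destruct (Req_EM_T x 0) as [->|Hx].
  - rewrite Rabs_R0, pow_i; [easy|lia].
  - rewrite <- Rpower_pow by apply exp_pos.
    rewrite Rpower_mult, Rinv_l, Rpower_1; [easy|now apply Rabs_pos_lt|].
    apply not_0_INR; lia.
Qed.

Lemma pow_lt_strict x y n : 0 <= x < y -> (1 <= n)%nat -> x ^ n < y ^ n.
Proof.
  intros Hxy Hn; induction Hn as [|n _ IH]; [lra|]. cbn [pow].
  assert (0 < y ^ n) by (apply pow_lt; lra).
  assert (0 <= x ^ n) by (apply pow_le; lra). nra.
Qed.

Lemma abs_root_le n x q : (1 <= n)%nat -> 0 <= q -> Rabs x <= q ^ n -> abs_root n x <= q.
Proof.
  intros Hn Hq H. rewrite <- (abs_root_pow n x Hn) in H.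
  destruct (Rle_lt_dec (abs_root n x) q) as [|Hlt]; [easy|].
  generalize (pow_lt_strict q (abs_root n x) n ltac:(lra) Hn); lra.
Qed.

Lemma abs_root_ge n x q : (1 <= n)%nat -> q ^ n <= Rabs x -> q <= abs_root n x.
Proof.
  intros Hn H. rewrite <- (abs_root_pow n x Hn) in H.
  destruct (Rle_lt_dec q (abs_root n x)) as [|Hlt]; [easy|].
  generalize (pow_lt_strict (abs_root n x) q n (conj (abs_root_nonneg n x) Hlt) Hn); lra.
Qed.

Lemma geom_eventually C q : 0 <= q < 1 -> exists N, forall n, (N <= n)%nat -> C * q ^ n < 1.
Proof.
  intros Hq.
  destruct (pow_lt_1_zero q ltac:(rewrite Rabs_pos_eq; lra) (/ (Rabs C + 1))) as [N HN].
  { apply Rinv_0_lt_compat; generalize (Rabs_pos C); lra. }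
  exists N; intros n Hn. specialize (HN n Hn).
  assert (0 <= q ^ n) by (apply pow_le; lra). rewrite Rabs_pos_eq in HN by easy.
  assert (HC := Rabs_pos C).
  apply (Rmult_lt_compat_l (Rabs C + 1)) in HN; [|lra]. rewrite Rinv_r in HN by lra.
  generalize (Rle_abs C); nra.
Qed.

Lemma root_upper u C q q' N : 0 < q < q' ->
  (forall n, (N <= n)%nat -> Rabs (u n) <= C * q ^ n) ->
  exists N', forall n, (N' <= n)%nat -> abs_root n (u n) <= q'.
Proof.
  intros Hq H.
  destruct (geom_eventually C (q / q')) as [N1 H1].
  { split; [apply Rlt_le, Rdiv_lt_0_compat; lra|].
    apply Rmult_lt_reg_r with q'; [lra|].
    unfold Rdiv; rewrite Rmult_assoc, Rinv_l; lra. }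
  exists (N + N1 + 1)%nat; intros n Hn.
  apply abs_root_le; [lia|lra|].
  eapply Rle_trans; [apply H; lia|].
  specialize (H1 n ltac:(lia)).
  assert (0 < q' ^ n) by (apply pow_lt; lra).
  unfold Rdiv in H1; rewrite Rpow_mult_distr, pow_inv in H1.
  apply (Rmult_lt_compat_r (q' ^ n)) in H1; [|easy].
  replace (C * (q ^ n * / q' ^ n) * q' ^ n) with (C * q ^ n) in H1 by (field; lra). lra.
Qed.

Lemma root_lower u c q q' N : 0 < c -> 0 < q' < q ->
  (forall n, (N <= n)%nat -> c * q ^ n <= Rabs (u n)) ->
  exists N', forall n, (N' <= n)%nat -> q' <= abs_root n (u n).
Proof.
  intros Hc Hq H.
  destruct (geom_eventually (/ c) (q' / q)) as [N1 H1].
  { split; [apply Rlt_le, Rdiv_lt_0_compat; lra|].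
    apply Rmult_lt_reg_r with q; [lra|].
    unfold Rdiv; rewrite Rmult_assoc, Rinv_l; lra. }
  exists (N + N1 + 1)%nat; intros n Hn.
  apply abs_root_ge; [lia|].
  eapply Rle_trans; [|apply H; lia].
  specialize (H1 n ltac:(lia)).
  assert (0 < q ^ n) by (apply pow_lt; lra).
  unfold Rdiv in H1; rewrite Rpow_mult_distr, pow_inv in H1.
  apply (Rmult_lt_compat_r (c * q ^ n)) in H1; [|now apply Rmult_lt_0_compat].
  replace (/ c * (q' ^ n * / q ^ n) * (c * q ^ n)) with (q' ^ n) in H1 by (field; lra). lra.
Qed.

Lemma eventually_step (P : nat -> Prop) N : P N -> (forall n, (N <= n)%nat -> P n -> P (S n)) ->
  forall n, (N <= n)%nat -> P n.
Proof. intros H0 HS n Hn; induction Hn as [|n Hn IH]; [easy|]. now apply HS. Qed.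

Lemma ratio_root u L N0 : 0 < L -> (forall n, (N0 <= n)%nat -> 0 < u n) ->
  is_lim_seq (fun n => u (n + 1)%nat / u n) L -> is_lim_seq (fun n => abs_root n (u n)) L.
Proof.
  intros HL Hp Hlim. apply is_lim_seq_spec; intros eps.
  assert (He := cond_pos eps).
  set (e := Rmin (eps / 4) (L / 4)).
  assert (He' : 0 < e) by (apply Rmin_glb_lt; lra).
  assert (e <= eps / 4) by apply Rmin_l. assert (e <= L / 4) by apply Rmin_r.
  apply is_lim_seq_spec in Hlim. destruct (Hlim (mkposreal e He')) as [N1 HN1]. cbn in HN1.
  set (N := (N0 + N1)%nat).
  assert (S1 : forall n, (N <= n)%nat -> (L - e) * u n <= u (S n) <= (L + e) * u n).
  { intros n Hn. specialize (HN1 n ltac:(unfold N in Hn; lia)).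
    assert (P := Hp n ltac:(unfold N in Hn; lia)).
    apply Rabs_def2 in HN1. rewrite Nat.add_1_r in HN1.
    replace (u (S n)) with (u (S n) / u n * u n) by (field; lra).
    split; apply Rmult_le_compat_r; lra. }
  assert (PN := Hp N ltac:(unfold N; lia)).
  destruct (root_upper u (u N / (L + e) ^ N) (L + e) (L + 2 * e) N ltac:(lra)) as [M1 HM1].
  { apply eventually_step.
    - rewrite Rabs_pos_eq by lra. right; field. apply pow_nonzero; lra.
    - intros n Hn IH. assert (P := Hp n ltac:(unfold N in Hn; lia)).
      assert (P' := Hp (S n) ltac:(unfold N in Hn; lia)).
      rewrite Rabs_pos_eq in * by lra. cbn [pow].
      generalize (S1 n Hn); intros [_ S2].
      apply (Rmult_le_compat_l (L + e)) in IH; lra. }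
  destruct (root_lower u (u N / (L - e) ^ N) (L - e) (L - 2 * e) N) as [M2 HM2].
  { apply Rdiv_lt_0_compat; [easy|apply pow_lt; lra]. }
  { lra. }
  { apply eventually_step.
    - rewrite Rabs_pos_eq by lra. right; field. apply pow_nonzero; lra.
    - intros n Hn IH. assert (P := Hp n ltac:(unfold N in Hn; lia)).
      assert (P' := Hp (S n) ltac:(unfold N in Hn; lia)).
      rewrite Rabs_pos_eq in * by lra. cbn [pow].
      generalize (S1 n Hn); intros [S2 _].
      apply (Rmult_le_compat_l (L - e)) in IH; lra. }
  exists (M1 + M2)%nat; intros n Hn.
  generalize (HM1 n ltac:(lia)) (HM2 n ltac:(lia)); intros.
  apply Rabs_def1; lra.
Qed.

(** * Recessive solutions of the recurrence *)

(** Invariant form (up to the factor p) of X' = s X - p Y, Y' = X. *)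
Definition qform (s p x y : R) : R := x ^ 2 - s * x * y + p * y ^ 2.

(** s = 102 - l and p = 27/l for the real zero l; what matters is s^2 < 4 p. *)
Lemma qform_coercive s p x y : 0.65 < s < 0.66 -> 0.2664 < p < 0.2665 ->
  x ^ 2 <= 4 * qform s p x y /\ y ^ 2 <= 7 * qform s p x y.
Proof.
  intros Hs Hp. unfold qform.
  assert (E : x ^ 2 - s * x * y + p * y ^ 2
              = (x - s / 2 * y) ^ 2 + (p - s ^ 2 / 4) * y ^ 2) by field.
  assert (H1 : 0.157 < p - s ^ 2 / 4) by nra.
  assert (H2 := pow2_ge_0 (x - s / 2 * y)). assert (H3 := pow2_ge_0 y).
  rewrite E. split.
  - assert (x ^ 2 <= 2 * (x - s / 2 * y) ^ 2 + 2 * (s / 2 * y) ^ 2).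
    { generalize (pow2_ge_0 (x - 2 * (s / 2 * y))); intros. nra. }
    assert ((s / 2 * y) ^ 2 <= 0.11 * y ^ 2).
    { replace ((s / 2 * y) ^ 2) with (s ^ 2 / 4 * y ^ 2) by field.
      apply Rmult_le_compat_r; nra. }
    nra.
  - nra.
Qed.

Lemma qform_step s p x y h e : 0.65 < s < 0.66 -> 0.2664 < p < 0.2665 -> 0 <= e <= 1 ->
  Rabs h <= e * (Rabs x + Rabs y) ->
  Rabs (qform s p (s * x - p * y + h) x - p * qform s p x y) <= 44 * e * qform s p x y.
Proof.
  intros Hs Hp He Hh.
  destruct (qform_coercive s p x y Hs Hp) as [Cx Cy].
  replace (qform s p (s * x - p * y + h) x - p * qform s p x y)
    with (h * (s * x - 2 * p * y) + h ^ 2) by (unfold qform; ring).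
  set (N := qform s p x y) in *.
  assert (Hx := Rabs_pos x). assert (Hy := Rabs_pos y).
  assert (Ex : x ^ 2 = Rabs x ^ 2) by (rewrite pow2_abs; easy).
  assert (Ey : y ^ 2 = Rabs y ^ 2) by (rewrite pow2_abs; easy).
  rewrite Ex in Cx. rewrite Ey in Cy.
  assert (H1 : Rabs (s * x - 2 * p * y) <= Rabs x + Rabs y).
  { unfold Rminus. eapply Rle_trans; [apply Rabs_triang|].
    rewrite Rabs_Ropp, !Rabs_mult, (Rabs_pos_eq s), (Rabs_pos_eq 2), (Rabs_pos_eq p) by lra.
    nra. }
  eapply Rle_trans; [apply Rabs_triang|]. rewrite Rabs_mult, <- RPow_abs.
  set (X := Rabs x) in *. set (Y := Rabs y) in *. set (H := Rabs h) in *.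
  assert (H0 : 0 <= H) by apply Rabs_pos.
  set (T := X + Y) in *.
  assert (HT : T ^ 2 <= 22 * N) by (unfold T; nra).
  assert (HT0 : 0 <= T) by (unfold T; lra).
  apply Rle_trans with (H * T + H * T).
  - apply Rplus_le_compat; [apply Rmult_le_compat_l; lra|].
    cbn. rewrite Rmult_1_r. apply Rmult_le_compat_l; [easy|]. nra.
  - apply Rle_trans with (2 * (e * T * T)); [nra|].
    replace (44 * e * N) with (2 * (e * (22 * N))) by ring. nra.
Qed.

Lemma is_lim_seq_eventually f (l : R) eps : is_lim_seq f l -> 0 < eps ->
  exists N, forall n, (N <= n)%nat -> Rabs (f n - l) < eps.
Proof.
  intros H He. apply is_lim_seq_spec in H. exact (H (mkposreal eps He)).
Qed.

(** The limiting recurrence multiplies the form by exactly p, and since the form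
    is definite, a small change of the coefficients changes it by a small
    fraction of itself. *)
Lemma qform_growth s p sg pi d : 0.65 < s < 0.66 -> 0.2664 < p < 0.2665 ->
  is_lim_seq sg s -> is_lim_seq pi p ->
  (forall n, d (n + 2)%nat = sg n * d (n + 1)%nat - pi n * d n) ->
  forall eta, 0 < eta -> exists N, forall n, (N <= n)%nat ->
    Rabs (qform s p (d (n + 2)%nat) (d (n + 1)%nat) - p * qform s p (d (n + 1)%nat) (d n))
    <= eta * qform s p (d (n + 1)%nat) (d n).
Proof.
  intros Hs Hp Lsg Lpi Hd eta Heta.
  set (e := Rmin 1 (eta / 44)).
  assert (He : 0 < e <= 1) by (split; [apply Rmin_glb_lt; lra|apply Rmin_l]).
  assert (He' : 44 * e <= eta).
  { assert (e <= eta / 44) by apply Rmin_r. lra. }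
  destruct (is_lim_seq_eventually _ _ e Lsg ltac:(lra)) as [N1 H1].
  destruct (is_lim_seq_eventually _ _ e Lpi ltac:(lra)) as [N2 H2].
  exists (N1 + N2)%nat; intros n Hn.
  specialize (H1 n ltac:(lia)). specialize (H2 n ltac:(lia)).
  set (x := d (n + 1)%nat) in *. set (y := d n) in *.
  rewrite Hd. fold x y.
  replace (sg n * x - pi n * y) with (s * x - p * y + ((sg n - s) * x - (pi n - p) * y)) by ring.
  eapply Rle_trans.
  - apply (qform_step s p x y _ e Hs Hp); [lra|].
    unfold Rminus at 1. eapply Rle_trans; [apply Rabs_triang|].
    rewrite Rabs_Ropp, !Rabs_mult, Rmult_plus_distr_l.
    apply Rplus_le_compat; apply Rmult_le_compat_r; try apply Rabs_pos; lra.
  - apply Rmult_le_compat_r; [|easy].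
    destruct (qform_coercive s p x y Hs Hp). generalize (pow2_ge_0 x); lra.
Qed.

Lemma qform_upper s p sg pi d q : 0.65 < s < 0.66 -> 0.2664 < p < 0.2665 ->
  is_lim_seq sg s -> is_lim_seq pi p ->
  (forall n, d (n + 2)%nat = sg n * d (n + 1)%nat - pi n * d n) ->
  sqrt p < q -> exists C N, 0 <= C /\ forall n, (N <= n)%nat -> Rabs (d n) <= C * q ^ n.
Proof.
  intros Hs Hp Lsg Lpi Hd Hq.
  assert (Hsp : 0 < sqrt p) by (apply sqrt_lt_R0; lra).
  assert (Esp := sqrt_sqrt p ltac:(lra)).
  assert (Hq2 : p < q ^ 2) by nra.
  destruct (qform_growth s p sg pi d Hs Hp Lsg Lpi Hd (q ^ 2 - p) ltac:(lra)) as [N HN].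
  set (Q := fun n => qform s p (d (n + 1)%nat) (d n)) in *.
  assert (Qpos : forall n, 0 <= Q n).
  { intros n. destruct (qform_coercive s p (d (n + 1)%nat) (d n) Hs Hp).
    unfold Q. generalize (pow2_ge_0 (d n)); lra. }
  set (K := Q N / (q ^ 2) ^ N).
  assert (HK : 0 <= K).
  { unfold K. apply Rmult_le_pos; [apply Qpos|].
    apply Rlt_le, Rinv_0_lt_compat, pow_lt; lra. }
  assert (HQ : forall n, (N <= n)%nat -> Q n <= K * (q ^ 2) ^ n).
  { apply eventually_step.
    - right; unfold K; field. apply pow_nonzero. lra.
    - intros n Hn IH. specialize (HN n Hn).
      assert (E : Q (S n) = qform s p (d (n + 2)%nat) (d (n + 1)%nat)).
      { unfold Q. now replace (S n + 1)%nat with (n + 2)%nat by lia; rewrite Nat.add_1_r. }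
      rewrite <- E in HN. fold (Q n) in HN.
      apply Rabs_le_between in HN.
      apply (Rmult_le_compat_l (q ^ 2)) in IH; [|lra]. cbn [pow] in *. lra. }
  exists (sqrt (7 * K)), N. split; [apply sqrt_pos|]. intros n Hn.
  specialize (HQ n Hn).
  destruct (qform_coercive s p (d (n + 1)%nat) (d n) Hs Hp) as [_ Cy]. fold (Q n) in Cy.
  assert (Hqn : 0 < q ^ n) by (apply pow_lt; lra).
  apply Rsqr_incr_0.
  - rewrite <- Rsqr_abs. unfold Rsqr.
    replace (sqrt (7 * K) * q ^ n * (sqrt (7 * K) * q ^ n))
      with (sqrt (7 * K) * sqrt (7 * K) * (q ^ n) ^ 2) by ring.
    rewrite sqrt_sqrt by lra. rewrite <- pow_mult, Nat.mul_comm, pow_mult. cbn [pow] in *. nra.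
  - apply Rabs_pos.
  - apply Rmult_le_pos; [apply sqrt_pos|lra].
Qed.

Lemma qform_lower s p sg pi d : 0.65 < s < 0.66 -> 0.2664 < p < 0.2665 ->
  is_lim_seq sg s -> is_lim_seq pi p ->
  (forall n, d (n + 2)%nat = sg n * d (n + 1)%nat - pi n * d n) ->
  (forall n, 0 < qform s p (d (n + 1)%nat) (d n)) ->
  forall q, 0 < q < sqrt p -> exists c N, 0 < c /\
    forall n, (N <= n)%nat -> c * (q ^ 2) ^ n <= qform s p (d (n + 1)%nat) (d n).
Proof.
  intros Hs Hp Lsg Lpi Hd Hpos q Hq.
  assert (Esp := sqrt_sqrt p ltac:(lra)).
  assert (Hq2 : 0 < q ^ 2 < p) by nra.
  destruct (qform_growth s p sg pi d Hs Hp Lsg Lpi Hd (p - q ^ 2) ltac:(lra)) as [N HN].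
  set (Q := fun n => qform s p (d (n + 1)%nat) (d n)) in *.
  exists (Q N / (q ^ 2) ^ N), N. split.
  { apply Rdiv_lt_0_compat; [apply Hpos|apply pow_lt; lra]. }
  apply eventually_step.
  - right; unfold Q; field. apply pow_nonzero. lra.
  - intros n Hn IH. specialize (HN n Hn).
    assert (E : Q (S n) = qform s p (d (n + 2)%nat) (d (n + 1)%nat)).
    { unfold Q. now replace (S n + 1)%nat with (n + 2)%nat by lia; rewrite Nat.add_1_r. }
    rewrite <- E in HN. fold (Q n) in HN, IH. fold (Q (S n)).
    apply Rabs_le_between in HN.
    apply (Rmult_le_compat_l (q ^ 2)) in IH; [|lra]. cbn [pow] in *. lra.
Qed.

(** The recurrence can be solved for its oldest term because cD does not vanish. *)
Lemma recurrence_backward u N : recurrence u -> (forall n, (N <= n)%nat -> u n = 0) ->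
  forall n, u n = 0.
Proof.
  intros Hu H. induction N as [|N IH]; [intros; apply H; lia|].
  apply IH. intros n Hn. destruct (Nat.eq_dec n N) as [->|Hne]; [|apply H; lia].
  assert (E := recurrence_cc u N Hu). rewrite !H in E by lia.
  assert (P := cD_pos _ (INR_ge_2 N)). nra.
Qed.

(** Throughout, A is a solution with ratios tending to the dominant zero L, and u
    is a nontrivial solution with u = o(A).  Reduction of order: the differences
    of u/A, rescaled to d(n) = u(n + 1) - rho(n) u(n), satisfy a recurrence of order
    two whose limiting characteristic polynomial is the cubic divided by x - L. *)
Section Recessive.

Variables (A : nat -> R) (L s p : R).
Hypothesis HA : recurrence A.
Hypothesis HA0 : 0 < A 0%nat.
Hypothesis HA1 : forall n, 0 < A (n + 1)%nat /\ 30 * A (n + 1)%nat <= A (n + 2)%nat.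
Hypothesis HL : 101 <= L <= 101.9.
Hypothesis HLA : is_lim_seq (fun n => A (n + 1)%nat / A n) L.
Hypothesis Hs : 0.65 < s < 0.66.
Hypothesis Hp : 0.2664 < p < 0.2665.
Hypothesis Es : s = 102 - L.
Hypothesis Ep : p = 27 / L.

Variable u : nat -> R.
Hypothesis Hu : recurrence u.
Hypothesis Hu0 : u 0%nat <> 0.
Hypothesis Hlim : is_lim_seq (fun n => u n / A n) 0.

Let rho n := A (n + 1)%nat / A n.
Let d n := u (n + 1)%nat - rho n * u n.

Lemma dominant_pos n : 0 < A n.
Proof. destruct n as [|n]; [easy|]. rewrite <- Nat.add_1_r. apply HA1. Qed.

Lemma reduced_recurrence n : d (n + 2)%nat
  = (cB (INR (n + 2)) / cA (INR (n + 2)) - rho (n + 2)%nat) * d (n + 1)%nat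
    - (cD (INR (n + 2)) / cA (INR (n + 2)) / rho n) * d n.
Proof.
  unfold d, rho.
  assert (P0 := dominant_pos n). assert (P1 := dominant_pos (n + 1)).
  assert (P2 := dominant_pos (n + 2)). assert (PA := cA_pos _ (INR_ge_2 n)).
  assert (E1 := recurrence_cc A n HA). assert (E2 := recurrence_cc u n Hu).
  replace (n + 2 + 1)%nat with (n + 3)%nat by lia.
  replace (n + 1 + 1)%nat with (n + 2)%nat by lia.
  set (x := INR (n + 2)) in *.
  apply (f_equal (fun z => z / cA x)) in E1, E2.
  replace (cA x * A (n + 3)%nat / cA x) with (A (n + 3)%nat) in E1 by (field; lra).
  replace (cA x * u (n + 3)%nat / cA x) with (u (n + 3)%nat) in E2 by (field; lra).
  rewrite E1, E2. field. repeat split; lra.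
Qed.

Lemma reduced_sigma : is_lim_seq (fun n => cB (INR (n + 2)) / cA (INR (n + 2)) - rho (n + 2)%nat) s.
Proof.
  rewrite Es. apply is_lim_seq_minus'; [apply is_lim_alpha|].
  now apply (is_lim_seq_incr_n rho 2).
Qed.

Lemma reduced_pi : is_lim_seq (fun n => cD (INR (n + 2)) / cA (INR (n + 2)) / rho n) p.
Proof.
  rewrite Ep. apply is_lim_seq_div'; [apply is_lim_gamma|easy|lra].
Qed.

Lemma quotient_step n : u (S n) / A (S n) - u n / A n = d n / A (S n).
Proof.
  unfold d, rho. rewrite Nat.add_1_r.
  assert (P0 := dominant_pos n). assert (P1 := dominant_pos (S n)). field; lra.
Qed.

(** If the form vanished once, d would vanish from there on, so u/A would be
    constant, hence 0, and running the recurrence backwards u = 0. *)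
Lemma reduced_nonzero n : 0 < qform s p (d (n + 1)%nat) (d n).
Proof.
  destruct (qform_coercive s p (d (n + 1)%nat) (d n) Hs Hp) as [Cx Cy].
  assert (S1 := pow2_ge_0 (d n)). assert (S2 := pow2_ge_0 (d (n + 1)%nat)).
  destruct (Rle_lt_or_eq_dec 0 (qform s p (d (n + 1)%nat) (d n)) ltac:(lra)) as [H|H];
    [easy|exfalso].
  rewrite <- H in Cx, Cy.
  assert (Z0 : d n = 0) by nra. assert (Z1 : d (n + 1)%nat = 0) by nra.
  assert (Z : forall k, d (n + k)%nat = 0 /\ d (n + k + 1)%nat = 0).
  { induction k as [|k [I1 I2]]; [now rewrite Nat.add_0_r|].
    replace (n + S k)%nat with (n + k + 1)%nat by lia. split; [easy|].
    replace (n + k + 1 + 1)%nat with (n + k + 2)%nat by lia.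
    rewrite reduced_recurrence, I1, I2; ring. }
  assert (W : forall k, u (n + k)%nat / A (n + k)%nat = u n / A n).
  { induction k as [|k IH]; [now rewrite Nat.add_0_r|].
    rewrite <- IH. replace (n + S k)%nat with (S (n + k)) by lia.
    generalize (quotient_step (n + k)%nat). rewrite (proj1 (Z k)).
    unfold Rdiv at 3. lra. }
  assert (W0 : u n / A n = 0).
  { apply (is_lim_seq_incr_n _ n) in Hlim.
    apply (is_lim_seq_ext _ (fun _ => u n / A n)) in Hlim.
    - apply is_lim_seq_unique in Hlim. rewrite Lim_seq_const in Hlim. now injection Hlim.
    - intros k. rewrite Nat.add_comm. apply W. }
  apply Hu0, (recurrence_backward u n Hu). intros m Hm.
  specialize (W (m - n)%nat). replace (n + (m - n))%nat with m in W by lia.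
  rewrite W0 in W. assert (P := dominant_pos m).
  replace (u m) with (u m / A m * A m) by (field; lra). rewrite W; ring.
Qed.

(** u(n)/A(n) is minus the tail of the series of its differences d(m)/A(m + 1),
    which is dominated by its first term as A grows at least by the factor 30. *)
Lemma recessive_upper q : sqrt p < q < 1 ->
  exists C N, forall n, (N <= n)%nat -> Rabs (u n) <= C * q ^ n.
Proof.
  intros Hq.
  destruct (qform_upper s p _ _ d q Hs Hp reduced_sigma reduced_pi reduced_recurrence
              (proj1 Hq)) as (C & N & HC & HN).
  assert (Hsp := sqrt_pos p).
  exists C, (N + 1)%nat. intros n Hn.
  assert (K : forall k m, (N + 1 <= m)%nat ->
    Rabs (u m / A m - u (m + k)%nat / A (m + k)%nat) <= C * q ^ m / A m).
  { induction k as [|k IH]; intros m Hm.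
    - rewrite Nat.add_0_r, Rminus_diag, Rabs_R0.
      apply Rmult_le_pos; [apply Rmult_le_pos; [easy|apply pow_le; lra]|].
      apply Rlt_le, Rinv_0_lt_compat, dominant_pos.
    - specialize (IH (S m) ltac:(lia)).
      replace (m + S k)%nat with (S m + k)%nat by lia.
      replace (u m / A m - u (S m + k)%nat / A (S m + k)%nat)
        with (- (u (S m) / A (S m) - u m / A m)
              + (u (S m) / A (S m) - u (S m + k)%nat / A (S m + k)%nat)) by ring.
      eapply Rle_trans; [apply Rabs_triang|]. rewrite Rabs_Ropp, quotient_step.
      assert (P0 := dominant_pos m). assert (P1 := dominant_pos (S m)).
      assert (G : 30 * A m <= A (S m)).
      { destruct m as [|m]; [lia|]. generalize (proj2 (HA1 m)).
        now replace (m + 1)%nat with (S m) by lia; replace (m + 2)%nat with (S (S m)) by lia. }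
      assert (D := HN m ltac:(lia)).
      assert (Hqm : 0 < q ^ m) by (apply pow_lt; lra).
      unfold Rdiv at 1. rewrite Rabs_mult, Rabs_inv, (Rabs_pos_eq (A (S m))) by lra.
      assert (I : / A (S m) <= / 30 * / A m).
      { rewrite <- Rinv_mult. apply Rinv_le_contravar; lra. }
      assert (I0 : 0 < / A (S m)) by now apply Rinv_0_lt_compat.
      assert (I1 : 0 < / A m) by now apply Rinv_0_lt_compat.
      unfold Rdiv in *. cbn [pow] in IH.
      assert (T1 : Rabs (d m) * / A (S m) <= C * q ^ m * (/ 30 * / A m)).
      { apply Rmult_le_compat; try lra. apply Rabs_pos. }
      assert (T2 : C * (q * q ^ m) * / A (S m) <= C * q ^ m * (/ 30 * / A m)).
      { apply Rmult_le_compat; try lra.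
        - apply Rmult_le_pos; [easy|nra].
        - apply Rmult_le_compat_l; [easy|nra]. }
      assert (0 <= C * q ^ m * / A m) by (repeat apply Rmult_le_pos; lra).
      lra. }
  assert (P := dominant_pos n).
  assert (F : Rabs (u n / A n) <= C * q ^ n / A n).
  { destruct (Rle_lt_dec (Rabs (u n / A n)) (C * q ^ n / A n)) as [|Hlt]; [easy|exfalso].
    destruct (is_lim_seq_eventually _ _ (Rabs (u n / A n) - C * q ^ n / A n) Hlim ltac:(lra))
      as [M HM].
    specialize (HM (n + M)%nat ltac:(lia)). rewrite Rminus_0_r in HM.
    specialize (K M n Hn).
    generalize (Rabs_triang_inv (u n / A n) (u (n + M)%nat / A (n + M)%nat)). lra. }
  unfold Rdiv in F. rewrite Rabs_mult, Rabs_inv, (Rabs_pos_eq (A n)) in F by lra.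
  apply Rmult_le_reg_r with (/ A n); [now apply Rinv_0_lt_compat|easy].
Qed.

(** A smaller u would make d, hence the quadratic form, too small. *)
Lemma recessive_not_smaller q N : 0 < q < sqrt p ->
  (forall n, (N <= n)%nat -> Rabs (u n) <= q ^ n) -> False.
Proof.
  intros Hq H.
  assert (Esp := sqrt_sqrt p ltac:(lra)).
  set (q' := (q + sqrt p) / 2).
  destruct (qform_lower s p _ _ d Hs Hp reduced_sigma reduced_pi reduced_recurrence
              reduced_nonzero q' ltac:(unfold q'; lra)) as (c & N1 & Hc & HN1).
  destruct (is_lim_seq_eventually _ _ 1 HLA Rlt_0_1) as [N2 HN2].
  assert (Hq1 : q < 1) by nra.
  assert (D : forall n, (N + N2 <= n)%nat -> Rabs (d n) <= 104 * q ^ n).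
  { intros n Hn. unfold d, Rminus.
    eapply Rle_trans; [apply Rabs_triang|]. rewrite Rabs_Ropp, Rabs_mult.
    specialize (HN2 n ltac:(lia)). fold (rho n) in HN2. apply Rabs_def2 in HN2.
    rewrite (Rabs_pos_eq (rho n)) by lra.
    generalize (H n ltac:(lia)) (H (n + 1)%nat ltac:(lia)) (Rabs_pos (u n)).
    rewrite pow_add, pow_1. intros U0 U1 U2.
    assert (0 < q ^ n) by (apply pow_lt; lra). nra. }
  destruct (geom_eventually (40000 / c) ((q / q') ^ 2)) as [N3 HN3].
  { assert (0 <= q / q' < 1).
    { split; [apply Rlt_le, Rdiv_lt_0_compat; unfold q'; lra|].
      apply Rmult_lt_reg_r with q'; [unfold q'; lra|].
      unfold Rdiv; rewrite Rmult_assoc, Rinv_l by (unfold q'; lra). unfold q'; lra. }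
    nra. }
  set (n := (N + N1 + N2 + N3)%nat).
  specialize (HN1 n ltac:(unfold n; lia)). specialize (HN3 n ltac:(unfold n; lia)).
  assert (D0 := D n ltac:(unfold n; lia)). assert (D1 := D (n + 1)%nat ltac:(unfold n; lia)).
  rewrite pow_add, pow_1 in D1.
  assert (Hqn : 0 < q ^ n) by (apply pow_lt; lra).
  assert (Hq'n : 0 < (q' ^ 2) ^ n) by (apply pow_lt; unfold q'; nra).
  (* 40000 > 3 * 104^2, with one square from each term of the form. *)
  assert (B : qform s p (d (n + 1)%nat) (d n) <= 40000 * (q ^ 2) ^ n).
  { replace ((q ^ 2) ^ n) with (q ^ n * q ^ n)
      by (rewrite <- pow_mult, Nat.mul_comm, pow_mult; ring).
    unfold qform.
    assert (X1 : Rabs (d (n + 1)%nat) <= 104 * q ^ n) by nra.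
    apply (pow_maj_Rabs _ _ 2) in D0, X1.
    generalize (d (n + 1)%nat) (d n) D0 X1. clear - Hs Hp Hqn. intros x y Hy Hx.
    assert (0 <= s * (x + y) ^ 2) by (apply Rmult_le_pos; [lra|apply pow2_ge_0]).
    assert (p * y ^ 2 <= y ^ 2) by (generalize (pow2_ge_0 y); nra).
    assert (s * (x ^ 2 + y ^ 2) <= x ^ 2 + y ^ 2)
      by (generalize (pow2_ge_0 y) (pow2_ge_0 x); nra).
    assert (0 <= q ^ n * q ^ n) by nra. lra. }
  unfold Rdiv in HN3; rewrite !Rpow_mult_distr in HN3.
  replace ((/ q') ^ 2) with (/ (q' ^ 2)) in HN3 by (rewrite pow_inv; easy).
  rewrite pow_inv in HN3.
  apply (Rmult_lt_compat_r (c * (q' ^ 2) ^ n)) in HN3; [|now apply Rmult_lt_0_compat].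
  replace (40000 * / c * ((q ^ 2) ^ n * / (q' ^ 2) ^ n) * (c * (q' ^ 2) ^ n))
    with (40000 * (q ^ 2) ^ n) in HN3 by (field; lra).
  lra.
Qed.

Lemma recessive_limsup : is_LimSup_seq (fun n => abs_root n (u n)) (sqrt p).
Proof.
  assert (Esp := sqrt_sqrt p ltac:(lra)). assert (Hsp : 0 < sqrt p) by (apply sqrt_lt_R0; lra).
  assert (Hsp1 : sqrt p < 0.6) by nra.
  intros eps; assert (He := cond_pos eps). split.
  - intros N.
    destruct (Classical_Prop.classic (exists n, (N <= n)%nat /\ sqrt p - eps < abs_root n (u n)))
      as [|Hno]; [easy|exfalso].
    set (q := Rmax (sqrt p - eps) (sqrt p / 2)).
    assert (Hq : 0 < q < sqrt p).
    { split; [eapply Rlt_le_trans; [|apply Rmax_r]; lra|apply Rmax_lub_lt; lra]. }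
    apply (recessive_not_smaller q (N + 1) Hq). intros n Hn.
    rewrite <- (abs_root_pow n) by lia. apply pow_incr; split; [apply abs_root_nonneg|].
    destruct (Rle_lt_dec (abs_root n (u n)) (sqrt p - eps)) as [Hle|Hlt].
    + eapply Rle_trans; [exact Hle|apply Rmax_l].
    + exfalso; apply Hno. exists n; split; [lia|easy].
  - set (e := Rmin (eps / 2) 0.1).
    assert (0 < e) by (apply Rmin_glb_lt; lra).
    assert (e <= eps / 2) by apply Rmin_l. assert (e <= 0.1) by apply Rmin_r.
    destruct (recessive_upper (sqrt p + e) ltac:(lra)) as (C & N & HN).
    destruct (root_upper u C (sqrt p + e) (sqrt p + e + e / 2) N ltac:(lra) HN) as [N' HN'].
    exists N'; intros n Hn. generalize (HN' n Hn); lra.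
Qed.

End Recessive.

(** * The characteristic polynomial *)

Lemma lambda3_ex : exists l : R, 101.341498049 <= l <= 101.3414980499 /\
  l ^ 3 - 102 * l ^ 2 + 67 * l - 27 = 0.
Proof.
  set (f := fun l => l ^ 3 - 102 * l ^ 2 + 67 * l - 27).
  destruct (IVT f 101.341498049 101.3414980499) as (l & Hl & E).
  - unfold f; reg.
  - lra.
  - unfold f; lra.
  - unfold f; lra.
  - now exists l.
Qed.

Lemma charpoly_factor (l s p w : R) (x : C) :
  l + s = 102 -> l * s + p = 67 -> l * p = 27 -> w * w = p - s * s / 4 ->
  charpoly x = ((x - RtoC l) * ((x - ((s / 2)%R, w)) * (x - ((s / 2)%R, (- w)%R))))%C.
Proof.
  intros H1 H2 H3 Hw.
  assert (Es : (((s / 2)%R, w) + ((s / 2)%R, (- w)%R))%C = RtoC s).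
  { unfold Cplus, RtoC; cbn. f_equal; field. }
  assert (Ep : (((s / 2)%R, w) * ((s / 2)%R, (- w)%R))%C = RtoC p).
  { unfold Cmult, RtoC; cbn. f_equal; [|field].
    replace p with (w * w + s * s / 4) by lra. field. }
  unfold charpoly. rewrite <- H1, <- H2, <- H3, !RtoC_plus, !RtoC_mult, <- Ep, <- Es.
  ring.
Qed.

Lemma Cmult_zero (x y : C) : (x * y)%C = RtoC 0 -> x = RtoC 0 \/ y = RtoC 0.
Proof.
  intros H. destruct (Ceq_dec x (RtoC 0)) as [E|E]; [now left|].
  destruct (Ceq_dec y (RtoC 0)) as [E'|E']; [now right|].
  exfalso; exact (Cmult_neq_0 x y E E' H).
Qed.

Lemma Cminus_zero (x y : C) : (x - y)%C = RtoC 0 -> x = y.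
Proof. intros H. replace x with ((x - y) + y)%C by ring. rewrite H. ring. Qed.

(** By Vieta the two other zeros have sum s = 102 - l and product p = 27/l, and
    s^2 < 4 p. *)
Lemma charpoly_roots : exists l s p w : R,
  101.341498049 <= l <= 101.3414980499 /\
  s = 102 - l /\ p = 27 / l /\ l * s + p = 67 /\ 0 < w /\ w * w = p - s * s / 4 /\
  (forall x : C, charpoly x = RtoC 0 <->
     x = (s / 2, w) \/ x = (s / 2, - w) \/ x = RtoC l).
Proof.
  destruct lambda3_ex as (l & Hl & E).
  set (s := 102 - l). set (p := 27 / l).
  assert (Hlp : l * p = 27) by (unfold p; field; lra).
  assert (H2 : l * s + p = 67).
  { apply Rmult_eq_reg_l with l; [|lra].
    rewrite Rmult_plus_distr_l, Hlp. unfold s. nra. }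
  assert (Hp : 0.2664 < p < 0.2665) by (split; nra).
  assert (Hd : 0 < p - s * s / 4) by (unfold s; nra).
  exists l, s, p, (sqrt (p - s * s / 4)).
  set (w := sqrt (p - s * s / 4)).
  assert (Hw : w * w = p - s * s / 4) by (apply sqrt_sqrt; lra).
  split; [easy|]. split; [easy|]. split; [easy|]. split; [easy|].
  split; [now apply sqrt_lt_R0|]. split; [easy|].
  intros x. rewrite (charpoly_factor l s p w x) by (auto; unfold s; ring). split.
  - intros H. apply Cmult_zero in H. destruct H as [H|H].
    + right; right. now apply Cminus_zero.
    + apply Cmult_zero in H. destruct H as [H|H]; apply Cminus_zero in H; auto.
  - intros [-> | [-> | ->]]; ring.
Qed.

(** All four digit strings follow from the enclosure of l of width below 10^-9. *)
Lemma trunc8_roots l s p w :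
  101.341498049 <= l <= 101.3414980499 -> s = 102 - l -> p = 27 / l -> 0 < w ->
  w * w = p - s * s / 4 ->
  trunc8 (s / 2) 0.32925097 /\ trunc8 w 0.39751691 /\ trunc8 (sqrt p) 0.51616460 /\
  trunc8 l 101.34149804.
Proof.
  intros Hl Hs Hp Hw Eq.
  assert (Hlp : l * p = 27) by (rewrite Hp; field; lra).
  assert (Hp0 : 0 < p) by (rewrite Hp; apply Rdiv_lt_0_compat; lra).
  assert (Hp1 : 0.266425901 < p < 0.266425902) by (split; nra).
  assert (Hsq : 0 < sqrt p) by now apply sqrt_lt_R0.
  assert (Eq' := sqrt_sqrt p ltac:(lra)).
  unfold trunc8. repeat split; try lra; nra.
Qed.

(** * The theorem *)

Lemma geometric_lower u : (forall n, 0 < u (n + 1)%nat /\ 30 * u (n + 1)%nat <= u (n + 2)%nat) ->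
  forall n, u 1%nat * 30 ^ n <= u (n + 1)%nat.
Proof.
  intros G n; induction n as [|n IH]; [cbn; lra|].
  destruct (G n) as [_ H]. replace (S n + 1)%nat with (n + 2)%nat by lia.
  cbn [pow]. lra.
Qed.

(** At most 15^n, up to a polynomial factor, against a multiple of 30^n. *)
Lemma quotient_lim u K : 0 <= K ->
  (forall n, Rabs (u n) <= K * (INR n + 1) ^ 2 * 15 ^ n) ->
  (forall n, a 1%nat * 30 ^ n <= a (n + 1)%nat) -> 0 < a 1%nat ->
  is_lim_seq (fun n => u n / a n) 0.
Proof.
  intros HK Hu Ha Ha1. apply (is_lim_seq_incr_1 (fun n => u n / a n)).
  set (c := K * 15 / a 1%nat).
  assert (L : is_lim_seq (fun n => c * ((/ 2) ^ n * (INR (S n) + 1) ^ 2)) 0).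
  { replace (Finite 0) with (Finite (c * 0)) by (f_equal; ring).
    apply is_lim_seq_mult'; [apply is_lim_seq_const|].
    apply ex_series_lim_0, poly_growth_ex_series; [|rewrite Rabs_pos_eq; lra].
    apply (poly_growth_S (fun n => (INR n + 1) ^ 2)). cbn [pow].
    assert (P : poly_growth (fun n => INR n + 1))
      by (apply poly_growth_plus; [apply poly_growth_INR|apply poly_growth_const]).
    repeat apply poly_growth_mult; try exact P. apply poly_growth_const. }
  apply (is_lim_seq_abs_0 (fun n => u (S n) / a (S n))).
  apply (is_lim_seq_le_le (fun _ => 0) _ (fun n => c * ((/ 2) ^ n * (INR (S n) + 1) ^ 2)));
    [|apply is_lim_seq_const|exact L].
  intros n; split; [apply Rabs_pos|].
  specialize (Ha n). rewrite Nat.add_1_r in Ha.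
  assert (H30 : 0 < 30 ^ n) by (apply pow_lt; lra).
  assert (Hpos : 0 < a 1%nat * 30 ^ n) by now apply Rmult_lt_0_compat.
  unfold Rdiv at 1; rewrite Rabs_mult, Rabs_inv, (Rabs_pos_eq (a (S n))) by lra.
  apply Rle_trans with (K * (INR (S n) + 1) ^ 2 * 15 ^ S n * / (a 1%nat * 30 ^ n)).
  - apply Rmult_le_compat; [apply Rabs_pos|apply Rlt_le, Rinv_0_lt_compat; lra|apply Hu|].
    apply Rinv_le_contravar; lra.
  - right. unfold c. replace 30 with (15 * 2) by ring.
    rewrite Rpow_mult_distr, pow_inv. cbn [pow]. field.
    repeat split; try apply pow_nonzero; lra.
Qed.

Theorem theorem3 :
  (forall n : nat,
     filterlim (rgen n) (at_right (-1)) (locally (r n)) /\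
     filterlim (rtgen n) (at_right (-1)) (locally (rt n)) /\
     r n = a n * (PI ^ 2 / 12) - b n /\
     rt n = a n * (3 * zeta 3 / 2) - bt n) /\
  (recurrence a /\ recurrence b /\ recurrence bt /\
   recurrence r /\ recurrence rt) /\
  (a 0 = 1 /\ a 1 = 8 /\ a 2 = 264) /\
  (b 0 = 0 /\ b 1 = 13 / 2 /\ b 2 = 1737 / 8) /\
  (bt 0 = 0 /\ bt 1 = 29 / 2 /\ bt 2 = 7617 / 16) /\
  exists (lambda1 lambda2 : C) (lambda3 : R),
    (forall x : C, charpoly x = RtoC 0 <->
       x = lambda1 \/ x = lambda2 \/ x = RtoC lambda3) /\
    lambda2 = Cconj lambda1 /\
    trunc8 (Re lambda1) 0.32925097 /\
    trunc8 (Im lambda1) 0.39751691 /\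
    Cmod lambda1 = Cmod lambda2 /\
    trunc8 (Cmod lambda1) 0.51616460 /\
    trunc8 lambda3 101.34149804 /\
    is_LimSup_seq (fun n => abs_root n (r n)) (Cmod lambda1) /\
    is_LimSup_seq (fun n => abs_root n (rt n)) (Cmod lambda1) /\
    is_lim_seq (fun n => abs_root n (a n)) lambda3 /\
    is_lim_seq (fun n => abs_root n (b n)) lambda3 /\
    is_lim_seq (fun n => abs_root n (bt n)) lambda3.
Proof.
  destruct values_0 as (a0 & r0 & rt0).
  destruct values_1 as (a1 & r1 & rt1).
  destruct values_2 as (a2 & r2 & rt2).
  assert (Hb : b 0 = 0 /\ b 1 = 13 / 2 /\ b 2 = 1737 / 8).
  { unfold b. rewrite a0, a1, a2, r0, r1, r2. repeat split; lra. }
  assert (Hbt : bt 0 = 0 /\ bt 1 = 29 / 2 /\ bt 2 = 7617 / 16).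
  { unfold bt. rewrite a0, a1, a2, rt0, rt1, rt2. repeat split; lra. }
  split.
  { intros n. split; [apply abel_Rn|]. split; [apply abel_Derive_Rn|].
    unfold b, bt; split; ring. }
  split.
  { repeat split; [apply recurrence_a|apply recurrence_b|apply recurrence_bt
      |apply recurrence_r|apply recurrence_rt]. }
  split; [easy|]. split; [easy|]. split; [easy|].
  destruct charpoly_roots as (l & s & p & w & Hl & Hs & Hp & H67 & Hw & Ew & Hroots).
  destruct (trunc8_roots l s p w Hl Hs Hp Hw Ew) as (T1 & T2 & T3 & T4).
  assert (Hmod : forall v, v * v = w * w -> Cmod (s / 2, v) = sqrt p).
  { intros v Ev. unfold Cmod; cbn [fst snd]. f_equal.
    replace (v ^ 2) with (v * v) by ring. rewrite Ev, Ew. field. }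
  exists (s / 2, w), (s / 2, - w), l.
  assert (Hcub : l ^ 3 - 102 * l ^ 2 + 67 * l - 27 = 0).
  { assert (l * p = 27) by (rewrite Hp; field; lra). rewrite <- H67.
    replace (102 * l ^ 2) with (l ^ 2 * (l + s)) by (rewrite Hs; ring). nra. }
  assert (Ga := growth_30 a recurrence_a ltac:(lra) ltac:(lra) ltac:(lra)).
  assert (root : forall u, recurrence u -> 0 <= u 0%nat -> 0 < u 1%nat ->
            30 * u 1%nat <= u 2%nat -> is_lim_seq (fun n => abs_root n (u n)) l).
  { intros u Hu u0 u1 u2. apply (ratio_root u l 1); [lra| |].
    - intros n Hn. destruct (growth_30 u Hu u0 u1 u2 (n - 1)) as (_ & P & _).
      now replace (n - 1 + 1)%nat with n in P by lia.
    - apply ratio_lim; auto; lra. }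
  assert (Hpp : 0.2664 < p < 0.2665).
  { assert (l * p = 27) by (rewrite Hp; field; lra). split; nra. }
  assert (rec : forall u, recurrence u -> u 0%nat <> 0 ->
            (exists K, 0 <= K /\ forall n, Rabs (u n) <= K * (INR n + 1) ^ 2 * 15 ^ n) ->
            is_LimSup_seq (fun n => abs_root n (u n)) (sqrt p)).
  { intros u Hu u0 (K & HK & HuK).
    apply (recessive_limsup a l s p); auto; try lra.
    - apply recurrence_a.
    - intros n; apply Ga.
    - apply ratio_lim; [apply recurrence_a|..]; lra.
    - apply (quotient_lim u K HK HuK); [|lra].
      apply geometric_lower. intros n; apply Ga. }
  assert (HC : 0 <= bound_const).
  { generalize (r_bound 0) (Rabs_pos (r 0)). cbn. lra. }
  split; [exact Hroots|]. split; [easy|]. split; [exact T1|]. split; [exact T2|].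
  rewrite (Hmod w eq_refl), (Hmod (- w) ltac:(ring)).
  split; [easy|]. split; [exact T3|]. split; [exact T4|].
  split; [|split; [|split; [|split]]].
  - apply rec; [apply recurrence_r| |].
    + rewrite r0. assert (HPI := PI_RGT_0).
      assert (0 < PI ^ 2) by (apply pow_lt; lra). lra.
    + exists bound_const; split; [easy|]. intros n.
      eapply Rle_trans; [apply r_bound|].
      apply Rmult_le_compat_r; [apply pow_le; lra|].
      apply Rmult_le_compat_l; [easy|]. generalize (pos_INR n); nra.
  - apply rec; [apply recurrence_rt| |].
    + rewrite rt0. generalize zeta_3_pos; lra.
    + exists (7 * bound_const); split; [lra|]. intros n.
      eapply Rle_trans; [apply rt_bound|].
      assert (Hn := pos_INR n).
      replace ((7 * INR n + 4) * (bound_const * (INR n + 1) * 15 ^ n))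
        with (bound_const * ((7 * INR n + 4) * (INR n + 1)) * 15 ^ n) by ring.
      replace (7 * bound_const * (INR n + 1) ^ 2 * 15 ^ n)
        with (bound_const * (7 * (INR n + 1) ^ 2) * 15 ^ n) by ring.
      apply Rmult_le_compat_r; [apply pow_le; lra|].
      apply Rmult_le_compat_l; [easy|]. nra.
  - apply root; [apply recurrence_a|lra|lra|lra].
  - apply root; [apply recurrence_b|lra|lra|lra].
  - apply root; [apply recurrence_bt|lra|lra|lra].
Qed.
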